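(* Let $d\ge 1$, $\sigma\geq 0$ and let $s,s_0$ be such that $s+\frac12\in\mathbb{N}$, $s_0\in\mathbb{N}$ and $s-\frac32\geq s_0>\frac{d+1}{2}$. Then there exists $\epsilon_0=\epsilon_0(s)>0$ such that the Dirichlet-Neumann operator map $$\eta\mapsto G(\eta),\qquad H^{\sigma,s}\cap B^{\sigma,s_0+\frac32}(\epsilon_0)\to \mathcal{L}(H^{\sigma,s},H^{\sigma,s-1}),$$ is analytic and fulfills the tame estimate $$\|G(\eta)\psi\|_{H^{\sigma,s-1}}\leq C(s)\big(\|\psi\|_{H^{\sigma,s}}+\|\eta\|_{H^{\sigma,s}}\|\psi\|_{H^{\sigma,s_0+\frac32}}\big).$$
   Context: Notation: $\mathbb{N}=\{1,2,\dots\}$, $\mathbb{T}^d=(\mathbb{R}/2\pi\mathbb{Z})^d$; $\nabla=(\partial_{x_1},\dots,\partial_{x_d})$, $\Delta=\sum_{j=1}^d\partial_{x_j}^2$, $\Delta_{x,y}=\Delta+\partial_y^2$. For $k\in\mathbb{Z}^d$, $|k|_1=|k_1|+\dots+|k_d|$, $|k|$ is the Euclidean norm and $\langle k\rangle=\max(1,|k|)$. For $\sigma\ge0$, $s\in\mathbb{R}$, $$H^{\sigma,s}=H^{\sigma,s}(\mathbb{T}^d)=\Big\{u(x)=\sum_{k\in\mathbb{Z}^d}u_ke^{\mathrm{i}k\cdot x}:\ \|u\|_{H^{\sigma,s}}^2=\sum_{k\in\mathbb{Z}^d}e^{2\sigma|k|_1}\langle k\rangle^{2s}|u_k|^2<\infty\Big\},$$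 and $B^{\sigma,s}(r)$ is the open ball of $H^{\sigma,s}$ with center $0$ and radius $r>0$. $H^{\sigma,s}\cap B^{\sigma,s_0+\frac32}(\epsilon_0)$ is open in the $H^{\sigma,s}$ topology. $\mathcal{L}(X,Y)$ is the Banach space of bounded linear operators from $X$ to $Y$. The functions $\eta$ are real-valued (they describe the boundary of a domain). Dirichlet-Neumann operator: let $\mathcal{D}_\eta=\{(x,y)\in\mathbb{T}^d\times\mathbb{R}: y<\eta(x)\}$. Given a periodic function $\psi(x)$, let $\Phi(x,y)$ be the unique harmonic function solving $$\Delta_{x,y}\Phi=0\ \text{in }\mathcal{D}_\eta,\qquad \Phi(x,\eta(x))=\psi(x),\qquad \partial_y\Phi(x,y)\to0\ \text{as }y\to-\infty .$$ The Dirichlet-Neumann operator is the linear operator $$[G(\eta)\psi](x)=(\partial_y\Phi)(x,\eta(x))-\nabla\eta(x)\cdot(\nabla\Phi)(x,\eta(x)).$$ *)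

(* Defs.v *)
From HB Require Import structures.
From mathcomp Require Import all_boot all_order all_algebra.
From mathcomp Require Import all_classical all_reals all_analysis.
From mathcomp Require Import ring complex.
From mathcomp Require summability.

Set Implicit Arguments.
Unset Strict Implicit.
Unset Printing Implicit Defensive.

Import Order.TTheory GRing.Theory Num.Theory.
Import numFieldNormedType.Exports.
Import ComplexField.Normc.

Local Open Scope classical_set_scope.
Local Open Scope ring_scope.

(* Complex scalars are taken in [Rcomplex R], the copy of [R[i]] that is a real
   vector space, and are equipped with the real-valued modulus [normc]; this
   makes ['D_v] and limits available for complex-valued functions of real
   variables. *)
Section rcomplex_normed.
Variable R : realType.

Lemma rcomplex_normrZ (a : R) (z : Rcomplex R) : `|a *: z| = `|a| * `|z|.
Proof.
case: z => x y; rewrite /Num.norm /=.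
by rewrite !exprMn -mulrDr sqrtrM ?sqr_ge0// sqrtr_sqr.
Qed.

HB.instance Definition _ :=
  PseudoMetric.copy (Rcomplex R) (pseudoMetric_normed (Rcomplex R)).
HB.instance Definition _ := isPointed.Build (Rcomplex R) 0.
HB.instance Definition _ :=
  NormedZmod_PseudoMetric_eq.Build R (Rcomplex R) erefl.
HB.instance Definition _ :=
  PseudoMetricNormedZmod_Lmodule_isNormedModule.Build R (Rcomplex R)
    rcomplex_normrZ.

Lemma normc_ge0 (z : R[i]) : 0 <= normc z.
Proof. by case: z => x y; exact: sqrtr_ge0. Qed.

Lemma normcZ (a : R) (z : Rcomplex R) : normc (a *: z) = `|a| * normc z.
Proof. exact: rcomplex_normrZ. Qed.

Lemma scalerc (a : R) (z : Rcomplex R) : a *: z = (a%:C)%C * z.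
Proof.
case: z => x y; apply/eqP; rewrite eq_complex /=.
by rewrite !mul0r subr0 addr0 !eqxx.
Qed.

End rcomplex_normed.

Section analytic.
Variables (R : realType) (X Y : normedModType R).

Definition multilinear n (A : ('I_n -> X) -> Y) := forall (i : 'I_n) x,
  linear (fun h => A (fun j => if j == i then h else x j)).

Definition analytic_at (f : X -> Y) (x0 : X) :=
  exists (A : forall n, ('I_n -> X) -> Y) (a : R^nat) (r : R),
  [/\ forall n, multilinear (@A n),
      forall n x, `|A n x| <= a n * \prod_(i < n) `|x i|,
      0 < r,
      cvgn (series (fun n => a n * r ^+ n)) &
      forall h, `|h| < r ->
        series (fun n => A n (fun=> h)) @ \oo --> f (x0 + h)].

Definition analytic_on (U : set X) (f : X -> Y) :=
  forall x, U x -> analytic_at f x.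

End analytic.

(* A function on the torus is represented by its family of Fourier
   coefficients, indexed by ['rV[int]_d]. *)
Section sobolev_norm.
Variables (R : realType) (d : nat).
Local Notation coef := ('rV[int]_d -> Rcomplex R).
Implicit Types (k : 'rV[int]_d) (u v : coef).

Definition norm1 k : R := \sum_(j < d) `|(k ord0 j)%:~R|.

Definition norm2 k : R := Num.sqrt (\sum_(j < d) (k ord0 j)%:~R ^+ 2).

Definition japanese k : R := Num.max 1 (norm2 k).

Definition hweight (sigma s : R) k : R :=
  expR (2 * sigma * norm1 k) * japanese k `^ (2 * s).

Definition hnorm (sigma s : R) u : \bar R :=
  sqrte (\esum_(k in setT) (hweight sigma s k * normc (u k) ^+ 2)%:E).

Variables sigma s : R.
Local Notation w := (hweight sigma s).
Let hsq u := (\esum_(k in setT) (w k * normc (u k) ^+ 2)%:E)%E.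

Lemma hweight_gt0 k : 0 < w k.
Proof.
by rewrite mulr_gt0 ?expR_gt0// powR_gt0// (lt_le_trans ltr01)// le_max lexx.
Qed.

Let wu_ge0 u k : 0 <= w k * normc (u k) ^+ 2.
Proof. by rewrite mulr_ge0 ?sqr_ge0// ltW ?hweight_gt0. Qed.

Lemma hnorm_ge0 u : (0 <= hnorm sigma s u)%E.
Proof. exact: sqrte_ge0. Qed.

Let hsq_ge0 u : (0 <= hsq u)%E.
Proof. by apply: esum_ge0 => k _; rewrite lee_fin wu_ge0. Qed.

Let hsqZ (c : R) u v : 0 <= c ->
  (forall k, normc (v k) ^+ 2 <= c * normc (u k) ^+ 2) ->
  (hsq v <= c%:E * hsq u)%E.
Proof.
move=> c0 vu; apply: ge_ereal_sup => _ [A finA <-].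
apply: (@le_trans _ _
    (\sum_(k \in A) (c%:E * (w k * normc (u k) ^+ 2)%:E)))%E.
  apply: lee_fsum; first by case: finA.
  by move=> k _; rewrite -EFinM lee_fin [leRHS]mulrCA ler_wpM2l// ltW// hweight_gt0.
rewrite -ge0_mule_fsumr; last by move=> k; rewrite lee_fin wu_ge0.
by rewrite lee_wpmul2l ?lee_fin//; apply: ereal_sup_ubound; exists A.
Qed.

Let le_normcD2 (t : R) (x y : R[i]) : 0 < t ->
  normc (x + y) ^+ 2 <= (1 + t) * normc x ^+ 2 + (1 + t^-1) * normc y ^+ 2.
Proof.
move=> t0; apply: (@le_trans _ _ ((normc x + normc y) ^+ 2)).
  by rewrite ler_sqr ?nnegrE ?addr_ge0 ?normc_ge0//; exact: le_normcD.
set a := normc x; set b := normc y; rewrite -subr_ge0.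
rewrite (_ : _ - _ = t * (a - t^-1 * b) ^+ 2).
  by rewrite mulr_ge0 ?sqr_ge0// ltW.
by field; rewrite gt_eqF.
Qed.

Let hsqD (t : R) u v : 0 < t ->
  (hsq (u + v)%R <= (1 + t)%:E * hsq u + (1 + t^-1)%:E * hsq v)%E.
Proof.
move=> t0; have t1 : 0 <= 1 + t by rewrite addr_ge0// ltW.
have t2 : 0 <= 1 + t^-1 by rewrite addr_ge0// ltW// invr_gt0.
pose U k : Rcomplex R := Num.sqrt (1 + t) *: u k.
pose V k : Rcomplex R := Num.sqrt (1 + t^-1) *: v k.
apply: (@le_trans _ _ (hsq U + hsq V)%E); last first.
  by apply: leeD; apply: hsqZ => // k;
    rewrite normcZ exprMn real_normK ?num_real// sqr_sqrtr.
rewrite /hsq -esumD; last 2 first.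
  by move=> k _; rewrite lee_fin wu_ge0.
  by move=> k _; rewrite lee_fin wu_ge0.
apply: le_esum => k _; rewrite -EFinD lee_fin -mulrDr ler_wpM2l//.
  by rewrite ltW ?hweight_gt0.
rewrite !normcZ !exprMn !real_normK ?num_real// !sqr_sqrtr//.
exact: le_normcD2.
Qed.

Let hsq_fin u : (hnorm sigma s u < +oo)%E -> exists2 a : R, 0 <= a &
  hsq u = (a ^+ 2)%:E /\ hnorm sigma s u = a%:E.
Proof.
move=> fu; have ge0 := hnorm_ge0 u.
exists (fine (hnorm sigma s u)); first exact: fine_ge0.
have fin : hnorm sigma s u \is a fin_num by rewrite ge0_fin_numE.
split; rewrite ?EFin_expe fineK//; rewrite sqr_sqrte//; exact: hsq_ge0.
Qed.

Let hsq0_eq0 u : hsq u = 0%E -> u = 0.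
Proof.
move=> u0; apply/funext => k /=; apply: eq0_normc; apply/eqP.
suff : w k * normc (u k) ^+ 2 == 0.
  by rewrite mulf_eq0 gt_eqF ?hweight_gt0//= sqrf_eq0.
rewrite eq_le wu_ge0 andbT -lee_fin -[leRHS]u0.
rewrite (_ : ((w k * normc (u k) ^+ 2)%:E =
    \sum_(j \in [set k]) (w j * normc (u j) ^+ 2)%:E)%E); last first.
  by rewrite fsbig_set1.
by apply: ereal_sup_ubound; exists [set k] => //; split.
Qed.

Lemma hnorm_eq0 u : hnorm sigma s u = 0%E -> u = 0.
Proof.
move=> u0; have [|a _ [ua h]] := @hsq_fin u; first by rewrite u0.
move: h; rewrite u0 => -[a0]; apply: hsq0_eq0.
by rewrite ua -a0 expr0n.
Qed.

Lemma hnorm0 : hnorm sigma s (0 : coef) = 0%E.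
Proof.
rewrite /hnorm esum1 ?sqrte0// => k _.
by rewrite (_ : (0 : coef) k = 0)// normc0 expr0n mulr0.
Qed.

Lemma hnormM (c : R) u v : 0 <= c -> (forall k, normc (v k) = c * normc (u k)) ->
  (hnorm sigma s v <= c%:E * hnorm sigma s u)%E.
Proof.
move=> c0 vu; have -> : c%:E = sqrte ((c ^+ 2)%:E).
  by rewrite /= sqrtr_sqr ger0_norm.
have c20 : (0 <= (c ^+ 2)%:E)%E by rewrite lee_fin sqr_ge0.
rewrite -sqrteM// lee_sqrt; last by rewrite mule_ge0// hsq_ge0.
by apply: hsqZ => [|k]; rewrite ?sqr_ge0// vu exprMn.
Qed.

Lemma hnormD u v : (hnorm sigma s (u + v)%R <= hnorm sigma s u + hnorm sigma s v)%E.
Proof.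
have [fu|] := ltP (hnorm sigma s u) +oo%E; last first.
  by rewrite leye_eq => /eqP ->; rewrite addye ?leey// gt_eqF//
    (lt_le_trans _ (hnorm_ge0 v)).
have [fv|] := ltP (hnorm sigma s v) +oo%E; last first.
  by rewrite leye_eq => /eqP ->; rewrite addey ?leey// gt_eqF//
    (lt_le_trans _ (hnorm_ge0 u)).
have [a a0 [ua na]] := hsq_fin fu; have [b b0 [vb nb]] := hsq_fin fv.
have [az|an] := eqVneq a 0.
  by rewrite (hsq0_eq0 (u := u)) ?add0r ?hnorm0 ?add0e// ua az expr0n.
have [bz|bn] := eqVneq b 0.
  by rewrite (hsq0_eq0 (u := v)) ?addr0 ?hnorm0 ?adde0// vb bz expr0n.
have {}a0 : 0 < a by rewrite lt_def an.
have {}b0 : 0 < b by rewrite lt_def bn.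
have := hsqD u v (divr_gt0 b0 a0); rewrite ua vb -!EFinM -EFinD => uv.
rewrite na nb -EFinD -[leRHS](_ : sqrte ((a + b) ^+ 2)%:E = _); last first.
  by rewrite /= sqrtr_sqr ger0_norm// addr_ge0// ltW.
rewrite lee_sqrt; last by rewrite lee_fin sqr_ge0.
apply: (le_trans uv); rewrite lee_fin le_eqVlt; apply/orP; left; apply/eqP.
by field; rewrite an bn.
Qed.

End sobolev_norm.

Section sobolev.
Variables (R : realType) (d : nat) (sigma s : R).
Local Notation coef := ('rV[int]_d -> Rcomplex R).

Definition sobolev_pred : {pred coef} :=
  fun u => `[< (hnorm sigma s u < +oo)%E >].

Record sobolev := Sobolev {
  hcoef :> 'rV[int]_d -> Rcomplex R ; _ : hcoef \in sobolev_pred }.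

HB.instance Definition _ := [isSub for hcoef].
HB.instance Definition _ := [Choice of sobolev by <:].

Lemma sobolev_predP (u : coef) :
  reflect (hnorm sigma s u < +oo)%E (u \in sobolev_pred).
Proof. exact: asboolP. Qed.

Lemma sobolev_submod_closed : submod_closed sobolev_pred.
Proof.
split=> [|a u v /sobolev_predP fu /sobolev_predP fv].
  by apply/sobolev_predP; rewrite hnorm0 ltry.
apply/sobolev_predP; apply: (le_lt_trans (hnormD _ _ _ _)).
rewrite lte_add_pinfty//.
apply: (@le_lt_trans _ _ (`|a|%:E * hnorm sigma s u)%E).
  by apply: hnormM => // k; exact: normcZ.
by rewrite lte_mul_pinfty ?lee_fin.
Qed.
HB.instance Definition _ :=
  GRing.isSubmodClosed.Build R coef sobolev_pred sobolev_submod_closed.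
HB.instance Definition _ := [SubChoice_isSubLmodule of sobolev by <:].

Lemma hnorm_fin (u : sobolev) : hnorm sigma s u \is a fin_num.
Proof.
by rewrite ge0_fin_numE ?hnorm_ge0//; exact/sobolev_predP/(valP u).
Qed.

Let snorm (u : sobolev) : R := fine (hnorm sigma s u).

Let snormD (u v : sobolev) : snorm (u + v) <= snorm u + snorm v.
Proof. by rewrite -lee_fin EFinD !fineK ?hnorm_fin// hnormD. Qed.

Let snormM (c : R) (u v : sobolev) : 0 <= c ->
  (forall k, normc (v k) = c * normc (u k)) -> snorm v <= c * snorm u.
Proof.
by move=> c0 vu; rewrite -lee_fin EFinM !fineK ?hnorm_fin// hnormM.
Qed.

Let snormZ (a : R) (u : sobolev) : snorm (a *: u) = `|a| * snorm u.
Proof.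
apply/eqP; rewrite eq_le; apply/andP; split.
  by apply: snormM => // k; exact: normcZ.
have [->|a0] := eqVneq a 0.
  by rewrite normr0 mul0r fine_ge0// hnorm_ge0.
rewrite mulrC -ler_pdivlMr ?normr_gt0// mulrC -normfV.
apply: snormM => // k; rewrite [(a *: u) k]/(a *: (u k)) normcZ mulrA.
by rewrite -normrM mulVf// normr1 mul1r.
Qed.

Let snorm_eq0 (u : sobolev) : snorm u = 0 -> u = 0.
Proof.
move=> u0; apply: val_inj; apply: (@hnorm_eq0 _ _ sigma s).
by rewrite -(fineK (hnorm_fin u)) -/(snorm u) u0.
Qed.

HB.instance Definition _ := Lmodule_isNormed.Build R sobolev
  snormD snormZ snorm_eq0.

Lemma sobolev_normE (u : sobolev) : (`|u|)%:E = hnorm sigma s u.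
Proof. exact: fineK (hnorm_fin u). Qed.

Lemma cscale_subproof (c : Rcomplex R) (u : sobolev) :
  (fun k => c * u k) \in sobolev_pred.
Proof.
have /sobolev_predP fu := valP u; apply/sobolev_predP.
apply: (@le_lt_trans _ _ ((normc c)%:E * hnorm sigma s u)%E).
  by apply: hnormM => [|k]; [exact: normc_ge0|exact: normcM].
by rewrite lte_mul_pinfty ?lee_fin ?normc_ge0.
Qed.

Definition cscale (c : Rcomplex R) (u : sobolev) : sobolev :=
  Sobolev (cscale_subproof c u).

Lemma scale_cscale (a : R) (u : sobolev) : a *: u = cscale (a%:C)%C u.
Proof. by apply: val_inj; apply/funext => k; exact: scalerc. Qed.

Lemma cscale1 (u : sobolev) : cscale 1 u = u.
Proof. by apply: val_inj; apply/funext => k; exact: mul1r. Qed.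

Lemma cscaleDr c (u v : sobolev) : cscale c (u + v) = cscale c u + cscale c v.
Proof. by apply: val_inj; apply/funext => k; exact: mulrDr. Qed.

Lemma cscaleCA (a : R) c (u : sobolev) : a *: cscale c u = cscale c (a *: u).
Proof.
by rewrite !scale_cscale; apply: val_inj; apply/funext => k; exact: mulrCA.
Qed.

(* Real-valued functions are those with u_(-k) equal to the conjugate of u_k. *)
Definition real_valued : {pred sobolev} :=
  fun u => `[< forall k, u (- k) = ((u k)^*)%C >].

Record rsobolev := RSobolev {
  rval :> sobolev ; _ : rval \in real_valued }.

HB.instance Definition _ := [isSub for rval].
HB.instance Definition _ := [Choice of rsobolev by <:].

Lemma real_valued_submod_closed : submod_closed real_valued.
Proof.
split=> [|a u v /asboolP ru /asboolP rv]; apply/asboolP => k.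
  by rewrite (_ : (0 : sobolev) _ = 0) // conjc0.
have E l : (a *: u + v) l = a *: u l + v l by [].
rewrite !E ru rv; case: (u k) (v k) => x y [x' y']; apply/eqP.
by rewrite eq_complex /= mulrN opprD !eqxx.
Qed.
HB.instance Definition _ :=
  GRing.isSubmodClosed.Build R sobolev real_valued real_valued_submod_closed.
HB.instance Definition _ := [SubChoice_isSubLmodule of rsobolev by <:].

Let rnorm (u : rsobolev) : R := `|rval u|.

Let rnormD (u v : rsobolev) : rnorm (u + v) <= rnorm u + rnorm v.
Proof. exact: ler_normD. Qed.

Let rnormZ (a : R) (u : rsobolev) : rnorm (a *: u) = `|a| * rnorm u.
Proof. exact: normrZ. Qed.

Let rnorm_eq0 (u : rsobolev) : rnorm u = 0 -> u = 0.
Proof. by move=> /normr0_eq0 u0; exact: val_inj. Qed.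

HB.instance Definition _ := Lmodule_isNormed.Build R rsobolev
  rnormD rnormZ rnorm_eq0.

End sobolev.

Section bounded_operators.
Variables (R : realType) (d : nat) (sigma s sigma' s' : R).
Local Notation X := (sobolev d sigma s).
Local Notation Y := (sobolev d sigma' s').

Definition complex_linear (T : X -> Y) :=
  forall c u v, T (cscale c u + v) = cscale c (T u) + T v.

Definition bop_pred : {pred (X -> Y)} := fun T =>
  `[< complex_linear T /\ exists M : R, forall u, `|T u| <= M * `|u| >].

Record bop := Bop { bop_fun :> X -> Y ; _ : bop_fun \in bop_pred }.

HB.instance Definition _ := [isSub for bop_fun].
HB.instance Definition _ := [Choice of bop by <:].

Lemma bop_submod_closed : submod_closed bop_pred.
Proof.
split=> [|a S T /asboolP[lS [M SM]] /asboolP[lT [N TN]]]; apply/asboolP; split.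
- move=> c u v; rewrite (_ : (0 : X -> Y) (cscale c u + v) = 0)// addr0.
  by apply: val_inj; apply/funext => k; rewrite [RHS]mulr0.
- by exists 0 => u; rewrite (_ : (0 : X -> Y) u = 0)// normr0 mul0r.
- have E u : (a *: S + T) u = a *: S u + T u by [].
  move=> c u v; rewrite !E lS lT scalerDr cscaleCA cscaleDr.
  by rewrite -!addrA; congr (_ + _); rewrite addrCA.
- exists (`|a| * M + N) => u; rewrite (_ : (a *: S + T) u = a *: S u + T u)//.
  rewrite (le_trans (ler_normD _ _))// mulrDl lerD// normrZ -mulrA.
  by rewrite ler_wpM2l.
Qed.
HB.instance Definition _ :=
  GRing.isSubmodClosed.Build R (X -> Y) bop_pred bop_submod_closed.
HB.instance Definition _ := [SubChoice_isSubLmodule of bop by <:].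

Lemma bopD (T : bop) u v : T (u + v) = T u + T v.
Proof.
have /asboolP[lT _] := valP T.
by rewrite -{1}[u]cscale1 [LHS]lT cscale1.
Qed.

Lemma bop0 (T : bop) : T 0 = 0.
Proof. by apply: (addrI (T 0)); rewrite -bopD !addr0. Qed.

Lemma bopZ (T : bop) (a : R) u : T (a *: u) = a *: T u.
Proof.
have /asboolP[lT _] := valP T; rewrite !scale_cscale.
by have := lT (a%:C)%C u 0; rewrite !addr0 [X in _ + X]bop0 addr0.
Qed.

Definition opnorm (T : bop) : R := sup [set `|T u| | u in [set u | `|u| <= 1]].

Lemma opnorm_le (T : bop) (M : R) :
  (forall u, `|u| <= 1 -> `|T u| <= M) -> opnorm T <= M.
Proof.
move=> TM; apply: ge_sup => [|_ [u u1 <-]]; last exact: TM.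
by exists `|T 0|, 0 => //=; rewrite normr0.
Qed.

Lemma le_opnorm (T : bop) u : `|u| <= 1 -> `|T u| <= opnorm T.
Proof.
move=> u1; have /asboolP[_ [M TM]] := valP T.
apply: ub_le_sup; last by exists u.
exists `|M| => _ [v /= v1 <-]; apply: (le_trans (TM v)).
apply: le_trans (ler_wpM2r (normr_ge0 v) (ler_norm M)) _.
by rewrite ler_piMr.
Qed.

Lemma opnormP (T : bop) u : `|T u| <= opnorm T * `|u|.
Proof.
have [->|u0] := eqVneq u 0; first by rewrite bop0 !normr0 mulr0.
have n0 : 0 < `|u| by rewrite normr_gt0.
rewrite -ler_pdivrMr// mulrC -[`|u|^-1]ger0_norm ?invr_ge0//.
rewrite -normrZ -bopZ; apply: le_opnorm.
by rewrite normrZ ger0_norm ?invr_ge0// mulVf// gt_eqF.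
Qed.

Let opnormD (S T : bop) : opnorm (S + T) <= opnorm S + opnorm T.
Proof.
apply: opnorm_le => u u1; apply: (le_trans (ler_normD (S u) (T u))).
by rewrite lerD// le_opnorm.
Qed.

Let opnormZ_le (a : R) (T : bop) : opnorm (a *: T) <= `|a| * opnorm T.
Proof.
apply: opnorm_le => u u1; rewrite [(a *: T) u]/(a *: T u) normrZ.
by rewrite ler_wpM2l// le_opnorm.
Qed.

Let opnormZ (a : R) (T : bop) : opnorm (a *: T) = `|a| * opnorm T.
Proof.
have [->|a0] := eqVneq a 0.
  rewrite scale0r normr0 mul0r; apply/eqP; rewrite eq_le; apply/andP; split.
    by apply: opnorm_le => u _; rewrite (_ : (0 : bop) u = 0)// normr0.
  by rewrite -[leLHS](normr0 Y) -(bop0 0) le_opnorm// normr0.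
apply/eqP; rewrite eq_le opnormZ_le /= mulrC -ler_pdivlMr ?normr_gt0//.
rewrite mulrC -normfV; apply: le_trans (opnormZ_le _ _).
by rewrite scalerA mulVf// scale1r.
Qed.

Let opnorm_eq0 (T : bop) : opnorm T = 0 -> T = 0.
Proof.
move=> T0; apply: val_inj; apply/funext => u /=; apply: normr0_eq0.
by apply/eqP; rewrite eq_le normr_ge0 andbT -(mul0r `|u|) -T0 opnormP.
Qed.

HB.instance Definition _ := Lmodule_isNormed.Build R bop
  opnormD opnormZ opnorm_eq0.

End bounded_operators.

(* A function on the torus is a function on ['rV[R]_d], 2 pi-periodic in each
   variable.  For the regularity considered below the Fourier series converges
   unconditionally at every point. *)
Section fourier.
Variables (R : realType) (d : nat).

Definition expi (k : 'rV[int]_d) (x : 'rV[R]_d) : Rcomplex R :=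
  let t := \sum_(j < d) (k ord0 j)%:~R * x ord0 j in (cos t +i* sin t)%C.

Definition fourier (u : 'rV[int]_d -> Rcomplex R) (x : 'rV[R]_d) : Rcomplex R :=
  @summability.sum _ R (Rcomplex R) (fun k => u k * expi k x).

Definition real_fourier (u : 'rV[int]_d -> Rcomplex R) (x : 'rV[R]_d) : R :=
  complex.Re (fourier u x).

End fourier.

Section dirichlet_neumann.
Variables (R : realType) (d : nat).
Local Notation C := (Rcomplex R).
Local Notation point := ('rV[R]_d * R)%type.
Implicit Types (eta : 'rV[R]_d -> R) (psi g : 'rV[R]_d -> C) (Phi : point -> C).

Definition evec (j : 'I_d) : 'rV[R]_d := delta_mx ord0 j.

Definition dx (j : 'I_d) Phi : point -> C := 'D_((evec j, 0) : point) Phi.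

Definition dy Phi : point -> C := 'D_((0, 1) : point) Phi.

Definition laplacian Phi (p : point) : C :=
  \sum_(j < d) dx j (dx j Phi) p + dy (dy Phi) p.

Definition below eta : set point := [set p | p.2 < eta p.1].

Definition closed_below eta : set point := [set p | p.2 <= eta p.1].

(* Only meant for an open set D. *)
Definition C1_on (D : set point) Phi := forall v p, D p ->
  derivable Phi p v /\ {for p, continuous ('D_v Phi)}.

Definition C2_on (D : set point) Phi :=
  C1_on D Phi /\ forall v, C1_on D ('D_v Phi).

Definition harmonic_on (D : set point) Phi :=
  C2_on D Phi /\ forall p, D p -> laplacian Phi p = 0.

Definition x_periodic_on (D : set point) Phi := forall x y j, D (x, y) ->
  Phi (x + (2 * pi) *: evec j, y) = Phi (x, y).

(* The decay as y tends to -oo is uniform in x. *)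
Definition is_potential eta psi Phi :=
  [/\ x_periodic_on (closed_below eta) Phi,
      harmonic_on (below eta) Phi,
      {within closed_below eta, continuous Phi},
      forall x, Phi (x, eta x) = psi x &
      forall e, 0 < e ->
        \forall y \near -oo, forall x, normc (dy Phi (x, y)) < e].

Definition is_the_potential eta psi Phi :=
  is_potential eta psi Phi /\
  forall Phi', is_potential eta psi Phi' -> {in closed_below eta, Phi' =1 Phi}.

(* Boundary values of derivatives are limits from inside the domain. *)
Definition trace eta (f : point -> C) (h : 'rV[R]_d -> C) := forall x,
  f p @[p --> within (below eta) (nbhs (x, eta x))] --> h x.

Definition is_dirichlet_neumann eta psi g :=
  exists Phi (hx : 'I_d -> 'rV[R]_d -> C) (hy : 'rV[R]_d -> C),
  [/\ is_the_potential eta psi Phi,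
      forall j, trace eta (dx j Phi) (hx j),
      trace eta (dy Phi) hy &
      forall x, g x = hy x - \sum_(j < d) 'D_(evec j) eta x *: hx j x].

End dirichlet_neumann.

Section sobolev_ball.
Variables (R : realType) (d : nat).

Definition sobolev_ball (sigma s r : R) : set ('rV[int]_d -> Rcomplex R) :=
  [set u | (hnorm sigma s u < r%:E)%E].

End sobolev_ball.

(* Main.v *)
Require Import Defs.
From HB Require Import structures.
From mathcomp Require Import all_boot all_order all_algebra.
From mathcomp Require Import all_classical all_reals all_analysis.
From mathcomp Require Import complex.
From mathcomp Require Import ring lra finmap zify.

Set Implicit Arguments.
Unset Strict Implicit.
Unset Printing Implicit Defensive.

Import Order.TTheory GRing.Theory Num.Theory.
Import numFieldNormedType.Exports.
Import ComplexField.Normc.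

Local Open Scope classical_set_scope.
Local Open Scope ring_scope.

(** Why the theorem holds.  Measure the depth below the surface by
[t = eta x - y] and expand in Fourier series in [x].  Let [b] and [V] be the
vertical and horizontal velocities of the potential, [phi] the potential
itself, and [N = b - grad eta . V] the flux, whose value at [t = 0] is the
Dirichlet-Neumann operator.  With [g = grad eta . V] and [e = b grad eta],
harmonicity is the first-order system
[phi' = - (N + g)], [N' = div V], [V = grad phi - e].
For a frequency [k], the combinations [u = N - |k| phi] and [w = N + |k| phi]
satisfy [u' = |k| u + |k| g - div e] and [w' = - |k| w - |k| g - div e].
The first must be the bounded solution; the initial value of the second is
given by the boundary value [psi] and by [u].  Sources of size [|k|] are
divided by [|k|], so the velocities solve [X = flat psi + op eta X], where
[op] is bilinear, of order zero in [X], and costs one derivative of [eta]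
([mode_solve_bounded], [op_tame]).

The norm of [X] is the Sobolev norm of index [s - 1] of the suprema over
[t >= 0] of [e^(t/2) |X_k t|].  The tame convolution estimate [tame_conv]
bounds [op eta] by [1/2] in a low norm when [eta] is small in the norm of
index [s0 + 3/2], and by [1/2] plus a multiple of the low norm, linear in
[eta], in the high norm; [neumann_exists] then solves the equation with a
bound linear in the norm of [eta].  This is the tame estimate.  The constants
do not depend on [sigma] because the weight [e^(sigma |k|)] is
submultiplicative.  Since [op] is linear in [eta], the inverse of
[1 - op eta] has a convergent power series ([dno_analytic]).

It remains to recognize the boundary flux as the Dirichlet-Neumann operator.
The lower bound on [s0] makes the Fourier series of the velocities and of
their first derivatives converge absolutely.  The series built on [phi] is
continuous up to the surface and has gradient [(V, b)] below it.  The
vertical velocity solves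
[(1 + |grad eta|^2) b = N + grad eta . grad_x phi], a formula that makes it
differentiable, and the Laplacian vanishes by algebra ([harmonic_below],
[potential_exists]).  The potential is unique by a maximum principle on one
period of the domain ([potential_unique]): subtracting the solutions and
adding small multiples of [y - H] and of the square of [y - Y] would produce
an interior maximum with positive Laplacian. *)

Lemma normrcE (R : realType) (z : Rcomplex R) : `|z| = normc z.
Proof. by []. Qed.

(** * Unordered sums of complex numbers *)

Section unordered_sums.
Variables (R : realType) (I : choiceType).
Local Notation C := (Rcomplex R).
Implicit Types (f g : I -> R) (u v : I -> C).
Definition psum u (A : {fset I}) : C := \sum_(i <- A) u i.
Definition csum u : C := @summability.sum I R C u.
Definition nsum f : \bar R := \esum_(i in setT) (f i)%:E.
Lemma partial_sumE u : @summability.partial_sum I C u = psum u.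
Proof. by apply/funext => A; rewrite /summability.partial_sum /psum big_seq_fsetE. Qed.

Lemma nsum_ge0 f : (forall i, 0 <= f i) -> (0 <= nsum f)%E.
Proof. by move=> f0; apply: esum_ge0 => i _; rewrite lee_fin. Qed.

Lemma le_nsum f g : (forall i, f i <= g i) -> (nsum f <= nsum g)%E.
Proof. by move=> fg; apply: le_esum => i _; rewrite lee_fin. Qed.

Lemma nsumD f g : (forall i, 0 <= f i) -> (forall i, 0 <= g i) ->
  nsum (fun i => f i + g i) = (nsum f + nsum g)%E.
Proof.
by move=> f0 g0; rewrite /nsum -esumD// => i _; rewrite lee_fin.
Qed.

Lemma fsum_le_nsum f (A : {fset I}) : (forall i, 0 <= f i) ->
  ((\sum_(i <- A) f i)%:E <= nsum f)%E.
Proof.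
move=> f0; apply: esum_ge; exists [set` A]; first by split.
by rewrite fsbig_finite//= set_fsetK sumEFin.
Qed.

Lemma nsum_le f (M : \bar R) :
  (forall A : {fset I}, ((\sum_(i <- A) f i)%:E <= M)%E) -> (nsum f <= M)%E.
Proof.
move=> fM; apply: ge_ereal_sup => _ [A [/finite_fsetP[B ->] _] <-].
by rewrite fsbig_finite//= set_fsetK sumEFin.
Qed.

Lemma le_nsum1 f i : (forall i, 0 <= f i) -> ((f i)%:E <= nsum f)%E.
Proof.
by move=> f0; have := fsum_le_nsum [fset i]%fset f0; rewrite big_seq_fset1.
Qed.

Lemma nsumZ_le f (c : R) : 0 <= c -> (forall i, 0 <= f i) ->
  (nsum (fun i => c * f i)%R <= c%:E * nsum f)%E.
Proof.
move=> c0 f0; apply: nsum_le => A; rewrite -mulr_sumr EFinM.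
by rewrite lee_wpmul2l ?lee_fin// fsum_le_nsum.
Qed.

Lemma nsumZ f (c : R) : 0 <= c -> (forall i, 0 <= f i) ->
  nsum (fun i => c * f i) = (c%:E * nsum f)%E.
Proof.
move=> c0 f0; apply/eqP; rewrite eq_le nsumZ_le//=.
have [->|cn] := eqVneq c 0.
  by rewrite mul0e; apply: nsum_ge0 => i; rewrite mul0r.
have ci : 0 <= c^-1 by rewrite invr_ge0.
have := @nsumZ_le (fun i => c * f i) _ ci (fun i => mulr_ge0 c0 (f0 i)).
under [X in (nsum X <= _)%E -> _]eq_fun do rewrite mulKf//.
have c0' : (0 <= c%:E)%E by rewrite lee_fin.
move=> /(lee_wpmul2l c0')/le_trans; apply.
by rewrite muleA -EFinM divff// mul1e.
Qed.

(** This tail estimate is what makes dominated convergence work for sums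
without an enumeration of the index set. *)
Lemma nsum_tail f : (forall i, 0 <= f i) -> (nsum f < +oo)%E ->
  forall e : R, 0 < e -> exists A : {fset I},
    (nsum (fun i => if i \in A then 0 else f i)%R < e%:E)%E.
Proof.
move=> f0 foo e e0.
have fin : nsum f \is a fin_num by rewrite ge0_fin_numE// nsum_ge0.
have : (nsum f - e%:E < nsum f)%E by rewrite lteBlDr// -(fineK fin) -EFinD lte_fin ltrDl.
move=> /ereal_sup_gt[_ [X [/finite_fsetP[A ->] _] <-]].
rewrite fsbig_finite//= set_fsetK sumEFin => h; exists A.
have E : nsum f = (nsum (fun i => if i \in A then 0 else f i)%R + nsum (fun i => if i \in A then f i else 0)%R)%E.
  rewrite -nsumD => [|i|i]; last 2 first.
  - by case: ifP.
  - by case: ifP.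
  by congr nsum; apply/funext => i; case: ifP => _; rewrite ?addr0 ?add0r.
have E2 : nsum (fun i => if i \in A then f i else 0) = (\sum_(i <- A) f i)%:E.
  rewrite /nsum; transitivity (\esum_(i in [set` A]) (f i)%:E).
    rewrite [RHS]esum_mkcond; apply: eq_esum => i _.
    by rewrite mem_setE; case: ifP.
  rewrite esum_fset//; first by rewrite fsbig_finite//= set_fsetK sumEFin.
  by move=> i _; rewrite lee_fin.
move: h; rewrite E E2.
have /fineK <- : nsum (fun i => if i \in A then 0 else f i) \is a fin_num.
  rewrite ge0_fin_numE; last by apply: nsum_ge0 => i; case: ifP.
  by apply: le_lt_trans foo; apply: le_nsum => i; case: ifP.
by rewrite -!EFinD !lte_fin => h; lra.
Qed.

#[local] Existing Instance summability.totally_filter.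
Definition asum u : Prop := (nsum (fun i => normc (u i)) < +oo)%E.
Lemma nsum_lty_le f g : (forall i, f i <= g i) -> (nsum g < +oo)%E ->
  (nsum f < +oo)%E.
Proof. by move=> fg; apply: le_lt_trans; exact: le_nsum. Qed.

Lemma nsum_ltyD f g : (forall i, 0 <= f i) -> (forall i, 0 <= g i) ->
  (nsum f < +oo)%E -> (nsum g < +oo)%E -> (nsum (fun i => f i + g i)%R < +oo)%E.
Proof. by move=> f0 g0 ff gf; rewrite nsumD// lte_add_pinfty. Qed.

Lemma nsum_ltyZ f (c : R) : 0 <= c -> (forall i, 0 <= f i) ->
  (nsum f < +oo)%E -> (nsum (fun i => c * f i)%R < +oo)%E.
Proof. by move=> c0 f0 ff; rewrite nsumZ// lte_mul_pinfty ?lee_fin. Qed.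

Lemma asum_le u f : (forall i, normc (u i) <= f i) -> (nsum f < +oo)%E -> asum u.
Proof. by move=> uf; exact: nsum_lty_le. Qed.

Lemma normc_Re (z : C) : `|complex.Re z| <= normc z.
Proof.
case: z => x y /=; rewrite -[leLHS]sqrtr_sqr ler_wsqrtr//.
by rewrite lerDl sqr_ge0.
Qed.

Lemma normc_Im (z : C) : `|complex.Im z| <= normc z.
Proof.
case: z => x y /=; rewrite -[leLHS]sqrtr_sqr ler_wsqrtr//.
by rewrite lerDr sqr_ge0.
Qed.

Lemma normc_le_ReIm (z : C) : normc z <= `|complex.Re z| + `|complex.Im z|.
Proof.
case: z => x y /=; rewrite -[leRHS]ger0_norm ?addr_ge0// -[leRHS]sqrtr_sqr.
rewrite ler_wsqrtr// sqrrD !real_normK ?num_real//.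
by rewrite addrAC lerDl mulrn_wge0// mulr_ge0.
Qed.

(** The definition of an unordered limit with [e] and a finite set; sums are
handled in this form, and [csum_is_csum] converts back to the filter limit. *)
Definition csum_is u S := forall e : R, 0 < e -> exists A : {fset I},
  forall B : {fset I}, (A `<=` B)%fset -> normc (S - psum u B) < e.
Lemma csum_isP u S : csum_is u S <-> psum u B @[B --> summability.totally] --> (S : C).
Proof.
split=> [h|/cvgrPdist_lt h e e0].
  apply/cvgrPdist_lt => e e0; have [A hA] := h e e0.
  by exists A => // B /= AB; rewrite normrcE; apply: hA.
have [A _ hA] := h e e0; exists A => B AB; exact: hA.
Qed.

Lemma csum_is_csum u S : csum_is u S -> csum u = S.
Proof.
move=> /csum_isP h; rewrite /csum /summability.sum partial_sumE.
exact: (cvg_lim (@norm_hausdorff R C) h).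
Qed.

Let nn_csum f : (forall i, 0 <= f i) -> (nsum f < +oo)%E ->
  forall e : R, 0 < e -> exists A : {fset I}, forall B : {fset I}, (A `<=` B)%fset ->
   `|fine (nsum f) - \sum_(i <- B) f i| < e.
Proof.
move=> f0 foo e e0.
have fin : nsum f \is a fin_num by rewrite ge0_fin_numE// nsum_ge0.
have : (nsum f - e%:E < nsum f)%E by rewrite lteBlDr// -(fineK fin) -EFinD lte_fin ltrDl.
move=> /ereal_sup_gt[_ [X [/finite_fsetP[A ->] _] <-]].
rewrite fsbig_finite//= set_fsetK sumEFin => h; exists A => B AB.
have hB := fsum_le_nsum B f0.
rewrite ger0_norm; last by rewrite subr_ge0 -lee_fin fineK.
move: h; rewrite -{1}(fineK fin) -EFinB lte_fin => h.
have : \sum_(i <- A) f i <= \sum_(i <- B) f i; last by lra.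
rewrite (big_fsetID _ [in A] B)/=.
have -> : [fset x | x in B & x \in A]%fset = A.
  apply/fsetP => x; rewrite !inE; apply/andP/idP => [[]//|xA].
  by split => //; exact: (fsubsetP AB).
by rewrite lerDl sumr_ge0.
Qed.

(** Absolute summability suffices: [u] is recovered from the three nonnegative
summable families [normc u], [normc u - Re u] and [normc u - Im u], whose
partial sums increase. *)
Lemma csumP u : asum u -> csum_is u (csum u).
Proof.
move=> au; pose n i := normc (u i).
pose f i := n i - complex.Re (u i); pose g i := n i - complex.Im (u i).
have n0 i : 0 <= n i by exact: normc_ge0.
have f0 i : 0 <= f i by rewrite subr_ge0 (le_trans (ler_norm _)) ?normc_Re.
have g0 i : 0 <= g i by rewrite subr_ge0 (le_trans (ler_norm _)) ?normc_Im.
have nf : (nsum (fun i => n i + n i)%R < +oo)%E by apply: nsum_ltyD.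
have ff : (nsum f < +oo)%E.
  apply: nsum_lty_le nf => i; rewrite lerD2l (le_trans (ler_norm _))// normrN.
  exact: normc_Re.
have gf : (nsum g < +oo)%E.
  apply: nsum_lty_le nf => i; rewrite lerD2l (le_trans (ler_norm _))// normrN.
  exact: normc_Im.
pose a := fine (nsum n); pose b := fine (nsum f); pose c := fine (nsum g).
suff h : csum_is u (Complex (a - b) (a - c)) by rewrite (csum_is_csum h).
move=> e e0; have e4 : 0 < e / 4 by rewrite divr_gt0.
have [A1 h1] := nn_csum n0 au e4; have [A2 h2] := nn_csum f0 ff e4.
have [A3 h3] := nn_csum g0 gf e4; exists (A1 `|` A2 `|` A3)%fset => B.
rewrite !fsubUset => /andP[/andP[/h1 b1 /h2 b2] /h3 b3].
apply: le_lt_trans (normc_le_ReIm _) _.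
have RE : complex.Re (psum u B) = \sum_(i <- B) n i - \sum_(i <- B) f i.
  rewrite -sumrB /psum; elim/big_rec2: _ => // i x y _; rewrite /f.
  case: (u i) y => p q [r s] /= ->; ring.
have IM : complex.Im (psum u B) = \sum_(i <- B) n i - \sum_(i <- B) g i.
  rewrite -sumrB /psum; elim/big_rec2: _ => // i x y _; rewrite /g.
  case: (u i) y => p q [r s] /= ->; ring.
case: (psum u B) RE IM => p q /= -> ->.
move: b1 b2 b3; rewrite -/a -/b -/c !ltr_norml => /andP[? ?] /andP[? ?] /andP[? ?].
have ? : `|a - b - (\sum_(i <- B) n i - \sum_(i <- B) f i)| < e / 2.
  by rewrite ltr_norml; apply/andP; split; lra.
have ? : `|a - c - (\sum_(i <- B) n i - \sum_(i <- B) g i)| < e / 2.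
  by rewrite ltr_norml; apply/andP; split; lra.
lra.
Qed.

Lemma csum_norm u : asum u -> ((normc (csum u))%:E <= nsum (fun i => normc (u i)))%E.
Proof.
move=> au; have n0 i : 0 <= normc (u i) by exact: normc_ge0.
have fin : nsum (fun i => normc (u i)) \is a fin_num by rewrite ge0_fin_numE// nsum_ge0.
rewrite -(fineK fin) lee_fin; apply/ler_addgt0Pl => e e0.
have [A hA] := csumP au e0; have {hA} := hA A (fsubset_refl _).
have : normc (psum u A) <= fine (nsum (fun i => normc (u i))).
  rewrite -lee_fin fineK//; apply: le_trans (fsum_le_nsum A n0).
  rewrite lee_fin /psum; elim/big_rec2: _ => [|i x y _ h]; first by rewrite normc0.
  by rewrite (le_trans (le_normcD _ _))// lerD2l.
have := le_normcD (csum u - psum u A) (psum u A); rewrite subrK; lra.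
Qed.

Lemma csum_norm_le u (f : I -> R) (M : R) : (forall i, normc (u i) <= f i) ->
  (nsum f <= M%:E)%E -> normc (csum u) <= M.
Proof.
move=> uf fM; rewrite -lee_fin (le_trans (csum_norm _))//.
  by apply: asum_le uf _; exact: le_lt_trans (ltry M).
by apply: le_trans fM; exact: le_nsum.
Qed.

Lemma asum0 : asum 0.
Proof.
rewrite /asum /nsum esum1 ?ltry// => i _.
by rewrite (_ : (0 : I -> C) i = 0)// normc0.
Qed.

Lemma asumD u v : asum u -> asum v -> asum (fun i => u i + v i).
Proof.
move=> au av; apply: asum_le (nsum_ltyD _ _ au av) => i //; last exact: normc_ge0.
  exact: le_normcD.
exact: normc_ge0.
Qed.

Lemma asum_additive (f : C -> C) M u : 0 <= M ->
  (forall z, normc (f z) <= M * normc z) -> asum u -> asum (f \o u).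
Proof.
move=> M0 fM au; apply: asum_le (nsum_ltyZ M0 _ au) => i; first exact: fM.
exact: normc_ge0.
Qed.

(** One continuity estimate yields compatibility of the sum with every bounded
additive map: multiplication by a scalar, conjugation, opposite. *)
Lemma csum_additive (f : C -> C) M u : {morph f : x y / x + y} -> 0 <= M ->
  (forall z, normc (f z) <= M * normc z) -> asum u -> csum (f \o u) = f (csum u).
Proof.
move=> fD M0 fM au; apply: csum_is_csum => e e0.
have M1 : 0 < M + 1 by rewrite ltr_wpDl.
have [A hA] := csumP au (divr_gt0 e0 M1); exists A => B /hA h.
have f0 : f 0 = 0 by apply: (addrI (f 0)); rewrite -fD !addr0.
have fB : f (psum u B) = psum (f \o u) B.
  by rewrite /psum (big_morph f fD f0).
have fN : f (csum u - psum u B) = f (csum u) - f (psum u B).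
  by apply: (addIr (f (psum u B))); rewrite -fD !subrK.
rewrite -fB -fN; apply: le_lt_trans (fM _) _.
apply: (@le_lt_trans _ _ ((M + 1) * normc (csum u - psum u B))).
  by rewrite ler_wpM2r ?normc_ge0// lerDl.
by rewrite mulrC -ltr_pdivlMr.
Qed.

Lemma csumD u v : asum u -> asum v -> csum (fun i => u i + v i) = csum u + csum v.
Proof.
move=> au av; apply: csum_is_csum => e e0; have e2 : 0 < e / 2 by rewrite divr_gt0.
have [A hA] := csumP au e2; have [B hB] := csumP av e2.
exists (A `|` B)%fset => D; rewrite fsubUset => /andP[/hA h1 /hB h2].
rewrite /psum big_split/= opprD addrACA; apply: le_lt_trans (le_normcD _ _) _.
by rewrite -/(psum u D) -/(psum v D) [ltRHS]splitr ltrD.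
Qed.

Lemma asumMl (c : C) u : asum u -> asum (fun i => c * u i).
Proof.
move=> au; apply: (@asum_additive (fun z => c * z) (normc c)) => //.
  exact: normc_ge0.
by move=> z; rewrite normcM.
Qed.

Lemma csumMl (c : C) u : asum u -> csum (fun i => c * u i) = c * csum u.
Proof.
move=> au; apply: (@csum_additive (fun z => c * z) (normc c)) => //.
- by move=> x y; rewrite mulrDr.
- exact: normc_ge0.
- by move=> z; rewrite normcM.
Qed.

Lemma asumN u : asum u -> asum (fun i => - u i).
Proof. by move=> au; apply: asum_le au => i; rewrite normcN. Qed.

Lemma csumN u : asum u -> csum (fun i => - u i) = - csum u.
Proof.
move=> au; apply: (@csum_additive (fun z => - z) 1) => //.
- by move=> x y; rewrite opprD.
- by move=> z; rewrite normcN mul1r.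
Qed.

Lemma csumB u v : asum u -> asum v -> csum (fun i => u i - v i) = csum u - csum v.
Proof. by move=> au av; rewrite csumD ?csumN//; exact: asumN. Qed.

Lemma asumB u v : asum u -> asum v -> asum (fun i => u i - v i).
Proof. by move=> au av; apply: asumD => //; exact: asumN. Qed.

Lemma csumZ (c : R) u : asum u -> csum (fun i => c *: u i) = c *: csum u.
Proof. by move=> au; rewrite scalerc -csumMl//; under eq_fun do rewrite scalerc. Qed.

Lemma asumZ (c : R) u : asum u -> asum (fun i => c *: u i).
Proof. by move=> au; under eq_fun do rewrite scalerc; exact: asumMl. Qed.

(** Outside a finite set the sum of [m], hence of both families, is small; on
the finite set convergence is entrywise. *)
Lemma csum_dominated (T : Type) (F : set_system T) (FF : Filter F)
    (u : T -> I -> C) (v : I -> C) (m : I -> R) :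
  (nsum m < +oo)%E -> (\forall t \near F, forall i, normc (u t i) <= m i) ->
  (forall i, normc (v i) <= m i) ->
  (forall i, u t i @[t --> F] --> v i) -> csum (u t) @[t --> F] --> (csum v : C).
Proof.
move=> mf um vm uv; have m0 i : 0 <= m i by rewrite (le_trans _ (vm i))// normc_ge0.
apply/cvgrPdist_lt => e e0; have e4 : 0 < e / 4 by rewrite divr_gt0.
have [A hA] := nsum_tail m0 mf e4.
have near_A : \forall t \near F, \sum_(i <- A) normc (v i - u t i) < e / 4.
  have : (fun t => \sum_(i <- A) normc (v i - u t i)) t @[t --> F] --> (\sum_(i <- A) (0 : R)).
    elim: (A : seq I) => [|i s ih].
      by rewrite big_nil; under eq_fun do rewrite big_nil; exact: cvg_cst.
    rewrite big_cons; under eq_fun do rewrite big_cons; apply: cvgD ih.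
    have := uv i; move/cvgrPdist_lt => h; apply/cvgrPdist_lt => d d0.
    near=> t; rewrite sub0r normrN ger0_norm ?normc_ge0//.
    by near: t; exact: h.
  rewrite big1// => /cvgrPdist_lt/(_ _ e4); apply: filterS => t.
  by rewrite sub0r normrN; apply: le_lt_trans; exact: ler_norm.
near=> t.
have ut i : normc (u t i) <= m i by move: i; near: t.
rewrite normrcE -csumB; last 2 first.
- exact: asum_le vm mf.
- exact: asum_le ut mf.
have eA : \sum_(i <- A) normc (v i - u t i) < e / 4 by near: t.
pose w i := if i \in A then normc (v i - u t i) else 0.
pose q i := 2 * (if i \in A then 0 else m i).
apply: (@le_lt_trans _ _ (e / 4 + 2 * (e / 4))); last lra.
apply: (@csum_norm_le _ (fun i => w i + q i)).
  move=> i; rewrite /w /q; case: ifP => _; first by rewrite mulr0 addr0.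
  rewrite add0r mulr_natl mulr2n (le_trans (le_normcD _ _))// normcN lerD//.
have w0 i : 0 <= w i by rewrite /w; case: ifP => // _; exact: normc_ge0.
have q0 i : 0 <= q i by rewrite /q mulr_ge0//; case: ifP.
rewrite nsumD// EFinD leeD//.
  apply: (@le_trans _ _ (\sum_(i <- A) normc (v i - u t i))%:E); last by rewrite lee_fin ltW.
  apply: nsum_le => B; rewrite lee_fin (big_fsetID _ [in A] B)/= [X in _ + X]big1_fset ?addr0.
    rewrite [leRHS](big_fsetID _ [in B] A)/= (_ : [fset x | x in B & x \in A] = [fset x | x in A & x \in B])%fset.
      have -> : \sum_(i <- [fset x | x in A & x \in B]%fset) w i =
          \sum_(i <- [fset x | x in A & x \in B]%fset) normc (v i - u t i).
        by apply: eq_fbigr => i; rewrite /w !inE => /andP[->].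
      by rewrite lerDl sumr_ge0// => i _; exact: normc_ge0.
    by apply/fsetP => x; rewrite !inE andbC.
  by move=> i; rewrite !inE /w => /andP[_ /negbTE ->].
rewrite nsumZ//; last by move=> i; case: ifP.
by rewrite EFinM lee_wpmul2l ?lee_fin// ltW.
Unshelve. all: by end_near. Qed.

Lemma asum_off u (B : {fset I}) : asum u -> asum (fun i => if i \in B then 0 else u i).
Proof.
move=> au; apply: asum_le au => i; case: ifP => // _.
by rewrite normc0 normc_ge0.
Qed.

Lemma csum_off u (B : {fset I}) : asum u ->
  csum (fun i => if i \in B then 0 else u i) = csum u - psum u B.
Proof.
move=> au; apply: csum_is_csum => e e0; have [A hA] := csumP au e0.
exists (A `|` B)%fset => D; rewrite fsubUset => /andP[AD BD].
suff -> : psum (fun i => if i \in B then 0 else u i) D = psum u D - psum u B.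
  by rewrite opprB addrA subrK; exact: hA.
rewrite /psum (big_fsetID _ [in B] D)/= big1_fset; last first.
  by move=> i; rewrite !inE => /andP[_ ->].
rewrite add0r [X in _ = X - _](big_fsetID _ [in B] D)/=.
rewrite (_ : [fset x | x in D & x \in B]%fset = B); last first.
  apply/fsetP => i; rewrite !inE; apply/andP/idP => [[]//|iB]; split => //.
  exact: (fsubsetP BD).
rewrite addrAC subrr add0r; apply: eq_fbigr => i.
by rewrite !inE => /andP[_ /negbTE ->].
Qed.

End unordered_sums.

Section reindexing.
Variable R : realType.
Local Notation C := (Rcomplex R).
Lemma csum_reindex (I J : choiceType) (e : I -> J) (e' : J -> I) (u : J -> C) :
  cancel e e' -> cancel e' e -> asum u -> csum (u \o e) = csum u.
Proof.
move=> ee' e'e au; apply: csum_is_csum => eps e0; have [A hA] := csumP au e0.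
exists [fset e' j | j in A]%fset => B AB.
have -> : psum (u \o e) B = psum u [fset e i | i in B]%fset.
  rewrite /psum big_imfset//= => x y _ _; exact: can_inj.
apply: hA; apply/fsubsetP => j jA; apply/imfsetP; exists (e' j); last by rewrite e'e.
by apply: (fsubsetP AB); apply/imfsetP; exists j.
Qed.

Lemma nsum_reindex (I J : choiceType) (e : I -> J) (e' : J -> I) (f : J -> R) :
  cancel e e' -> cancel e' e -> nsum (f \o e) = nsum f.
Proof.
move=> ee' e'e; rewrite /nsum (@reindex_esum _ _ _ setT setT e (fun j => (f j)%:E))//.
split => //; first by move=> x y _ _; exact: can_inj.
by move=> j _; exists (e' j).
Qed.

Lemma esum_exchange (I J : choiceType) (a : I -> J -> \bar R) :
  (forall i j, 0 <= a i j)%E ->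
  \esum_(i in setT) \esum_(j in setT) a i j = \esum_(j in setT) \esum_(i in setT) a i j.
Proof.
move=> a0; rewrite (@esum_esum _ _ _ setT (fun=> setT))//.
rewrite (@esum_esum _ _ _ setT (fun=> setT) (fun j i => a i j))//.
rewrite (@reindex_esum R (J * I)%type (I * J)%type (setT `*`` fun=> setT)
  (setT `*`` fun=> setT) (fun p => (p.2, p.1)) (fun k => a k.1 k.2))//.
split => //; first by move=> [x y] [x' y'] _ _ [-> ->].
by move=> [j i] _; exists (i, j).
Qed.

Section exchange.
Variables (I J : choiceType) (a : I -> J -> C).
Hypothesis af : (\esum_(i in setT) nsum (fun j => normc (a i j)) < +oo)%E.
Let n0 i j : 0 <= normc (a i j). Proof. exact: normc_ge0. Qed.

Lemma esum_lty_all (K : choiceType) (g : K -> \bar R) (k : K) :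
  (forall k, 0 <= g k)%E -> (\esum_(k in setT) g k < +oo)%E -> (g k < +oo)%E.
Proof.
move=> g0; apply: le_lt_trans; rewrite -(esum_set1 (g0 k)).
rewrite esum_mkcond; apply: le_esum => i _; case: ifP => // _; exact: g0.
Qed.

Lemma asum_row i : asum (a i).
Proof. by apply: (esum_lty_all (g := fun i => nsum (fun j => normc (a i j)))) af => k; exact: nsum_ge0. Qed.

Lemma asum_col j : asum (a^~ j).
Proof.
move: af; rewrite /nsum esum_exchange; last by move=> *; rewrite lee_fin.
by apply: (esum_lty_all (g := fun j => nsum (fun i => normc (a i j)))) => k; exact: nsum_ge0.
Qed.

Lemma asum_csum_row : asum (fun i => csum (a i)).
Proof.
by apply: le_lt_trans af; apply: le_esum => i _; apply: csum_norm; exact: asum_row.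
Qed.

(** The partial sums over [j] may be exchanged freely, and by summability of
the column norms they approximate the double sum uniformly. *)
Lemma csum_exchange : csum (fun i => csum (a i)) = csum (fun j => csum (a^~ j)).
Proof.
apply/esym/csum_is_csum => e e0.
pose S j := fine (nsum (fun i => normc (a i j))).
have SE j : (S j)%:E = nsum (fun i => normc (a i j)).
  by rewrite fineK// ge0_fin_numE; [exact: asum_col|exact: nsum_ge0].
have S0 j : 0 <= S j by rewrite -lee_fin SE nsum_ge0.
have Sf : (nsum S < +oo)%E.
  move: af; rewrite /nsum esum_exchange; last by move=> *; rewrite lee_fin.
  by rewrite /nsum; under [X in _ -> (X < _)%E]eq_esum do rewrite SE.
have [A hA] := nsum_tail S0 Sf e0; exists A => B AB.
have -> : psum (fun j => csum (a^~ j)) B = csum (fun i => psum (a i) B).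
  rewrite /psum; elim: (B : seq J) => [|j s ih].
    rewrite big_nil; apply/esym/csum_is_csum => d d0; exists fset0 => D _.
    rewrite /psum big1 ?subrr ?normc0// => i _; exact: big_nil.
  rewrite big_cons ih -csumD; last 2 first.
  - exact: asum_col.
  - elim: s {ih} => [|k s ih].
      by apply: asum_le (@asum0 R I) => i; rewrite big_nil.
    by under eq_fun do rewrite big_cons; apply: asumD => //; exact: asum_col.
  by congr csum; apply/funext => i; rewrite big_cons.
have aB : asum (fun i => psum (a i) B).
  rewrite /psum; elim: (B : seq J) => [|k s ih].
    by apply: asum_le (@asum0 R I) => i; rewrite big_nil.
  by under eq_fun do rewrite big_cons; apply: asumD => //; exact: asum_col.
rewrite -csumB//; last exact: asum_csum_row.
rewrite -lte_fin; apply: le_lt_trans (csum_norm _) _.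
  by apply: asumB => //; exact: asum_csum_row.
apply: le_lt_trans hA.
apply: (@le_trans _ _ (\esum_(i in setT) \esum_(j in setT)
    (if j \in A then 0 else normc (a i j))%:E)).
  apply: le_esum => i _; rewrite -csum_off; last exact: asum_row.
  apply: le_trans (csum_norm _) _; first by apply: asum_off; exact: asum_row.
  apply: le_esum => j _; rewrite lee_fin.
  have [jA|jA] := boolP (j \in A).
    by rewrite (fsubsetP AB _ jA) normc0.
  by case: ifP => // _; rewrite normc0.
rewrite esum_exchange; last by move=> i j; rewrite lee_fin; case: ifP.
apply: le_esum => j _; case: ifP => _; last by rewrite SE.
by rewrite esum1.
Qed.

End exchange.

End reindexing.

(** * Differentiation along lines and under the sum sign *)

Section difference_quotient.
Variables (R : realType) (V W : normedModType R).
Lemma is_derive_cvgP (f : V -> W) p v df : is_derive p v f df <->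
  h^-1 *: (f (h *: v + p) - f p) @[h --> (0 : R)^'] --> df.
Proof.
split=> [[d <-]|h]; first exact: d.
by split; [apply/cvg_ex; exists df|exact: (cvg_lim (@norm_hausdorff _ _) h)].
Qed.

End difference_quotient.

Section derive_line.
Variables (R : realType) (V W : normedModType R).
(** Directional derivatives only see the restriction to a line, so that all
differentiation takes place in one real variable. *)
Lemma is_derive_line (f : V -> W) p v df : is_derive p v f df <->
  is_derive (0 : R) 1 (fun h : R => f (h *: v + p)) df.
Proof.
rewrite !is_derive_cvgP scale0r add0r.
by under [X in _ <-> (X @ _ --> _)]eq_fun do rewrite addr0 scaler1.
Qed.

End derive_line.

Section derive_bounded_linear.
Variables (R : realType) (V W W' : normedModType R).
(** Derivatives pass through bounded linear maps; this moves derivatives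
between a complex-valued function and its real and imaginary parts. *)
Lemma is_derive_lin (L : W -> W') M (f : V -> W) p v df :
  {morph L : x y / x - y} -> (forall (a : R) x, L (a *: x) = a *: L x) ->
  (forall x, `|L x| <= M * `|x|) ->
  is_derive p v f df -> is_derive p v (L \o f) (L df).
Proof.
move=> LB LZ LM; rewrite !is_derive_cvgP => /cvgrPdist_lt h.
apply/cvgrPdist_lt => e e0; have M1 : 0 < `|M| + 1 by rewrite ltr_wpDl.
have := h _ (divr_gt0 e0 M1); apply: filterS => t ht.
rewrite /= -LB -LZ -LB; apply: le_lt_trans (LM _) _.
apply: (@le_lt_trans _ _ ((`|M| + 1) * `|df - t^-1 *: (f (t *: v + p) - f p)|)).
  by rewrite ler_wpM2r// (le_trans (ler_norm _))// lerDl.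
by rewrite mulrC -ltr_pdivlMr.
Qed.

End derive_bounded_linear.

Section complex_derive.
Variables (R : realType) (V : normedModType R).
Local Notation C := (Rcomplex R).
Lemma is_derive_Re (f : V -> C) p v df : is_derive p v f df ->
  is_derive p v (fun x => complex.Re (f x)) (complex.Re df).
Proof.
apply: (@is_derive_lin _ _ C R (fun z => complex.Re z) 1).
- by move=> [a b] [c d].
- by move=> a [b c].
- by move=> z; rewrite mul1r normrcE; exact: normc_Re.
Qed.

Lemma is_derive_Im (f : V -> C) p v df : is_derive p v f df ->
  is_derive p v (fun x => complex.Im (f x)) (complex.Im df).
Proof.
apply: (@is_derive_lin _ _ C R (fun z => complex.Im z) 1).
- by move=> [a b] [c d].
- by move=> a [b c].
- by move=> z; rewrite mul1r normrcE; exact: normc_Im.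
Qed.

Lemma is_derive_complex (f g : V -> R) p v df dg : is_derive p v f df -> is_derive p v g dg ->
  is_derive p v (fun x => Complex (f x) (g x) : C) (Complex df dg : C).
Proof.
move=> hf hg.
have h1 : is_derive p v (fun x => Complex (f x) 0 : C) (Complex df 0 : C).
  apply: (@is_derive_lin _ _ R C (fun x => Complex x 0 : C) 1) => //.
  - by move=> a b; apply/eqP; rewrite eq_complex /= subr0 !eqxx.
  - by move=> a b; apply/eqP; rewrite eq_complex /= mulr0 !eqxx.
  - by move=> x; rewrite normrcE/= expr0n addr0 sqrtr_sqr mul1r.
have h2 : is_derive p v (fun x => Complex 0 (g x) : C) (Complex 0 dg : C).
  apply: (@is_derive_lin _ _ R C (fun x => Complex 0 x : C) 1) => //.
  - by move=> a b; apply/eqP; rewrite eq_complex /= subr0 !eqxx.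
  - by move=> a b; apply/eqP; rewrite eq_complex /= mulr0 !eqxx.
  - by move=> x; rewrite normrcE/= expr0n add0r sqrtr_sqr mul1r.
have E a b : (Complex a b : C) = (Complex a 0 : C) + (Complex 0 b : C).
  by apply/eqP; rewrite eq_complex /= addr0 add0r !eqxx.
have -> : (fun x => Complex (f x) (g x) : C) = (fun x => Complex (f x) 0 : C) + (fun x => Complex 0 (g x) : C).
  by apply/funext => x; rewrite E.
by rewrite E; apply: is_deriveD.
Qed.

End complex_derive.

Section mean_value.
Variable R : realType.
Local Notation C := (Rcomplex R).
Lemma mean_value_real (f df : R -> R) (M a b : R) :
  (forall t, Num.min a b <= t <= Num.max a b -> is_derive t 1 f (df t)) ->
  (forall t, Num.min a b <= t <= Num.max a b -> `|df t| <= M) ->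
  `|f b - f a| <= M * `|b - a|.
Proof.
wlog ab : a b / a <= b.
  move=> hw; have [ab|/ltW ba] := leP a b; last first.
    move=> h1 h2; rewrite distrC (distrC b).
    by apply: hw => // t; rewrite (min_l ba) (max_r ba); auto.
  by move=> h1 h2; apply: hw => // t; rewrite (min_l ab) (max_r ab); auto.
rewrite min_l// max_r// => h1 h2.
have [||c /[!in_itv]/= hc ->] := @MVT_segment R f df a b ab.
- by move=> x /[!in_itv]/= /andP[/ltW ? /ltW ?]; apply: h1; apply/andP.
- apply: derivable_within_continuous => x /[!in_itv]/= hx.
  by case: (h1 x hx).
by rewrite normrM ler_wpM2r// h2.
Qed.

(** The factor 2 comes from estimating the real and the imaginary part
separately, since the mean value theorem fails for complex values. *)
Lemma mean_value_complex (f df : R -> C) (M a b : R) :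
  (forall t, Num.min a b <= t <= Num.max a b -> is_derive t 1 f (df t)) ->
  (forall t, Num.min a b <= t <= Num.max a b -> normc (df t) <= M) ->
  normc (f b - f a) <= 2 * M * `|b - a|.
Proof.
move=> h1 h2; apply: le_trans (normc_le_ReIm _) _.
have hr : `|complex.Re (f b) - complex.Re (f a)| <= M * `|b - a|.
  apply: (@mean_value_real (fun t => complex.Re (f t)) (fun t => complex.Re (df t))) => t ht.
    by apply: is_derive_Re; exact: h1.
  by rewrite (le_trans (normc_Re _))// h2.
have hi : `|complex.Im (f b) - complex.Im (f a)| <= M * `|b - a|.
  apply: (@mean_value_real (fun t => complex.Im (f t)) (fun t => complex.Im (df t))) => t ht.
    by apply: is_derive_Im; exact: h1.
  by rewrite (le_trans (normc_Im _))// h2.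
by move: hr hi; case: (f b) (f a) => x y [z w] /=; lra.
Qed.

(** By the mean value inequality the difference quotients are dominated by the
bound on the derivatives, so that termwise differentiation is dominated
convergence. *)
Lemma is_derive_csum (I : choiceType) (u du : I -> R -> C) (m : I -> R) (x r : R) :
  0 < r -> (nsum m < +oo)%E ->
  (forall i t, `|t - x| < r -> is_derive t 1 (u i) (du i t)) ->
  (forall i t, `|t - x| < r -> normc (du i t) <= m i) ->
  (forall t, `|t - x| < r -> asum (u^~ t)) ->
  is_derive x 1 (fun t => csum (u^~ t)) (csum (du^~ x)).
Proof.
move=> r0 mf hd hm hs; apply/is_derive_cvgP.
have xx : `|x - x| < r by rewrite subrr normr0.
have m0 i : 0 <= m i by apply: le_trans (hm i x xx); exact: normc_ge0.
have nr : \forall h \near (0 : R)^', `|(h + x) - x| < r.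
  near=> h; rewrite addrK; near: h; apply: dnbhs0_lt; exact: r0.
have m2f : (nsum (fun i => 2 * m i)%R < +oo)%E by exact: nsum_ltyZ.
apply: (@cvg_trans _ (csum (fun i => h^-1 *: (u i (h *: 1 + x) - u i x)) @[h --> (0 : R)^'])).
  apply: near_eq_cvg; near=> h; have hh : `|h + x - x| < r by near: h.
  rewrite scaler1 csumZ ?csumB//; last 2 first.
  - exact: (hs _ xx).
  - by apply: asumB; [exact: hs|exact: hs].
  - exact: (hs _ hh).
apply: (@csum_dominated _ _ _ _ _ _ _ (fun i => 2 * m i)) => //.
- near=> h => i; rewrite scaler1 normcZ.
  have hh : `|h + x - x| < r by near: h.
  have h0 : h != 0 by near: h; exact: nbhs_dnbhs_neq.
  rewrite normfV mulrC ler_pdivrMr ?normr_gt0//.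
  have tt t : Num.min x (h + x) <= t <= Num.max x (h + x) -> `|t - x| < r.
    move=> ht; apply: le_lt_trans hh; rewrite addrK.
    move: ht; rewrite ge_min le_max; case: (ltP 0 h) => hp ht; rewrite ?(gtr0_norm hp) ?(ler0_norm hp) ler_norml; apply/andP; lra.
  have := @mean_value_complex (u i) (du i) (m i) x (h + x).
  rewrite addrK; apply => t ht; [apply: hd|apply: hm]; exact: tt.
- by move=> i; apply: le_trans (hm i x xx) _; rewrite ler_peMl// ler1n.
- move=> i; have := hd i x xx; rewrite is_derive_cvgP; exact.
Unshelve. all: by end_near. Qed.

End mean_value.

(** * Weighted convolution estimates on the lattice of frequencies *)

Section cauchy_schwarz.
Variables (R : realType) (I : choiceType).
Implicit Types (x y : I -> R).

Lemma fsum_sqr_le (s : seq I) x y (A B : R) : 0 <= A -> 0 <= B ->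
  (forall i, 0 <= x i) -> (forall i, 0 <= y i) ->
  \sum_(i <- s) x i ^+ 2 <= A ^+ 2 -> \sum_(i <- s) y i ^+ 2 <= B ^+ 2 ->
  \sum_(i <- s) x i * y i <= A * B.
Proof.
move=> A0 B0 x0 y0 xA yB; apply/ler_addgt0Pl => e e0.
wlog : A B A0 B0 xA yB e e0 / 0 < A /\ 0 < B => [hw|[Ap Bp]].
  (* Both bounds are made positive at the price of an arbitrarily small error.
  *)
  pose e' := Num.min 1 (e / (A + B + 2)).
  have D0 : 0 < A + B + 2 by lra.
  have e'0 : 0 < e' by rewrite lt_min ltr01 divr_gt0.
  have e'1 : e' <= 1 by rewrite ge_min lexx.
  have e'e : e' * (A + B + 2) <= e by rewrite -ler_pdivlMr// ge_min lexx orbT.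
  have := hw (A + e') (B + e') _ _ _ _ e' e'0.
  move=> /(_ _ _ _ _ _)/le_trans; apply; rewrite ?addr_ge0// ?(ltW e'0)//; try (split; lra).
  - by apply: le_trans xA _; rewrite ler_sqr ?nnegrE; lra.
  - by apply: le_trans yB _; rewrite ler_sqr ?nnegrE; lra.
  - have : 0 <= e' * (1 - e') by rewrite mulr_ge0; lra.
    lra.
have h : \sum_(i <- s) (x i * y i) <= \sum_(i <- s) ((B / A * x i ^+ 2 + A / B * y i ^+ 2) / 2).
  apply: ler_sum => i _; rewrite -subr_ge0.
  have -> : (B / A * x i ^+ 2 + A / B * y i ^+ 2) / 2 - x i * y i = (B * x i - A * y i) ^+ 2 / (2 * A * B).
    by field; rewrite !gt_eqF.
  by rewrite divr_ge0 ?sqr_ge0// !mulr_ge0.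
apply: le_trans h _; rewrite -mulr_suml big_split/= -!mulr_sumr.
have : B / A * (\sum_(i <- s) x i ^+ 2) <= B / A * A ^+ 2 by rewrite ler_wpM2l// divr_ge0.
have : A / B * (\sum_(i <- s) y i ^+ 2) <= A / B * B ^+ 2 by rewrite ler_wpM2l// divr_ge0.
have -> : A / B * B ^+ 2 = A * B by field; rewrite gt_eqF.
have -> : B / A * A ^+ 2 = A * B by field; rewrite gt_eqF.
lra.
Qed.

(** Explicit bounds on both factors avoid finiteness side conditions. *)
Lemma nsum_cauchy_schwarz x y (A B : R) : 0 <= A -> 0 <= B ->
  (forall i, 0 <= x i) -> (forall i, 0 <= y i) ->
  (nsum (fun i => x i ^+ 2)%R <= (A ^+ 2)%:E)%E ->
  (nsum (fun i => y i ^+ 2)%R <= (B ^+ 2)%:E)%E ->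
  (nsum (fun i => x i * y i)%R <= (A * B)%:E)%E.
Proof.
move=> A0 B0 x0 y0 xA yB; apply: nsum_le => D; rewrite lee_fin.
apply: fsum_sqr_le => //; rewrite -lee_fin.
  by apply: le_trans xA; apply: fsum_le_nsum => i; exact: sqr_ge0.
by apply: le_trans yB; apply: fsum_le_nsum => i; exact: sqr_ge0.
Qed.

Lemma nsum_sqrD x y (A B : R) : 0 <= A -> 0 <= B ->
  (forall i, 0 <= x i) -> (forall i, 0 <= y i) ->
  (nsum (fun i => x i ^+ 2)%R <= (A ^+ 2)%:E)%E ->
  (nsum (fun i => y i ^+ 2)%R <= (B ^+ 2)%:E)%E ->
  (nsum (fun i => (x i + y i) ^+ 2)%R <= ((A + B) ^+ 2)%:E)%E.
Proof.
move=> A0 B0 x0 y0 xA yB; have xy := nsum_cauchy_schwarz A0 B0 x0 y0 xA yB.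
have -> : (fun i => (x i + y i) ^+ 2)%R = (fun i => x i ^+ 2 + (2 * (x i * y i) + y i ^+ 2)).
  by apply/funext => i; ring.
have -> : (A + B) ^+ 2 = A ^+ 2 + (2 * (A * B) + B ^+ 2) by ring.
have xy0 i : 0 <= x i * y i by rewrite mulr_ge0.
rewrite nsumD; last 2 first.
- by move=> i; exact: sqr_ge0.
- by move=> i; rewrite addr_ge0 ?sqr_ge0// mulr_ge0.
rewrite EFinD leeD// nsumD; last 2 first.
- by move=> i; rewrite mulr_ge0.
- by move=> i; exact: sqr_ge0.
by rewrite EFinD leeD// nsumZ// EFinM lee_wpmul2l ?lee_fin.
Qed.

Lemma nsum_fin x (M : R) : (forall i, 0 <= x i) -> (nsum x <= M%:E)%E ->
  nsum x \is a fin_num.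
Proof. by move=> x0 xM; rewrite ge0_fin_numE ?nsum_ge0// (le_lt_trans xM) ?ltry. Qed.

End cauchy_schwarz.

Section young.
Variables (R : realType) (G : zmodType).
Implicit Types (x y : G -> R).

Definition rconv x y (k : G) : R := fine (nsum (fun l => x (k - l) * y l)).

Lemma rconv_ge0 x y k : (forall i, 0 <= x i) -> (forall i, 0 <= y i) -> 0 <= rconv x y k.
Proof. by move=> x0 y0; rewrite fine_ge0// nsum_ge0// => l; rewrite mulr_ge0. Qed.

(** Cauchy-Schwarz with the weight [y] reduces the square of the convolution to
the convolution of [x^2] with [y], whose sum is a product. *)
Lemma young x y (X Y : R) : 0 <= X -> 0 <= Y ->
  (forall i, 0 <= x i) -> (forall i, 0 <= y i) ->
  (nsum (fun i => x i ^+ 2)%R <= (X ^+ 2)%:E)%E -> (nsum y <= Y%:E)%E ->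
  (forall k, (nsum (fun l => x (k - l) * y l)%R < +oo)%E) /\
  (nsum (fun k => rconv x y k ^+ 2)%R <= ((X * Y) ^+ 2)%:E)%E.
Proof.
move=> X0 Y0 x0 y0 xX yY.
pose q k := nsum (fun l => x (k - l) ^+ 2 * y l).
have q0 k : (0 <= q k)%E by apply: nsum_ge0 => l; rewrite mulr_ge0// sqr_ge0.
have qs : (\esum_(k in setT) q k <= (X ^+ 2 * Y)%:E)%E.
  rewrite /q /nsum esum_exchange; last by move=> k l; rewrite lee_fin mulr_ge0// sqr_ge0.
  apply: (@le_trans _ _ (\esum_(l in setT) (X ^+ 2 * y l)%:E)).
    apply: le_esum => l _; rewrite -/(nsum (fun k => x (k - l) ^+ 2 * y l)).
    under [X in nsum X]eq_fun do rewrite mulrC.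
    rewrite nsumZ//; last by move=> k; exact: sqr_ge0.
    rewrite [X ^+ 2 * _]mulrC EFinM lee_wpmul2l ?lee_fin//.
    rewrite -/((fun i => x i ^+ 2) \o (fun k => k - l)) in xX *.
    rewrite (@nsum_reindex _ _ _ (fun k => k - l) (fun k => k + l) (fun i => x i ^+ 2))//.
    - by move=> k; rewrite subrK.
    - by move=> k; rewrite addrK.
  by rewrite -/(nsum (fun l => X ^+ 2 * y l)) nsumZ ?sqr_ge0// [leRHS]EFinM lee_wpmul2l// lee_fin sqr_ge0.
have qf k : q k \is a fin_num.
  rewrite ge0_fin_numE//; apply: (esum_lty_all (g := q)) => //.
  exact: le_lt_trans qs (ltry _).
have cs k : (nsum (fun l => x (k - l) * y l)%R <= (Num.sqrt (fine (q k)) * Num.sqrt Y)%:E)%E.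
  have -> : (fun l => x (k - l) * y l) = (fun l => (x (k - l) * Num.sqrt (y l)) * Num.sqrt (y l)).
    by apply/funext => l; rewrite -mulrA -expr2 sqr_sqrtr.
  apply: nsum_cauchy_schwarz; rewrite ?sqrtr_ge0//.
  - by move=> l; rewrite mulr_ge0// sqrtr_ge0.
  - rewrite sqr_sqrtr ?fine_ge0// fineK//.
    by apply: le_nsum => l; rewrite exprMn sqr_sqrtr.
  - by rewrite sqr_sqrtr//; apply: le_trans yY; apply: le_nsum => l; rewrite sqr_sqrtr.
split=> [k|]; first exact: le_lt_trans (cs k) (ltry _).
apply: (@le_trans _ _ (\esum_(k in setT) (Y%:E * q k)))%E.
  apply: le_esum => k _; rewrite -[q k]fineK// -EFinM lee_fin.
  have -> : Y * fine (q k) = (Num.sqrt (fine (q k)) * Num.sqrt Y) ^+ 2.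
    by rewrite exprMn !sqr_sqrtr ?fine_ge0// mulrC.
  have r0 : 0 <= rconv x y k by exact: rconv_ge0.
  rewrite ler_sqr ?nnegrE// ?mulr_ge0 ?sqrtr_ge0//.
  rewrite -lee_fin /rconv fineK ?cs//; apply: nsum_fin (cs k) => l.
  by rewrite mulr_ge0.
have -> : (\esum_(k in setT) (Y%:E * q k) = nsum (fun k => Y * fine (q k))%R)%E.
  by apply: eq_esum => k _; rewrite EFinM fineK.
rewrite nsumZ//; last by move=> k; exact: fine_ge0.
rewrite (_ : (X * Y) ^+ 2 = Y * (X ^+ 2 * Y)) ?EFinM; last by ring.
rewrite lee_wpmul2l ?lee_fin// -EFinM; apply: le_trans qs.
by apply: le_esum => k _; rewrite fineK.
Qed.

End young.

Section lattice_sum.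
Variable R : realType.

(** A telescoping comparison replaces the integral test. *)
Lemma pow_inv_le (d n : nat) : (0 < d)%N -> (0 < n)%N ->
  n.+1%:R `^ (- (1 + d%:R^-1)) <= d%:R * (n%:R `^ (- d%:R^-1) - n.+1%:R `^ (- d%:R^-1)) :> R.
Proof.
move=> d0 n0; set a : R := d%:R^-1; have a0 : 0 < a by rewrite invr_gt0 ltr0n.
have d0' : d%:R != 0 :> R by rewrite pnatr_eq0 -lt0n.
pose N : R := n.+1%:R; have N0 : 0 < N by rewrite ltr0n.
have n0' : 0 < n%:R :> R by rewrite ltr0n.
have nN : n%:R = N * (1 - N^-1).
  by rewrite mulrBr mulr1 divff ?gt_eqF// /N -natr1 addrK.
have y1 : 0 < 1 - N^-1 by rewrite -(pmulr_rgt0 _ N0) -nN.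
rewrite -/N nN powRM ?(ltW N0) ?(ltW y1)// opprD powRD; last by rewrite (gt_eqF N0) implybT.
rewrite -ler_pdivrMl ?ltr0n// -/a powRN powRr1 ?(ltW N0)//.
have -> : N `^ (- a) * (1 - N^-1) `^ (- a) - N `^ (- a) = ((1 - N^-1) `^ (- a) - 1) * N `^ (- a) by ring.
rewrite mulrA ler_wpM2r ?powR_ge0//.
rewrite /powR gt_eqF// lerBrDl.
apply: le_trans (expR_ge1Dx (a * N^-1)) _.
rewrite ler_expR mulNr -mulrN ler_wpM2l ?(ltW a0)// lerNr.
have := @le_ln1Dx R (- N^-1); apply.
by rewrite ltrNl opprK invf_lt1// ltr1n ltnS.
Qed.

Lemma sum_pow_inv_le (d N : nat) : (0 < d)%N ->
  \sum_(0 <= n < N) n.+1%:R `^ (- (1 + d%:R^-1)) <= 1 + d%:R :> R.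
Proof.
move=> d0; case: N => [|N]; first by rewrite big_nil addr_ge0.
rewrite big_nat_recl//= powR1 lerD2l.
apply: (@le_trans _ _ (\sum_(0 <= n < N) d%:R * (n.+1%:R `^ (- d%:R^-1) - n.+2%:R `^ (- d%:R^-1)))).
  by apply: ler_sum => n _; exact: pow_inv_le.
rewrite -mulr_sumr ler_piMr//; pose u n : R := n.+1%:R `^ (- d%:R^-1).
rewrite (eq_bigr (fun n => - (u n.+1 - u n))); last by move=> n _; rewrite opprB.
by rewrite sumrN telescope_sumr// opprB /u powR1 lerBlDr lerDl powR_ge0.
Qed.

Let p (d : nat) : R := - (1 + d%:R^-1).
Let g d (n : int) : R := Num.max 1 `|n%:~R| `^ p d.

Let g_nat d n : g d n.+1%:Z = n.+1%:R `^ p d.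
Proof.
rewrite /g ger0_norm ?ler0z// -pmulrn max_r//.
by rewrite ler1n.
Qed.

Let gN d n : g d (- n) = g d n.
Proof. by rewrite /g mulrNz normrN. Qed.

Let g_ge0 d n : 0 <= g d n. Proof. exact: powR_ge0. Qed.

Let sum_g (d N : nat) : (0 < d)%N ->
  \sum_(i < N + N.+1) g d (i%:Z - N%:Z) <= 3 + 2 * d%:R.
Proof.
move=> d0; rewrite -(big_mkord xpredT (fun i => g d (i%:Z - N%:Z))).
rewrite (@big_cat_nat _ _ _ N)//=; last by rewrite leq_addr.
rewrite big_nat_rev/= add0n.
have -> : \sum_(0 <= i < N) g d ((N - i.+1)%N%:Z - N%:Z) = \sum_(0 <= n < N) n.+1%:R `^ p d.
  rewrite !big_nat; apply: eq_bigr => i /andP[_ iN].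
  by rewrite -gN opprB -g_nat -subzn// opprB addrC subrK.
rewrite -{2}[N]add0n big_addn addKn big_nat_recl//= add0n subrr.
have -> : \sum_(0 <= i < N) g d ((i.+1 + N)%N%:Z - N%:Z) = \sum_(0 <= n < N) n.+1%:R `^ p d.
  by apply: eq_bigr => i _; rewrite PoszD addrK g_nat.
have -> : g d 0 = 1 by rewrite /g normr0 max_l// powR1.
have := sum_pow_inv_le N d0; rewrite -/(p d); lra.
Qed.

(** Each coordinate is at most the bracket, so the sum is dominated by a
product of [d] one-dimensional sums with exponent [1 + 1/d]. *)
Lemma lattice_sum (d : nat) : (0 < d)%N ->
  (nsum (fun k : 'rV[int]_d => japanese R k `^ (- d.+1%:R))%R <= ((3 + 2 * d%:R) ^+ d)%:E)%E.
Proof.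
move=> d0; apply: (@le_trans _ _ (nsum (fun k : 'rV[int]_d => \prod_(j < d) g d (k ord0 j)))).
  apply: le_nsum => k; set J := japanese R k.
  have J1 : 1 <= J by rewrite le_max lexx.
  have Jj j : Num.max 1 `|(k ord0 j)%:~R| <= J.
    rewrite ge_max J1/= le_max -sqrtr_sqr ler_wsqrtr ?orbT//.
    by rewrite (bigD1 j)//= lerDl sumr_ge0// => i _; exact: sqr_ge0.
  have -> : J `^ (- d.+1%:R) = \prod_(j < d) (J `^ p d).
    rewrite prodr_const card_ord -powR_mulrn ?powR_ge0// -powRrM; congr (_ `^ _).
    by rewrite /p mulNr mulrDl mul1r mulVf ?pnatr_eq0 -?lt0n// natr1.
  apply: ler_prod => j _; rewrite powR_ge0/= /g /p !powRN lef_pV2 ?posrE ?powR_gt0//.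
  - have J0 : 0 <= J by exact: le_trans ler01 J1.
    by apply: ge0_ler_powR; rewrite ?nnegrE ?Jj ?addr_ge0 ?invr_ge0 ?ler0n// le_max ler01.
  - by rewrite (lt_le_trans ltr01).
apply: nsum_le => A; rewrite lee_fin.
(* A finite set of frequencies lies in a cube, over which the sum of products
is a product of sums. *)
pose N := \max_(k <- A) \max_(j < d) `|k ord0 j|%N.
have AN k j : k \in A -> (`|k ord0 j| <= N)%N.
  move=> kA; apply: leq_trans (leq_bigmax_seq _ kA isT).
  exact: (leq_bigmax (F := fun j => `|k ord0 j|%N)).
pose e (f : {ffun 'I_d -> 'I_(N + N.+1)}) : 'rV[int]_d := \row_j ((f j)%:Z - N%:Z).
have NN : (N + N.+1 = (N + N).+1)%N by rewrite addnS.
pose c (k : 'rV[int]_d) : {ffun 'I_d -> 'I_(N + N.+1)} :=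
  [ffun j => cast_ord (esym NN) (inord (absz (k ord0 j + N%:Z)%R))].
have ec k : k \in A -> e (c k) = k.
  move=> kA; apply/rowP => j; rewrite mxE ffunE /=.
  have := AN k j kA; set m := k ord0 j => mN.
  have m0 : (0 <= m + N%:Z) by lia.
  rewrite inordK; last by lia.
  by rewrite gez0_abs// addrK.
rewrite big_seq (eq_bigr (fun k => \prod_(j < d) g d (e (c k) ord0 j))); last first.
  by move=> k kA; rewrite ec.
rewrite -big_seq -(big_map c xpredT (fun f => \prod_(j < d) g d (e f ord0 j))).
have uc : uniq (map c A).
  rewrite map_inj_in_uniq ?fset_uniq// => x y xA yA /(congr1 e).
  by rewrite !ec.
rewrite big_uniq//= big_mkcond/=.
apply: (@le_trans _ _ (\sum_f \prod_(j < d) g d (e f ord0 j))).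
  by apply: ler_sum => f _; case: ifP => // _; exact: prodr_ge0.
under eq_bigr do under eq_bigr do rewrite mxE.
rewrite -(bigA_distr_bigA (fun (_ : 'I_d) (i : 'I_(N + N.+1)) => g d ((nat_of_ord i)%:Z - N%:Z))).
rewrite prodr_const card_ord lerXn2r ?nnegrE ?sum_g//; by apply: sumr_ge0.
Qed.

End lattice_sum.

Section weights.
Variables (R : realType) (d : nat).
Local Notation K := 'rV[int]_d.
Local Notation C := (Rcomplex R).
Implicit Types (k l : K).

Lemma japanese_ge1 k : 1 <= japanese R k.
Proof. by rewrite le_max lexx. Qed.

Lemma japanese_gt0 k : 0 < japanese R k.
Proof. exact: lt_le_trans (japanese_ge1 k). Qed.

Hint Resolve japanese_ge1 japanese_gt0 : core.

Lemma norm2_ge0 k : 0 <= norm2 R k. Proof. exact: sqrtr_ge0. Qed.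

Lemma norm2_le_japanese k : norm2 R k <= japanese R k.
Proof. by rewrite le_max lexx orbT. Qed.

Lemma coord_le_norm2 k j : `|(k ord0 j)%:~R| <= norm2 R k.
Proof.
rewrite -sqrtr_sqr ler_wsqrtr// (bigD1 j)//= lerDl sumr_ge0// => i _.
exact: sqr_ge0.
Qed.

Lemma norm2_0 : norm2 R (0 : K) = 0.
Proof.
rewrite /norm2 big1 ?sqrtr0// => j _; by rewrite mxE expr0n.
Qed.

Lemma norm2_ge1 k : k != 0 -> 1 <= norm2 R k.
Proof.
move=> k0; have [j kj] : exists j, k ord0 j != 0.
  apply/existsP; apply: contraNT k0; rewrite negb_exists => /forallP h.
  by apply/eqP/rowP => j; rewrite mxE; apply/eqP; have := h j; rewrite negbK.
apply: le_trans (coord_le_norm2 k j); rewrite -intr_norm ler1z.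
by rewrite -gtz0_ge1 normr_gt0.
Qed.

Lemma norm1D k l : norm1 R (k + l) <= norm1 R k + norm1 R l.
Proof. by rewrite -big_split/=; apply: ler_sum => j _; rewrite mxE intrD ler_normD. Qed.

Lemma japaneseD k l : japanese R (k + l) <= 2 * Num.max (japanese R k) (japanese R l).
Proof.
set m := Num.max _ _; have m1 : 1 <= m by rewrite le_max japanese_ge1.
rewrite ge_max; apply/andP; split; first by lra.
rewrite -[leRHS]ger0_norm; last by lra.
rewrite -sqrtr_sqr ler_wsqrtr//.
have sqk (q : K) : norm2 R q <= m -> \sum_(j < d) (q ord0 j)%:~R ^+ 2 <= m ^+ 2.
  move=> qm; rewrite -[leLHS]sqr_sqrtr; last by apply: sumr_ge0 => j _; exact: sqr_ge0.
  by rewrite ler_sqr ?nnegrE ?sqrtr_ge0//; lra.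
have hk := sqk k; have hl := sqk l.
apply: (@le_trans _ _ (\sum_(j < d) (2 * (k ord0 j)%:~R ^+ 2 + 2 * (l ord0 j)%:~R ^+ 2))).
  apply: ler_sum => j _; rewrite mxE intrD -subr_ge0.
  set a := (k ord0 j)%:~R; set b := (l ord0 j)%:~R.
  have -> : 2 * a ^+ 2 + 2 * b ^+ 2 - (a + b) ^+ 2 = (a - b) ^+ 2 :> R by ring.
  exact: sqr_ge0.
rewrite big_split/= -!mulr_sumr.
have {}hk : \sum_(j < d) (k ord0 j)%:~R ^+ 2 <= m ^+ 2.
  by apply: hk; rewrite le_max norm2_le_japanese.
have {}hl : \sum_(j < d) (l ord0 j)%:~R ^+ 2 <= m ^+ 2.
  by apply: hl; rewrite le_max norm2_le_japanese orbT.
lra.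
Qed.

Lemma japanese_powD (r : R) k l : 0 <= r ->
  japanese R (k + l) `^ r <= 2 `^ r * (japanese R k `^ r + japanese R l `^ r).
Proof.
move=> r0; apply: (@le_trans _ _ ((2 * Num.max (japanese R k) (japanese R l)) `^ r)).
  by apply: ge0_ler_powR; rewrite ?nnegrE ?japaneseD// ?(ltW (japanese_gt0 _))// mulr_ge0// le_max ltW.
rewrite powRM//; last by rewrite le_max ltW.
rewrite ler_wpM2l ?powR_ge0//.
by case: (leP (japanese R k) (japanese R l)) => _; rewrite ?lerDl ?lerDr powR_ge0.
Qed.

Definition rweight (sigma r : R) k : R := expR (sigma * norm1 R k) * japanese R k `^ r.

Lemma rweight_gt0 sigma r k : 0 < rweight sigma r k.
Proof. by rewrite mulr_gt0 ?expR_gt0 ?powR_gt0. Qed.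

Lemma hweightE sigma r k : hweight sigma r k = rweight sigma r k ^+ 2.
Proof.
rewrite /hweight /rweight exprMn -mulrA -expRM_natl -mulr_natl; congr (expR _ * _).
by rewrite mulr1 [2 * r]mulrC powRrM powR_mulrn// powR_ge0.
Qed.

Lemma rweight_mono sigma r r' k : r <= r' -> rweight sigma r k <= rweight sigma r' k.
Proof.
by move=> rr; rewrite ler_wpM2l ?expR_ge0// ler_powR.
Qed.

Lemma rweight_japanese sigma r k : rweight sigma (r + 1) k = rweight sigma r k * japanese R k.
Proof.
rewrite /rweight powRD; last by rewrite (gt_eqF (japanese_gt0 k)) implybT.
by rewrite powRr1 ?mulrA// ltW.
Qed.

(** Bounds on Sobolev norms are stated for nonnegative sequences of moduli and
without extended reals, so that finiteness is part of the bound. *)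
Definition hbound sigma r (f : K -> R) (M : R) : Prop :=
  (nsum (fun k => (rweight sigma r k * f k) ^+ 2)%R <= (M ^+ 2)%:E)%E.

Lemma hnorm_leP sigma r (u : K -> C) M : 0 <= M ->
  (hnorm sigma r u <= M%:E)%E <-> hbound sigma r (fun k => normc (u k)) M.
Proof.
move=> M0; rewrite /hnorm /hbound.
have -> : M%:E = sqrte ((M ^+ 2)%:E) by rewrite /= sqrtr_sqr ger0_norm.
rewrite lee_sqrt; last by rewrite lee_fin sqr_ge0.
rewrite /nsum.
by under [X in _ <-> is_true (X <= _)%E]eq_esum do rewrite exprMn -hweightE.
Qed.

Lemma hbound_le sigma r (f g : K -> R) M : (forall k, 0 <= f k) -> (forall k, f k <= g k) ->
  hbound sigma r g M -> hbound sigma r f M.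
Proof.
move=> f0 fg; apply: le_trans; apply: le_nsum => k.
have w0 := rweight_gt0 sigma r k.
have g0 := le_trans (f0 k) (fg k).
rewrite ler_sqr ?nnegrE; first by rewrite ler_wpM2l// ltW.
- by apply: mulr_ge0 => //; exact: ltW.
- by apply: mulr_ge0 => //; exact: ltW.
Qed.

Lemma hboundD sigma r (f g : K -> R) A B : 0 <= A -> 0 <= B ->
  (forall k, 0 <= f k) -> (forall k, 0 <= g k) ->
  hbound sigma r f A -> hbound sigma r g B -> hbound sigma r (fun k => f k + g k) (A + B).
Proof.
move=> A0 B0 f0 g0 fA gB; rewrite /hbound.
under [X in nsum X]eq_fun do rewrite mulrDr.
apply: nsum_sqrD => // k; by rewrite mulr_ge0// ltW ?rweight_gt0.
Qed.

Lemma hboundZ sigma r (f : K -> R) A c : 0 <= c -> (forall k, 0 <= f k) ->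
  hbound sigma r f A -> hbound sigma r (fun k => c * f k) (c * A).
Proof.
move=> c0 f0; rewrite /hbound => fA.
under [X in nsum X]eq_fun do rewrite mulrCA exprMn.
rewrite nsumZ ?sqr_ge0// => [|k]; last exact: sqr_ge0.
by rewrite [in leRHS]exprMn [leRHS]EFinM lee_wpmul2l// lee_fin sqr_ge0.
Qed.

Lemma hbound_mono sigma r (f : K -> R) A B : 0 <= A -> A <= B ->
  hbound sigma r f A -> hbound sigma r f B.
Proof.
by move=> A0 AB /le_trans; apply; rewrite lee_fin ler_sqr ?nnegrE// (le_trans A0).
Qed.

Lemma hbound_wmono sigma r r' (f : K -> R) A : r <= r' -> (forall k, 0 <= f k) ->
  hbound sigma r' f A -> hbound sigma r f A.
Proof.
move=> rr f0; apply: le_trans; apply: le_nsum => k.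
have w0 := ltW (rweight_gt0 sigma r k); have w0' := ltW (rweight_gt0 sigma r' k).
rewrite ler_sqr ?nnegrE; [|exact: mulr_ge0|exact: mulr_ge0].
by rewrite ler_wpM2r// rweight_mono.
Qed.

(** A derivative costs one unit of regularity. *)
Lemma hbound_japanese sigma r (f : K -> R) A :
  hbound sigma r (fun k => japanese R k * f k) A <-> hbound sigma (r + 1) f A.
Proof.
rewrite /hbound; under [X in _ <-> is_true (nsum X <= _)%E]eq_fun do rewrite rweight_japanese -mulrA.
by [].
Qed.

Lemma hbound_entry sigma r (f : K -> R) A k : 0 <= A -> (forall k, 0 <= f k) ->
  hbound sigma r f A -> rweight sigma r k * f k <= A.
Proof.
move=> A0 f0 h; rewrite -ler_sqr ?nnegrE//; last by rewrite mulr_ge0// ltW ?rweight_gt0.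
rewrite -lee_fin; apply: le_trans h.
by apply: (@le_nsum1 _ _ (fun k => (rweight sigma r k * f k) ^+ 2)) => l; exact: sqr_ge0.
Qed.

End weights.

#[global] Hint Resolve japanese_ge1 japanese_gt0 : core.
Lemma mule_lty_fin (R : realType) (w c : R) (S : \bar R) : 0 < w -> (0 <= S)%E ->
  (w%:E * S <= c%:E)%E -> (S < +oo)%E.
Proof.
move=> w0; case: S => [x _ _|_|//]; first by rewrite ltry.
by rewrite gt0_muley ?lte_fin.
Qed.

Section tame.
Variables (R : realType) (d : nat) (d0 : (0 < d)%N).
Local Notation K := 'rV[int]_d.

Let ltw sigma r (k : K) := ltW (@rweight_gt0 R d sigma r k).

(** A bound for the square norm of the inverse bracket to the power [r0],
uniform in [r0 >= (d + 1) / 2]. *)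
Definition lattice_const : R := Num.sqrt ((3 + 2 * d%:R) ^+ d).
Local Notation Z := lattice_const.

Lemma lattice_const_ge0 : 0 <= Z. Proof. exact: sqrtr_ge0. Qed.

Lemma nsum_japanese (r0 : R) : d.+1%:R <= 2 * r0 ->
  (nsum (fun k : K => (japanese R k `^ (- r0)) ^+ 2)%R <= (Z ^+ 2)%:E)%E.
Proof.
move=> hr; rewrite sqr_sqrtr; last by rewrite exprn_ge0// addr_ge0// mulr_ge0.
apply: le_trans (lattice_sum R d0); apply: le_nsum => k.
rewrite -powR_mulrn ?powR_ge0// -powRrM ler_powR//.
by rewrite mulNr lerN2 mulrC.
Qed.

Lemma nsum_weight0 sigma (r0 : R) (f : K -> R) A : d.+1%:R <= 2 * r0 -> 0 <= A ->
  (forall k, 0 <= f k) -> hbound sigma r0 f A ->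
  (nsum (fun k => expR (sigma * norm1 R k) * f k)%R <= (Z * A)%:E)%E.
Proof.
move=> hr A0 f0 fA.
have -> : (fun k => expR (sigma * norm1 R k) * f k) =
   (fun k => japanese R k `^ (- r0) * (rweight sigma r0 k * f k)).
  apply/funext => k; rewrite /rweight powRN; field.
  by rewrite gt_eqF ?powR_gt0.
apply: nsum_cauchy_schwarz => //; first exact: lattice_const_ge0.
- by move=> k; exact: powR_ge0.
- by move=> k; rewrite mulr_ge0 ?ltw.
- exact: nsum_japanese.
Qed.

(** Cauchy-Schwarz against the inverse bracket: the exponent exceeds half the
dimension, so the Fourier series converges absolutely. *)
Lemma hbound_nsum sigma (r0 : R) (f : K -> R) A : 0 <= sigma -> d.+1%:R <= 2 * r0 -> 0 <= A ->
  (forall k, 0 <= f k) -> hbound sigma r0 f A -> (nsum f <= (Z * A)%:E)%E.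
Proof.
move=> s0 hr A0 f0 fA; apply: le_trans (nsum_weight0 hr A0 f0 fA).
apply: le_nsum => k; rewrite ler_peMl// -expR0 ler_expR mulr_ge0// sumr_ge0// => j _.
Qed.

(** The high norm falls on one factor at a time, and the other factor is only
measured in the norm of exponent [r0]. The exponential weight is
submultiplicative, so the constant is independent of [sigma]. *)
Lemma tame_conv sigma (r r0 : R) (a m : K -> R) (A A0 M M0 : R) :
  0 <= sigma -> d.+1%:R <= 2 * r0 -> 0 <= r ->
  0 <= A -> 0 <= A0 -> 0 <= M -> 0 <= M0 ->
  (forall k, 0 <= a k) -> (forall k, 0 <= m k) ->
  hbound sigma r0 a A0 -> hbound sigma r a A ->
  hbound sigma r0 m M0 -> hbound sigma r m M ->
  (forall k, (nsum (fun l => a (k - l) * m l)%R < +oo)%E) /\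
  hbound sigma r (rconv a m) (2 `^ r * Z * (A0 * M + A * M0)).
Proof.
move=> s0 hr r_ge0 A_ A0_ M_ M0_ a0 m0 ha0 ha hm0 hm.
pose E (k : K) := expR (sigma * norm1 R k).
have E0 k : 0 <= E k by exact: expR_ge0.
pose x1 k := rweight sigma r k * a k; pose y1 k := E k * m k.
pose x2 k := rweight sigma r k * m k; pose y2 k := E k * a k.
have x10 k : 0 <= x1 k by rewrite mulr_ge0 ?ltw.
have x20 k : 0 <= x2 k by rewrite mulr_ge0 ?ltw.
have y10 k : 0 <= y1 k by rewrite mulr_ge0.
have y20 k : 0 <= y2 k by rewrite mulr_ge0.
have Z0 := lattice_const_ge0.
have [f1 n1] := young A_ (mulr_ge0 Z0 M0_) x10 y10 ha (nsum_weight0 hr M0_ m0 hm0).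
have [f2 n2] := young M_ (mulr_ge0 Z0 A0_) x20 y20 hm (nsum_weight0 hr A0_ a0 ha0).
have pw k l : rweight sigma r k * (a (k - l) * m l) <=
    2 `^ r * (x1 (k - l) * y1 l + x2 l * y2 (k - l)).
  rewrite [leRHS](_ : _ = (E (k - l) * E l) * (2 `^ r * (japanese R (k - l) `^ r + japanese R l `^ r)) * (a (k - l) * m l)); last first.
    by rewrite /x1 /x2 /y1 /y2 /rweight -/(E _) -/(E l); ring.
  rewrite ler_wpM2r ?mulr_ge0// ler_pM ?expR_ge0 ?powR_ge0//.
    rewrite -expRD ler_expR -mulrDr ler_wpM2l//.
    by rewrite -{1}(subrK l k) norm1D.
  by rewrite -{1}(subrK l k) japanese_powD.
pose c2 k := nsum (fun l => x2 l * y2 (k - l)).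
have c2E k : c2 k = nsum (fun l => x2 (k - l) * y2 l).
  rewrite /c2 -(@nsum_reindex _ _ _ (fun l => k - l) (fun l => k - l) (fun l => x2 (k - l) * y2 l)).
  - by congr nsum; apply/funext => l /=; rewrite subKr.
  - by move=> l; rewrite subKr.
  - by move=> l; rewrite subKr.
have p20 : 0 <= 2 `^ r :> R by exact: powR_ge0.
have key k : (nsum (fun l => rweight sigma r k * (a (k - l) * m l))%R <=
    (2 `^ r)%:E * ((rconv x1 y1 k)%:E + (rconv x2 y2 k)%:E))%E.
  have F1 : nsum (fun l => x1 (k - l) * y1 l) \is a fin_num.
    by rewrite ge0_fin_numE// nsum_ge0// => l; rewrite mulr_ge0.
  have F2 : nsum (fun l => x2 (k - l) * y2 l) \is a fin_num.
    by rewrite ge0_fin_numE// nsum_ge0// => l; rewrite mulr_ge0.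
  rewrite /rconv !fineK// -c2E -nsumD; last 2 first.
  - by move=> l; rewrite mulr_ge0.
  - by move=> l; rewrite mulr_ge0.
  rewrite -nsumZ//; last by move=> l; rewrite addr_ge0// mulr_ge0.
  exact: le_nsum.
have am0 k l : 0 <= a (k - l) * m l by rewrite mulr_ge0.
have fin k : (nsum (fun l => a (k - l) * m l)%R < +oo)%E.
  apply: (mule_lty_fin (@rweight_gt0 R d sigma r k) (nsum_ge0 (am0 k))).
  by rewrite -nsumZ ?ltw//; apply: le_trans (key k) _; rewrite -EFinD -EFinM.
split => //; rewrite /hbound.
have conv0 x y k : (forall i, 0 <= x i) -> (forall i, 0 <= y i) -> 0 <= @rconv R K x y k by exact: rconv_ge0.
apply: (@le_trans _ _ (nsum (fun k => (2 `^ r * (rconv x1 y1 k + rconv x2 y2 k)) ^+ 2)%R)).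
  apply: le_nsum => k; have W := ltw sigma r k; have cc : 0 <= rconv x1 y1 k + rconv x2 y2 k.
    by rewrite addr_ge0// conv0.
  rewrite ler_sqr ?nnegrE; last 2 first.
  - by rewrite mulr_ge0// conv0.
  - by rewrite mulr_ge0.
  have F : nsum (fun l => a (k - l) * m l) \is a fin_num.
    by rewrite ge0_fin_numE ?fin// nsum_ge0.
  have := key k; rewrite nsumZ ?ltw// -{1}(fineK F) -EFinD -!EFinM lee_fin.
  exact.
under [X in nsum X]eq_fun do rewrite exprMn.
rewrite nsumZ ?sqr_ge0// => [|k]; last exact: sqr_ge0.
rewrite (_ : 2 `^ r * Z * _ = 2 `^ r * (A * (Z * M0) + M * (Z * A0))); last by ring.
rewrite [leRHS](_ : _ = ((2 `^ r) ^+ 2)%:E * ((A * (Z * M0) + M * (Z * A0)) ^+ 2)%:E)%E; last first.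
  by rewrite -EFinM exprMn.
rewrite lee_wpmul2l ?lee_fin ?sqr_ge0//.
apply: nsum_sqrD => //; rewrite ?mulr_ge0// => k; exact: conv0.
Qed.

End tame.

(** * The equations [u' = q u - f] and [v' = f - q v] on a half-line *)

Section derive_rules.
Variables (R : realType) (V W : normedModType R) (x v : V).

Lemma derive_eq (f : V -> W) df df' : is_derive x v f df -> df = df' -> is_derive x v f df'.
Proof. by move=> h <-. Qed.

(** The rules of differentiation are restated for functions given pointwise,
the form in which they are chained with [derive_eq]. *)
Lemma dD (f g : V -> W) df dg : is_derive x v f df -> is_derive x v g dg ->
  is_derive x v (fun y => f y + g y) (df + dg).
Proof. exact: is_deriveD. Qed.

Lemma dN (f : V -> W) df : is_derive x v f df -> is_derive x v (fun y => - f y) (- df).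
Proof. exact: is_deriveN. Qed.

Lemma dB (f g : V -> W) df dg : is_derive x v f df -> is_derive x v g dg ->
  is_derive x v (fun y => f y - g y) (df - dg).
Proof. exact: is_deriveB. Qed.

Lemma dZ (c : R) (f : V -> W) df : is_derive x v f df -> is_derive x v (fun y => c *: f y) (c *: df).
Proof. exact: is_deriveZ. Qed.

Lemma dcst (c : W) : is_derive x v (fun=> c) 0.
Proof. exact: is_derive_cst. Qed.

Lemma dMl (c : R) (f : V -> R) df : is_derive x v f df -> is_derive x v (fun y => c * f y) (c * df).
Proof. exact: is_deriveZ. Qed.

Lemma dM (f g : V -> R) df dg : is_derive x v f df -> is_derive x v g dg ->
  is_derive x v (fun y => f y * g y) (f x * dg + df * g x).
Proof. by move=> hf hg; rewrite [df * _]mulrC; exact: is_deriveM. Qed.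

End derive_rules.

Section ode_real.
Variable R : realType.
Implicit Types (f u v : R -> R) (q t M : R).

(** Functions of the half-line are encoded as functions of the real line that
are constant on the negative half-line, so that equality of functions is
equality of their restrictions. *)
Definition half_line (T : Type) (f : R -> T) := forall t, f t = f (Num.max 0 t).

Lemma max0_continuous : continuous (fun t : R => Num.max 0 t).
Proof.
move=> t; apply: (@continuous_max R R (fun=> 0) id); first exact: cst_continuous.
exact: cvg_id.
Qed.

Lemma antiderivative f : continuous f -> exists F : R -> R,
  [/\ continuous F, half_line F, F 0 = 0 &
      forall t, 0 < t -> is_derive t (1 : R) F (f t)].
Proof.
move=> cf; pose F0 (x : R) : R := \int[lebesgue_measure]_(s in `[-1, x]) f s.
have dF0 t : -1 < t -> is_derive t (1 : R) F0 (f t).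
  move=> t1; have tt : t < t + 1 by rewrite ltrDl.
  have [|//| |d1 d2] := @continuous_FTC1 R f (BLeft (-1)) t (t + 1) tt.
  - apply: continuous_compact_integrable; first exact: segment_compact.
    by apply: continuous_subspaceT => x; exact: cf.
  - exact: cf.
  by split; [exact: d1|rewrite -derive1E; exact: d2].
exists (fun t => F0 (Num.max 0 t) - F0 0); split.
- move=> t; apply: cvgB; last exact: cvg_cst.
  apply: (@continuous_comp _ _ _ (fun t : R => Num.max 0 t) F0); first exact: max0_continuous.
  have m1 : -1 < Num.max 0 t by rewrite lt_max ltrN10.
  have [d _] := dF0 _ m1.
  by apply: differentiable_continuous; apply/derivable1_diffP.
- by move=> t; rewrite maxA maxxx.
- by rewrite maxxx subrr.
move=> t t0; apply: (@near_eq_is_derive _ _ _ (fun t => F0 t - F0 0)).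
  near=> s; rewrite max_r//; apply/ltW; near: s.
  exact: lt_nbhsr.
have t1 : -1 < t by apply: lt_trans t0; rewrite ltrN10.
by apply: derive_eq (dB (dF0 _ t1) (dcst _ _ _)) _; rewrite subr0.
Unshelve. all: by end_near. Qed.

Lemma half_line_nondecreasing f df : continuous f ->
  (forall t, 0 < t -> is_derive t (1 : R) f (df t)) ->
  (forall t, 0 < t -> 0 <= df t) ->
  forall s t, 0 <= s -> s <= t -> f s <= f t.
Proof.
move=> cf hd h0 s t s0 st; rewrite -subr_ge0.
move: st; rewrite le_eqVlt => /predU1P[->|st]; first by rewrite subrr.
have [||c /[!in_itv]/= /andP[sc _] ->] := @MVT R f df s t st.
- by move=> x /[!in_itv]/= /andP[sx _]; apply: hd; exact: le_lt_trans sx.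
- by apply: continuous_subspaceT => x; exact: cf.
by rewrite mulr_ge0 ?subr_ge0 ?(ltW st)// h0// (le_lt_trans s0).
Qed.

Lemma half_line_constant f : continuous f ->
  (forall t, 0 < t -> is_derive t (1 : R) f 0) -> forall t, 0 <= t -> f t = f 0.
Proof.
move=> cf hd t t0; apply/eqP; rewrite eq_le; apply/andP; split; last first.
  exact: (@half_line_nondecreasing f (fun=> 0)).
rewrite -lerN2; apply: (@half_line_nondecreasing (fun x => - f x) (fun=> - 0)) => //.
- by move=> x; apply: cvgN; exact: cf.
- by move=> x x0; apply: is_deriveN; exact: hd.
Qed.

Lemma is_derive_expRM q t : is_derive t (1 : R) (fun t => expR (q * t)) (q * expR (q * t)).
Proof.
have h : is_derive t (1 : R) (fun t => q * t) (q * 1) by apply: dMl; exact: is_derive_id.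
have := @is_derive1_comp _ expR (fun t => q * t) t _ _ (is_derive_expR _) h.
by rewrite mulr1 mulrC.
Qed.

Lemma continuous_expRM q : continuous (fun t : R => expR (q * t)).
Proof.
move=> t; apply: (@continuous_comp _ _ _ (fun t => q * t) expR).
  by apply: cvgM; [exact: cvg_cst|exact: cvg_id].
exact: continuous_expR.
Qed.

(** Among the solutions of [u' = q u - f] exactly one stays bounded, the one
whose initial value is the integral of [e^(-q t) f t] over the half-line. Its
existence is obtained by monotonicity: both [A t - (M / q) e^(-q t)] and its
analogue for [- A] increase, where [A] is the primitive, which bounds the limit
of [A]. *)
Lemma outgoing_exists q f M : 0 < q -> continuous f -> (forall t, `|f t| <= M) ->
  exists u, [/\ continuous u, half_line u,
    forall t, 0 < t -> is_derive t (1 : R) u (q * u t - f t) &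
    forall t, `|u t| <= M / q].
Proof.
move=> q0 cf fM; have M0 : 0 <= M by apply: le_trans (fM 0).
pose e t := expR (- q * t).
have [|A [cA hA A0 dA]] := @antiderivative (fun t => e t * f t).
  by move=> t; apply: cvgM; [exact: continuous_expRM|exact: cf].
have de t := is_derive_expRM (- q) t.
have e0 t : 0 < e t by exact: expR_gt0.
have ce : continuous e by exact: continuous_expRM.
pose P (s : R) t := s * A t - (M / q) * e t.
have dP s t : 0 < t -> is_derive t (1 : R) (P s) (e t * (s * f t + M)).
  move=> t0; have := dA t t0 => dAt.
  apply: derive_eq (dB (dMl s dAt) (dMl (M / q) (de t))) _.
  rewrite -/(e t); field; exact: lt0r_neq0.
have cP s : continuous (P s).
  move=> t; apply: cvgB; apply: cvgM; [exact: cvg_cst|exact: cA|exact: cvg_cst|exact: ce].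
have incP (s : R) : `|s| = 1 -> forall a b, 0 <= a -> a <= b -> P s a <= P s b.
  move=> s1; apply: half_line_nondecreasing (cP s) (dP s) _ => t t0.
  rewrite mulr_ge0 ?(ltW (e0 t))//.
  have : `|s * f t| <= M by rewrite normrM s1 mul1r.
  by rewrite ler_norml => /andP[? _]; lra.
have inc1 := incP 1 (normr1 _); have inc2 := incP (-1) (normrN1 _).
have Me t : 0 <= M / q * e t by rewrite mulr_ge0 ?divr_ge0 ?(ltW q0) ?(ltW (e0 t)).
pose S := [set P 1 t | t in [set t | 0 <= t]].
have bd a b : 0 <= a -> 0 <= b -> P 1 a <= A b + M / q * e b.
  move=> a0 b0; have [ab|/ltW ba] := leP a b.
    by apply: le_trans (inc1 _ _ a0 ab) _; rewrite /P; have := Me b; lra.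
  have := inc2 _ _ b0 ba; rewrite /P; have := Me a; have := Me b; lra.
have hS : has_sup S.
  split; first by exists (P 1 0), 0 => /=.
  by exists (A 0 + M / q * e 0) => _ [t t0 <-]; exact: bd.
pose L := sup S.
have L1 t : 0 <= t -> P 1 t <= L.
  by move=> t0; apply: ub_le_sup; [case: hS|exists t].
have L2 t : 0 <= t -> L <= A t + M / q * e t.
  move=> t0; apply: ge_sup; first by case: hS.
  by move=> _ [s s0 <-]; exact: bd.
pose u0 t := expR (q * t) * (L - A t).
have eE t : expR (q * t) * e t = 1 by rewrite /e mulNr expRN divff// gt_eqF ?expR_gt0.
exists (fun t => u0 (Num.max 0 t)); split.
- move=> t; apply: (@continuous_comp _ _ _ (fun t : R => Num.max 0 t) u0); first exact: max0_continuous.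
  by apply: cvgM; [exact: continuous_expRM|apply: cvgB; [exact: cvg_cst|exact: cA]].
- by move=> t; rewrite maxA maxxx.
- move=> t t0; apply: (@near_eq_is_derive _ _ _ u0).
    near=> s; rewrite max_r//; apply/ltW; near: s; exact: lt_nbhsr.
  have dAt := dA t t0; have deq := is_derive_expRM q t.
  apply: derive_eq (dM deq (dB (dcst _ _ L) dAt)) _.
  rewrite (max_r (ltW t0)) /u0 sub0r.
  set x := expR _; set y := f t; set z := e t.
  have xz : x * z = 1 by exact: eE.
  have -> : q * (x * (L - A t)) - y = q * (x * (L - A t)) - (x * z) * y by rewrite xz mul1r.
  ring.
move=> t; set s := Num.max 0 t; have s0 : 0 <= s by rewrite le_max lexx.
rewrite /u0 normrM gtr0_norm ?expR_gt0// -[M / q]mulr1 -(eE s) mulrCA.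
rewrite ler_wpM2l ?expR_ge0// ler_norml; apply/andP.
by have := L1 s s0; have := L2 s s0; rewrite /P; lra.
Unshelve. all: by end_near. Qed.

(** The solution of [v' = f - q v] vanishing at the origin; the bound follows
from the monotonicity of [(M / q) e^(q t)] plus or minus the primitive of [e^(q
t) f t]. *)
Lemma incoming_exists q f M : 0 < q -> continuous f -> (forall t, `|f t| <= M) ->
  exists v, [/\ continuous v, half_line v, v 0 = 0,
    forall t, 0 < t -> is_derive t (1 : R) v (f t - q * v t) &
    forall t, `|v t| <= M / q].
Proof.
move=> q0 cf fM; have M0 : 0 <= M by apply: le_trans (fM 0).
pose e t := expR (q * t).
have [|A [cA hA A0 dA]] := @antiderivative (fun t => e t * f t).
  by move=> t; apply: cvgM; [exact: continuous_expRM|exact: cf].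
have de t := is_derive_expRM q t.
have e0 t : 0 < e t by exact: expR_gt0.
have ce : continuous e by exact: continuous_expRM.
pose P (s : R) t := s * A t + (M / q) * e t.
have dP s t : 0 < t -> is_derive t (1 : R) (P s) (e t * (s * f t + M)).
  move=> t0; have := dA t t0 => dAt.
  apply: derive_eq (dD (dMl s dAt) (dMl (M / q) (de t))) _.
  rewrite -/(e t); field; exact: lt0r_neq0.
have cP s : continuous (P s).
  move=> t; apply: cvgD; apply: cvgM; [exact: cvg_cst|exact: cA|exact: cvg_cst|exact: ce].
have incP (s : R) : `|s| = 1 -> forall b, 0 <= b -> P s 0 <= P s b.
  move=> s1 b b0; apply: half_line_nondecreasing (cP s) (dP s) _ _ _ (lexx 0) b0 => t t0.
  rewrite mulr_ge0 ?(ltW (e0 t))//.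
  have : `|s * f t| <= M by rewrite normrM s1 mul1r.
  by rewrite ler_norml => /andP[? _]; lra.
have inc1 := incP 1 (normr1 _); have inc2 := incP (-1) (normrN1 _).
pose v0 t := expR (- q * t) * A t.
have eE t : expR (- q * t) * e t = 1 by rewrite /e mulNr expRN mulVf// gt_eqF ?expR_gt0.
exists (fun t => v0 (Num.max 0 t)); split.
- move=> t; apply: (@continuous_comp _ _ _ (fun t : R => Num.max 0 t) v0); first exact: max0_continuous.
  by apply: cvgM; [exact: continuous_expRM|exact: cA].
- by move=> t; rewrite maxA maxxx.
- by rewrite maxxx /v0 A0 mulr0.
- move=> t t0; apply: (@near_eq_is_derive _ _ _ v0).
    near=> s; rewrite max_r//; apply/ltW; near: s; exact: lt_nbhsr.
  have dAt := dA t t0; have deq := is_derive_expRM (- q) t.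
  apply: derive_eq (dM deq dAt) _.
  rewrite (max_r (ltW t0)) /v0.
  set x := expR _; set z := e t.
  have xz : x * z = 1 by exact: eE.
  have -> : f t - q * (x * A t) = (x * z) * f t - q * (x * A t) by rewrite xz mul1r.
  ring.
move=> t; set s := Num.max 0 t; have s0 : 0 <= s by rewrite le_max lexx.
rewrite /v0 normrM gtr0_norm ?expR_gt0// -[M / q]mulr1 -(eE s) mulrCA.
have Mq : 0 <= M / q by rewrite divr_ge0// ltW.
rewrite ler_wpM2l ?expR_ge0// ler_norml; apply/andP.
have := inc1 s s0; have := inc2 s s0; rewrite /P /e mulr0 expR0 mulr1 A0 mulr0 -/(e s); lra.
Unshelve. all: by end_near. Qed.

(** A nonzero solution of the homogeneous equation grows like [1 + q t]. *)
Lemma outgoing_unique q u B : 0 < q -> continuous u ->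
  (forall t, 0 < t -> is_derive t (1 : R) u (q * u t)) -> (forall t, `|u t| <= B) ->
  forall t, 0 <= t -> u t = 0.
Proof.
move=> q0 cu du uB.
have h : forall t, 0 <= t -> expR (- q * t) * u t = u 0.
  move=> t t0; have := @half_line_constant (fun t => expR (- q * t) * u t) _ _ t t0.
  rewrite mulr0 expR0 mul1r; apply.
    by move=> s; apply: cvgM; [exact: continuous_expRM|exact: cu].
  move=> s s0; have := du s s0 => dus; have de := is_derive_expRM (- q) s.
  by apply: derive_eq (dM de dus) _; ring.
have {}h t : 0 <= t -> u t = expR (q * t) * u 0.
  by move=> t0; rewrite -(h t t0) mulrA mulNr expRN divff ?mul1r// gt_eqF ?expR_gt0.
suff u0 : u 0 = 0 by move=> t t0; rewrite h// u0 mulr0.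
apply/eqP/negPn/negP => u0; have n0 : 0 < `|u 0| by rewrite normr_gt0.
have B0 : 0 <= B by apply: le_trans (uB 0).
pose t := B / (q * `|u 0|).
have t0 : 0 <= t by rewrite divr_ge0// mulr_ge0 ?(ltW q0).
have := uB t; rewrite h// normrM gtr0_norm ?expR_gt0//; apply/negP; rewrite -ltNge.
apply: (@lt_le_trans _ _ ((1 + q * t) * `|u 0|)); last first.
  by rewrite ler_wpM2r// expR_ge1Dx.
rewrite mulrDl mul1r (_ : q * t * `|u 0| = B) ?ltrDr//.
by rewrite /t; field; rewrite !gt_eqF.
Qed.

Lemma incoming_unique q u : continuous u ->
  (forall t, 0 < t -> is_derive t (1 : R) u (- q * u t)) -> u 0 = 0 ->
  forall t, 0 <= t -> u t = 0.
Proof.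
move=> cu du u0 t t0.
have : expR (q * t) * u t = 0.
  have := @half_line_constant (fun t => expR (q * t) * u t) _ _ t t0.
  rewrite u0 mulr0; apply.
    by move=> s; apply: cvgM; [exact: continuous_expRM|exact: cu].
  move=> s s0; have := du s s0 => dus; have de := is_derive_expRM q s.
  by apply: derive_eq (dM de dus) _; ring.
by move=> /eqP; rewrite mulf_eq0 gt_eqF ?expR_gt0//= => /eqP.
Qed.

End ode_real.

Section ode_complex.
Variable R : realType.
Local Notation C := (Rcomplex R).
Implicit Types (f g u v : R -> C) (q t M : R).

Lemma cvg_Re (T : Type) (F : set_system T) (FF : Filter F) (f : T -> C) (l : C) :
  f x @[x --> F] --> l -> complex.Re (f x) @[x --> F] --> complex.Re l.
Proof.
move=> /cvgrPdist_lt h; apply/cvgrPdist_lt => e e0; apply: filterS (h e e0) => x.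
apply: le_lt_trans; have := normc_Re (l - f x); rewrite normrcE.
by case: (l) (f x) => a b [c d].
Qed.

Lemma cvg_Im (T : Type) (F : set_system T) (FF : Filter F) (f : T -> C) (l : C) :
  f x @[x --> F] --> l -> complex.Im (f x) @[x --> F] --> complex.Im l.
Proof.
move=> /cvgrPdist_lt h; apply/cvgrPdist_lt => e e0; apply: filterS (h e e0) => x.
apply: le_lt_trans; have := normc_Im (l - f x); rewrite normrcE.
by case: (l) (f x) => a b [c d].
Qed.

Lemma cvg_complex (T : Type) (F : set_system T) (FF : Filter F) (f g : T -> R) (a b : R) :
  f x @[x --> F] --> a -> g x @[x --> F] --> b ->
  (Complex (f x) (g x) : C) @[x --> F] --> (Complex a b : C).
Proof.
move=> /cvgrPdist_lt hf /cvgrPdist_lt hg; apply/cvgrPdist_lt => e e0.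
have e2 : 0 < e / 2 by rewrite divr_gt0.
near=> x; apply: le_lt_trans (normc_le_ReIm _) _; rewrite [ltRHS]splitr /=.
by apply: ltrD; near: x; [exact: hf|exact: hg].
Unshelve. all: by end_near. Qed.

Lemma complexE (z : C) : z = Complex (complex.Re z) (complex.Im z).
Proof. by case: z. Qed.

Definition half_line_bounded f M :=
  [/\ continuous f, half_line f & forall t, normc (f t) <= M].

Definition outgoing_spec q f u := [/\ continuous u, half_line u,
  forall t, 0 < t -> is_derive t (1 : R) u (q *: u t - f t) &
  exists M, forall t, normc (u t) <= M].

Definition incoming_spec q f v := [/\ continuous v, half_line v, v 0 = 0 &
  forall t, 0 < t -> is_derive t (1 : R) v (f t - q *: v t)].

(** The solution operators are defined by choice, and linearity is deduced from
uniqueness, which spares an integral formula. *)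
Definition outgoing q f : R -> C :=
  if pselect (exists u, outgoing_spec q f u) is left h then projT1 (cid h) else fun=> 0.

Definition incoming q f : R -> C :=
  if pselect (exists v, incoming_spec q f v) is left h then projT1 (cid h) else fun=> 0.

Let outgoing_ex q f M : 0 < q -> half_line_bounded f M -> exists u,
  outgoing_spec q f u /\ forall t, normc (u t) <= 2 * (M / q).
Proof.
move=> q0 [cf hf fM].
have [|t|u [cu hu du uM]] := @outgoing_exists R q (fun t => complex.Re (f t)) M q0.
- by move=> t; apply: cvg_Re; exact: cf.
- exact: le_trans (normc_Re _) (fM t).
have [|t|v [cv hv dv vM]] := @outgoing_exists R q (fun t => complex.Im (f t)) M q0.
- by move=> t; apply: cvg_Im; exact: cf.
- exact: le_trans (normc_Im _) (fM t).
have b t : normc (Complex (u t) (v t)) <= 2 * (M / q).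
  by apply: le_trans (normc_le_ReIm _) _; rewrite /=; have := uM t; have := vM t; lra.
exists (fun t => Complex (u t) (v t)); split => //; split.
- by move=> t; apply: cvg_complex; [exact: cu|exact: cv].
- by move=> t; rewrite hu hv.
- move=> t t0; apply: derive_eq (is_derive_complex (du t t0) (dv t t0)) _.
  by case: (f t).
- by exists (2 * (M / q)).
Qed.

Let incoming_ex q f M : 0 < q -> half_line_bounded f M -> exists u,
  incoming_spec q f u /\ forall t, normc (u t) <= 2 * (M / q).
Proof.
move=> q0 [cf hf fM].
have [|t|u [cu hu u0 du uM]] := @incoming_exists R q (fun t => complex.Re (f t)) M q0.
- by move=> t; apply: cvg_Re; exact: cf.
- exact: le_trans (normc_Re _) (fM t).
have [|t|v [cv hv v0 dv vM]] := @incoming_exists R q (fun t => complex.Im (f t)) M q0.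
- by move=> t; apply: cvg_Im; exact: cf.
- exact: le_trans (normc_Im _) (fM t).
exists (fun t => Complex (u t) (v t)); split; first split.
- by move=> t; apply: cvg_complex; [exact: cu|exact: cv].
- by move=> t; rewrite hu hv.
- by rewrite u0 v0.
- move=> t t0; apply: derive_eq (is_derive_complex (du t t0) (dv t t0)) _.
  by case: (f t).
by move=> t; apply: le_trans (normc_le_ReIm _) _; rewrite /=; have := uM t; have := vM t; lra.
Qed.

Lemma outgoing_unique_spec q f u v : 0 < q -> outgoing_spec q f u -> outgoing_spec q f v -> u = v.
Proof.
move=> q0 [cu hu du [A uA]] [cv hv dv [B vB]].
have dw t : 0 < t -> is_derive t (1 : R) (fun t => u t - v t) (q *: (u t - v t)).
  move=> t0; apply: derive_eq (dB (du t t0) (dv t t0)) _.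
  by rewrite scalerBr opprB addrA subrK.
have wB t : normc (u t - v t) <= A + B.
  by apply: le_trans (le_normcD _ _) _; rewrite normcN lerD.
apply/funext => t; rewrite hu hv; set s := Num.max 0 t.
have s0 : 0 <= s by rewrite le_max lexx.
apply/eqP; rewrite -subr_eq0; apply/eqP; rewrite [LHS]complexE.
have cw : continuous (fun t => u t - v t) by move=> x; apply: cvgB; [exact: cu|exact: cv].
have -> : complex.Re (u s - v s) = 0.
  apply: (@outgoing_unique R q (fun t => complex.Re (u t - v t)) (A + B)) => //.
  - by move=> x; apply: cvg_Re; exact: cw.
  - move=> x x0; apply: derive_eq (is_derive_Re (dw x x0)) _.
    by case: (u x - v x).
  - by move=> x; exact: le_trans (normc_Re _) (wB x).
have -> // : complex.Im (u s - v s) = 0.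
apply: (@outgoing_unique R q (fun t => complex.Im (u t - v t)) (A + B)) => //.
- by move=> x; apply: cvg_Im; exact: cw.
- move=> x x0; apply: derive_eq (is_derive_Im (dw x x0)) _.
  by case: (u x - v x).
- by move=> x; exact: le_trans (normc_Im _) (wB x).
Qed.

Lemma incoming_unique_spec q f u v : incoming_spec q f u -> incoming_spec q f v -> u = v.
Proof.
move=> [cu hu u0 du] [cv hv v0 dv].
have dw t : 0 < t -> is_derive t (1 : R) (fun t => u t - v t) ((- q) *: (u t - v t)).
  move=> t0; apply: derive_eq (dB (du t t0) (dv t t0)) _.
  by rewrite scaleNr scalerBr opprB opprB addrC addrA subrK addrC.
apply/funext => t; rewrite hu hv; set s := Num.max 0 t.
have s0 : 0 <= s by rewrite le_max lexx.
apply/eqP; rewrite -subr_eq0; apply/eqP; rewrite [LHS]complexE.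
have cw : continuous (fun t => u t - v t) by move=> x; apply: cvgB; [exact: cu|exact: cv].
have -> : complex.Re (u s - v s) = 0.
  apply: (@incoming_unique R q (fun t => complex.Re (u t - v t))) => //.
  - by move=> x; apply: cvg_Re; exact: cw.
  - move=> x x0; apply: derive_eq (is_derive_Re (dw x x0)) _.
    by case: (u x - v x).
  - by rewrite u0 v0 subrr.
have -> // : complex.Im (u s - v s) = 0.
apply: (@incoming_unique R q (fun t => complex.Im (u t - v t))) => //.
- by move=> x; apply: cvg_Im; exact: cw.
- move=> x x0; apply: derive_eq (is_derive_Im (dw x x0)) _.
  by case: (u x - v x).
- by rewrite u0 v0 subrr.
Qed.

Lemma outgoingP q f M : 0 < q -> half_line_bounded f M ->
  outgoing_spec q f (outgoing q f) /\ forall t, normc (outgoing q f t) <= 2 * (M / q).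
Proof.
move=> q0 hf; have [u [su uM]] := outgoing_ex q0 hf.
rewrite /outgoing; case: pselect => [h|[]]; last by exists u.
have sh := projT2 (cid h); split => // t.
by rewrite (outgoing_unique_spec q0 sh su).
Qed.

Lemma incomingP q f M : 0 < q -> half_line_bounded f M ->
  incoming_spec q f (incoming q f) /\ forall t, normc (incoming q f t) <= 2 * (M / q).
Proof.
move=> q0 hf; have [u [su uM]] := incoming_ex q0 hf.
rewrite /incoming; case: pselect => [h|[]]; last by exists u.
have sh := projT2 (cid h); split => // t.
by rewrite (incoming_unique_spec sh su).
Qed.

Lemma half_line_boundedD f g A B : half_line_bounded f A -> half_line_bounded g B ->
  half_line_bounded (fun t => f t + g t) (A + B).
Proof.
move=> [cf hf fA] [cg hg gB]; split.
- by move=> t; apply: cvgD; [exact: cf|exact: cg].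
- by move=> t; rewrite hf hg.
- by move=> t; apply: le_trans (le_normcD _ _) _; rewrite lerD.
Qed.

Lemma cvg_mulc (T : Type) (F : set_system T) (FF : Filter F) (c : C) (f : T -> C) (l : C) :
  f x @[x --> F] --> l -> c * f x @[x --> F] --> c * l.
Proof.
move=> /cvgrPdist_lt h; apply/cvgrPdist_lt => e e0.
have c1 : 0 < normc c + 1 by rewrite ltr_wpDl// normc_ge0.
apply: filterS (h _ (divr_gt0 e0 c1)) => x; rewrite -mulrBr !normrcE normcM => hx.
apply: (@le_lt_trans _ _ ((normc c + 1) * normc (l - f x))).
  by rewrite ler_wpM2r ?normc_ge0// lerDl.
by rewrite mulrC -ltr_pdivlMr.
Qed.

Lemma half_line_boundedM (c : C) f A : half_line_bounded f A ->
  half_line_bounded (fun t => c * f t) (normc c * A).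
Proof.
move=> [cf hf fA]; split.
- by move=> t; apply: cvg_mulc; exact: cf.
- by move=> t; rewrite hf.
- by move=> t; rewrite normcM ler_wpM2l ?normc_ge0.
Qed.

Lemma is_derive_mulc (V : normedModType R) (p w : V) (c : C) (f : V -> C) df :
  is_derive p w f df -> is_derive p w (fun x => c * f x) (c * df).
Proof.
apply: (@is_derive_lin R V C C (fun z => c * z) (normc c)).
- by move=> x y; rewrite mulrBr.
- by move=> a x; rewrite !scalerc mulrCA.
- by move=> x; rewrite !normrcE normcM.
Qed.

Lemma scaler_mulrc (a : R) (c z : C) : a *: (c * z) = c * (a *: z).
Proof. by rewrite !scalerc mulrCA. Qed.

Lemma outgoing_linear q f g A B (c : C) : 0 < q ->
  half_line_bounded f A -> half_line_bounded g B ->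
  outgoing q (fun t => c * f t + g t) = (fun t => c * outgoing q f t + outgoing q g t).
Proof.
move=> q0 hf hg.
have [[cu hu du [U uU]] _] := outgoingP q0 hf; have [[cv hv dv [V vV]] _] := outgoingP q0 hg.
have [sw _] := outgoingP q0 (half_line_boundedD (half_line_boundedM c hf) hg).
apply: outgoing_unique_spec q0 sw _; split.
- by move=> t; apply: cvgD; [apply: cvg_mulc; exact: cu|exact: cv].
- by move=> t; rewrite hu hv.
- move=> t t0; apply: derive_eq (dD (is_derive_mulc c (du t t0)) (dv t t0)) _.
  by rewrite scalerDr scaler_mulrc mulrBr opprD addrACA.
- exists (normc c * U + V) => t; apply: le_trans (le_normcD _ _) _.
  by rewrite normcM lerD// ler_wpM2l ?normc_ge0.
Qed.

Lemma incoming_linear q f g A B (c : C) : 0 < q ->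
  half_line_bounded f A -> half_line_bounded g B ->
  incoming q (fun t => c * f t + g t) = (fun t => c * incoming q f t + incoming q g t).
Proof.
move=> q0 hf hg.
have [[cu hu u0 du] _] := incomingP q0 hf; have [[cv hv v0 dv] _] := incomingP q0 hg.
have [sw _] := incomingP q0 (half_line_boundedD (half_line_boundedM c hf) hg).
apply: incoming_unique_spec sw _; split.
- by move=> t; apply: cvgD; [apply: cvg_mulc; exact: cu|exact: cv].
- by move=> t; rewrite hu hv.
- by rewrite u0 v0 mulr0 addr0.
- move=> t t0; apply: derive_eq (dD (is_derive_mulc c (du t t0)) (dv t t0)) _.
  by rewrite scalerDr scaler_mulrc mulrBr opprD addrACA.
Qed.

End ode_complex.

(** * Inverting a perturbation of the identity in two norms *)

Section neumann.
Variables (R : realType) (V : lmodType R) (N L : V -> R).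
Hypothesis N_ge0 : forall x, 0 <= N x.
Hypothesis ND : forall x y, N (x + y) <= N x + N y.
Hypothesis NZ : forall (a : R) x, N (a *: x) <= `|a| * N x.
Hypothesis N_eq0 : forall x, N x = 0 -> x = 0.
Hypothesis L_ge0 : forall x, 0 <= L x.
Hypothesis LN : forall x, L x <= N x.
Hypothesis N_complete : forall (x : nat -> V) (c q : R), 0 < c -> 0 < q -> q < 1 ->
  (forall n, N (x n) <= c * q ^+ n) ->
  exists y, forall n, N (y - \sum_(i < n) x i) <= c * q ^+ n / (1 - q).

Lemma seminormN x : N (- x) <= N x.
Proof. by have := NZ (-1) x; rewrite scaleN1r normrN1 mul1r. Qed.

Lemma seminormB x y : N (x - y) <= N x + N y.
Proof. by apply: le_trans (ND _ _) _; rewrite lerD2l seminormN. Qed.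

Lemma geometric_small (c q e : R) : 0 <= c -> 0 <= q -> q < 1 -> 0 < e ->
  exists n, c * q ^+ n < e.
Proof.
move=> c0 q0 q1 e0.
have h : (fun n => c * q ^+ n) @ \oo --> (c * 0 : R).
  by apply: cvgM; [exact: cvg_cst|apply: cvg_expr; rewrite ger0_norm].
move: h; rewrite mulr0 => /cvgrPdist_lt/(_ e e0)[n _ /(_ n (leqnn n))] /=.
rewrite sub0r normrN ger0_norm; first by exists n.
by rewrite mulr_ge0// exprn_ge0.
Qed.

Section one_operator.
Variables (K : V -> V) (lam : R).
Hypothesis K_linear : linear K.
Hypothesis lam_ge0 : 0 <= lam.
Hypothesis KL : forall x, L (K x) <= 2^-1 * L x.
Hypothesis KN : forall x, N (K x) <= 2^-1 * N x + lam * L x.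

Let KD x y : K (x + y) = K x + K y.
Proof. by rewrite -[x in LHS]scale1r K_linear scale1r. Qed.

Let KB x y : K (x - y) = K x - K y.
Proof. by apply: (addIr (K y)); rewrite -KD !subrK. Qed.

Let K_sum (I : Type) (s : seq I) (f : I -> V) : K (\sum_(i <- s) f i) = \sum_(i <- s) K (f i).
Proof. by apply: (big_morph K KD); apply: (addrI (K 0)); rewrite -KD !addr0. Qed.

(** A solution of [y = K y] has vanishing low norm, hence vanishing high norm.
*)
Lemma neumann_unique y : y = K y -> y = 0.
Proof.
move=> yK; have Ly : L y = 0.
  by apply/eqP; rewrite eq_le L_ge0 andbT; have := KL y; rewrite -yK; lra.
apply/N_eq0/eqP; rewrite eq_le N_ge0 andbT.
by have := KN y; rewrite -yK Ly mulr0; lra.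
Qed.

(** Although only the low norm of [K] is small, [K] contracts the combined norm
[N + 4 lam L], with ratio [3/4] because [lam + 4 lam / 2 = (3/4) (4 lam)]; the
solution inherits a bound linear in [lam]. *)
Lemma neumann_exists x : exists y, y = x + K y /\ N y <= 4 * (N x + 4 * lam * L x).
Proof.
pose B := N x + 4 * lam * L x; have B0 : 0 <= B by rewrite addr_ge0// !mulr_ge0.
pose S n := N (iter n K x) + 4 * lam * L (iter n K x).
have SB n : S n <= B * (3 / 4) ^+ n.
  elim: n => [|n ih]; first by rewrite expr0 mulr1.
  rewrite exprS; apply: (@le_trans _ _ ((3 / 4) * S n)).
    rewrite /S iterS; set z := iter n K x.
    have := KN z; have := KL z; have := N_ge0 z.
    move=> h1 h2 h3; have : 4 * lam * L (K z) <= 4 * lam * (2^-1 * L z).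
      by rewrite ler_wpM2l// mulr_ge0.
    have : 0 <= N z by []. lra.
  by rewrite mulrCA ler_wpM2l.
have NB n : N (iter n K x) <= B * (3 / 4) ^+ n.
  by apply: le_trans (SB n); rewrite lerDl !mulr_ge0.
have q0 : 0 < (3 / 4 : R) by lra. have q1 : (3 / 4 : R) < 1 by lra.
have q2 : 1 - 3 / 4 = 4^-1 :> R by field.
have sol (c : R) y : B <= c -> (forall n, N (y - \sum_(i < n) iter i K x) <= c * (3 / 4) ^+ n / (1 - 3 / 4)) -> y = x + K y.
  move=> Bc hy; have c0 : 0 <= c by exact: le_trans Bc.
  apply/eqP; rewrite -subr_eq0; apply/eqP/N_eq0/eqP; rewrite eq_le N_ge0 andbT.
  rewrite leNgt; apply/negP => e0.
  (* The residual of the partial sums is at most a multiple of the n-th power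
  of the ratio. *)
  pose D := 4 * c * (2 + lam); have D0 : 0 <= D by rewrite !mulr_ge0// addr_ge0.
  have [n hn] := geometric_small D0 (ltW q0) q1 e0; move: hn; apply/negP; rewrite -leNgt.
  have E : y - (x + K y) = (y - \sum_(i < n.+1) iter i K x) - K (y - \sum_(i < n) iter i K x).
    have -> : \sum_(i < n.+1) iter i K x = x + \sum_(i < n) K (iter i K x).
      by rewrite big_ord_recl.
    by rewrite KB K_sum !opprD opprK !addrA [RHS]addrAC subrK.
  rewrite {}E; apply: le_trans (seminormB _ _) _.
  set a := y - _; set b := y - _.
  have ha : N a <= 4 * c * (3 / 4) ^+ n.
    apply: le_trans (hy n.+1) _; rewrite q2 invrK mulrC -mulrA ler_wpM2l// ler_wpM2l//.
    by rewrite exprS ler_piMl ?exprn_ge0// ltW.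
  have hb : N b <= 4 * c * (3 / 4) ^+ n.
    by apply: le_trans (hy n) _; rewrite q2 invrK mulrC mulrA.
  have := KN b; have h1 : lam * L b <= lam * (4 * c * (3 / 4) ^+ n).
    by rewrite ler_wpM2l// (le_trans (LN _)).
  have p0 : 0 <= 4 * c * (3 / 4) ^+ n by apply: le_trans hb.
  rewrite /D; move: h1; set P := 4 * c * _ in p0 ha hb *.
  have -> : 4 * c * (2 + lam) * (3 / 4) ^+ n = (2 + lam) * P by rewrite /P; ring.
  have := N_ge0 b; lra.
(* Completeness is stated with a positive constant; a vanishing bound forces
[x] to vanish. *)
have [Beq0|Bn0] := eqVneq B 0.
  have x0 : x = 0.
    apply/N_eq0/eqP; rewrite eq_le N_ge0 andbT -Beq0 /B lerDl !mulr_ge0//.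
  have K0 : K 0 = 0 by apply: (addrI (K 0)); rewrite -KD !addr0.
  exists 0; rewrite x0 K0 add0r; split => //.
  have -> : N (0 : V) = 0.
    by apply/eqP; rewrite eq_le N_ge0 andbT; have := NZ 0 0; rewrite scale0r normr0 mul0r.
  by rewrite add0r !mulr_ge0.
have Bp : 0 < B by rewrite lt_def Bn0.
have [y hy] := N_complete Bp q0 q1 NB.
exists y; split; first exact: (sol B).
by have := hy 0%N; rewrite big_ord0 subr0 expr0 mulr1 q2 invrK mulrC.
Qed.

Definition resolvent x : V := projT1 (cid (neumann_exists x)).

Lemma resolventP x : resolvent x = x + K (resolvent x).
Proof. by rewrite /resolvent; case: cid => y []. Qed.

Lemma resolvent_le x : N (resolvent x) <= 4 * (N x + 4 * lam * L x).
Proof. by rewrite /resolvent; case: cid => y []. Qed.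

Lemma resolvent_unique x y : y = x + K y -> y = resolvent x.
Proof.
move=> hy; apply/eqP; rewrite -subr_eq0; apply/eqP/neumann_unique.
by rewrite KB {1}hy {1}(resolventP x) opprD addrACA subrr add0r.
Qed.

End one_operator.

End neumann.

Section series_of_sequences.
Variables (R : realType).

Lemma nsum_nat (f : nat -> R) (M : \bar R) : (forall n, 0 <= f n) ->
  (forall n, (\sum_(i < n) f i)%:E <= M)%E -> (nsum f <= M)%E.
Proof.
move=> f0 h; apply: nsum_le => A.
pose n := (\max_(i <- A) i).+1; apply: le_trans (h n); rewrite lee_fin.
rewrite -(big_mkord xpredT f) /index_iota subn0.
have -> : \sum_(i <- A) f i = \sum_(i <- iota 0 n | i \in A) f i.
  rewrite -[RHS]big_filter; apply: perm_big; apply: uniq_perm.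
  - exact: fset_uniq.
  - by rewrite filter_uniq// iota_uniq.
  move=> i; rewrite mem_filter mem_iota /= add0n.
  by case: (boolP (i \in A)) => //= iA; apply/esym; rewrite ltnS; apply: leq_bigmax_seq.
by rewrite [leRHS](bigID [in A])/= lerDl sumr_ge0.
Qed.

Lemma psum_iota (I : nmodType) (f : nat -> I) n :
  \sum_(i <- [fset m in iota 0 n]%fset) f i = \sum_(i < n) f i.
Proof.
rewrite -(big_mkord xpredT f) /index_iota subn0; apply: perm_big.
apply: uniq_perm; [exact: fset_uniq|exact: iota_uniq|].
by move=> m; rewrite !inE.
Qed.

Lemma nsum_shift (f : nat -> R) n : (forall m, 0 <= f m) ->
  (nsum (fun m => if (m < n)%N then 0 else f m)%R <= nsum (fun j => f (n + j)%N))%E.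
Proof.
move=> f0; apply: nsum_nat => [m|N]; first by case: ifP.
have [Nn|nN] := leqP N n.
  rewrite big1 => [|i _]; first exact: nsum_ge0.
  by rewrite (leq_trans (ltn_ord i) Nn).
have -> : \sum_(i < N) (if (i < n)%N then 0 else f i) = \sum_(j < N - n) f (n + j)%N.
  rewrite -(big_mkord xpredT (fun i => if (i < n)%N then 0 else f i)).
  rewrite (@big_cat_nat _ _ _ n)//=; last exact: ltnW.
  rewrite big_nat big1 => [|i /andP[_ ->]//]; rewrite add0r.
  rewrite -{1}[n]add0n big_addn big_mkord; apply: eq_bigr => i _.
  by rewrite ltnNge leq_addl/= addnC.
by rewrite -(@psum_iota R (fun j => f (n + j)%N)); apply: fsum_le_nsum.
Qed.

Lemma nsum_geometric (c q : R) : 0 <= c -> 0 <= q -> q < 1 ->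
  (nsum (fun n => c * q ^+ n)%R <= (c / (1 - q))%:E)%E.
Proof.
move=> c0 q0 q1; apply: nsum_nat => n; first by rewrite mulr_ge0// exprn_ge0.
rewrite lee_fin.
have q2 : 0 < 1 - q by rewrite subr_gt0.
suff -> : \sum_(i < n) c * q ^+ i = c / (1 - q) - c * q ^+ n / (1 - q).
  by rewrite lerBlDr lerDl divr_ge0 ?(ltW q2)// mulr_ge0// exprn_ge0.
elim: n => [|n ih]; first by rewrite big_ord0 expr0 mulr1 subrr.
rewrite big_ord_recr/= ih exprS; field; exact: lt0r_neq0.
Qed.

Variables (d : nat) (sigma r : R).
Local Notation K := 'rV[int]_d.

(** Minkowski's inequality for infinitely many terms: Cauchy-Schwarz with
weights [M m]. *)
Lemma hbound_series (f : nat -> K -> R) (M : nat -> R) (S : R) : 0 <= S ->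
  (forall m k, 0 <= f m k) -> (forall m, 0 < M m) -> (nsum M <= S%:E)%E ->
  (forall m, hbound sigma r (f m) (M m)) ->
  (forall k, (nsum (f^~ k) < +oo)%E) /\
  hbound sigma r (fun k => fine (nsum (f^~ k))) S.
Proof.
move=> S0 f0 M0 MS fM.
pose w k := @rweight R d sigma r k; have w0 k : 0 < w k by exact: rweight_gt0.
pose q k := nsum (fun m => (w k * f m k) ^+ 2 / M m).
have qpos m k : 0 <= (w k * f m k) ^+ 2 / M m by rewrite divr_ge0 ?sqr_ge0// ltW.
have q0 k : (0 <= q k)%E by exact: nsum_ge0.
have qs : (\esum_(k in setT) q k <= S%:E)%E.
  rewrite /q /nsum esum_exchange; last by move=> k m; rewrite lee_fin.
  apply: le_trans MS; apply: le_esum => m _.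
  rewrite -/(nsum (fun k => (w k * f m k) ^+ 2 / M m)).
  under [X in nsum X]eq_fun do rewrite mulrC.
  rewrite nsumZ ?invr_ge0 ?(ltW (M0 m))//; last by move=> k; exact: sqr_ge0.
  have -> : (M m)%:E = ((M m)^-1%:E * (M m ^+ 2)%:E)%E.
    by rewrite -EFinM expr2 mulrA mulVf ?mul1r// gt_eqF.
  by rewrite lee_wpmul2l ?lee_fin ?invr_ge0 ?(ltW (M0 m))//; exact: fM.
have qf k : q k \is a fin_num.
  rewrite ge0_fin_numE//; apply: (esum_lty_all (g := q)) => //.
  exact: le_lt_trans qs (ltry _).
have cs k : (nsum (fun m => w k * f m k)%R <= (Num.sqrt (fine (q k)) * Num.sqrt S)%:E)%E.
  have -> : (fun m => w k * f m k) = (fun m => (w k * f m k / Num.sqrt (M m)) * Num.sqrt (M m)).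
    by apply/funext => m; rewrite mulfVK// gt_eqF ?sqrtr_gt0.
  have wf m : 0 <= w k * f m k by rewrite mulr_ge0// ltW.
  apply: nsum_cauchy_schwarz; rewrite ?sqrtr_ge0//.
  - by move=> m; rewrite divr_ge0 ?sqrtr_ge0.
  - rewrite sqr_sqrtr ?fine_ge0// fineK//.
    by apply: le_nsum => m; rewrite exprMn exprVn sqr_sqrtr// ltW.
  - by rewrite sqr_sqrtr//; apply: le_trans MS; apply: le_nsum => m; rewrite sqr_sqrtr// ltW.
have fin k : (nsum (f^~ k) < +oo)%E.
  apply: (mule_lty_fin (w0 k) (nsum_ge0 (fun m => f0 m k))).
  by rewrite -nsumZ ?(ltW (w0 k))//; exact: cs.
split => //; rewrite /hbound.
apply: (@le_trans _ _ (nsum (fun k => S * fine (q k))%R)).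
  apply: le_nsum => k.
  have -> : S * fine (q k) = (Num.sqrt (fine (q k)) * Num.sqrt S) ^+ 2.
    by rewrite exprMn !sqr_sqrtr ?fine_ge0// mulrC.
  have F : nsum (f^~ k) \is a fin_num by rewrite ge0_fin_numE ?fin// nsum_ge0.
  rewrite ler_sqr ?nnegrE.
  - by rewrite -lee_fin EFinM fineK// -nsumZ ?(ltW (w0 k))//; exact: cs.
  - by rewrite mulr_ge0 ?(ltW (w0 k))// fine_ge0// nsum_ge0.
  - by rewrite mulr_ge0 ?sqrtr_ge0.
rewrite nsumZ//; last by move=> k; exact: fine_ge0.
rewrite expr2 EFinM lee_wpmul2l ?lee_fin//; apply: le_trans qs.
by apply: le_esum => k _; rewrite fineK.
Qed.

End series_of_sequences.

(** * Families of modes *)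

(** The components of a mode are its flux through the level surfaces ([None]),
its vertical velocity ([Some None]) and its horizontal velocities ([Some (Some
j)]). *)
Definition comp (d : nat) := option (option 'I_d).

Section mode_size.
Variables (R : realType) (d : nat).
Local Notation C := (Rcomplex R).
Local Notation mode := (comp d -> R -> C).
Implicit Types (F G : mode).

Definition mode_bounded F (M : R) := forall i, half_line_bounded (F i) M.

Definition msize F : R := sup [set normc (F p.1 p.2) | p in [set: comp d * R]].

Lemma msize_le F M : (forall i t, normc (F i t) <= M) -> msize F <= M.
Proof.
move=> h; apply: ge_sup; first by exists (normc (F None 0)), (None, 0).
by move=> _ [[i t] _ <-]; exact: h.
Qed.

Lemma le_msize F M i t : mode_bounded F M -> normc (F i t) <= msize F.
Proof.
move=> FM; apply: ub_le_sup; last by exists (i, t).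
by exists M => _ [[j s] _ <-]; have [_ _] := FM j; exact.
Qed.

Lemma msize_ge0 F M : mode_bounded F M -> 0 <= msize F.
Proof. by move=> FM; apply: le_trans (le_msize None 0 FM); exact: normc_ge0. Qed.

Lemma mode_bounded_msize F M : mode_bounded F M -> mode_bounded F (msize F).
Proof.
by move=> FM i; have [cF hF _] := FM i; split => // t; exact: le_msize FM.
Qed.

Lemma mode_boundedD F G A B : mode_bounded F A -> mode_bounded G B ->
  mode_bounded (fun i t => F i t + G i t) (A + B).
Proof. by move=> FA GB i; apply: half_line_boundedD; [exact: FA|exact: GB]. Qed.

Lemma mode_boundedM (c : C) F A : mode_bounded F A ->
  mode_bounded (fun i t => c * F i t) (normc c * A).
Proof. by move=> FA i; apply: half_line_boundedM; exact: FA. Qed.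

End mode_size.

Section wspace.
Variables (R : realType) (d : nat) (sigma r : R).
Local Notation C := (Rcomplex R).
Local Notation K := 'rV[int]_d.
Local Notation family := (K -> comp d -> R -> C).

Definition wspace_pred : {pred family} := fun W =>
  `[< (forall k, exists M, mode_bounded (W k) M) /\
      exists M, 0 <= M /\ hbound sigma r (fun k => msize (W k)) M >].

(** The modes are stored after multiplication by [e^(t/2)]: continuity and
boundedness in this form express exponential decay in depth, and the size of a
mode is a supremum over all depths. The size is square-summable with the weight
of a Sobolev norm. *)
Record wspace := WSpace { wfun :> family; _ : wfun \in wspace_pred }.

HB.instance Definition _ := [isSub for wfun].
HB.instance Definition _ := [Choice of wspace by <:].

Let majorant_pred (W : family) (m : K -> R) M :
  (forall k, mode_bounded (W k) (m k)) -> (forall k, 0 <= m k) -> 0 <= M ->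
  hbound sigma r m M -> W \in wspace_pred.
Proof.
move=> Wm m0 M0 mM; apply/asboolP; split=> [k|]; first by exists (m k).
exists M; split => //; apply: hbound_le mM => k; first exact: msize_ge0 (Wm k).
by apply: msize_le => i t; have [_ _] := Wm k i; exact.
Qed.

Lemma wspace_submod_closed : submod_closed wspace_pred.
Proof.
split=> [|a U V /asboolP[Ub [A [A0 UA]]] /asboolP[Vb [B [B0 VB]]]].
  apply: (@majorant_pred _ (fun=> 0) 0) => //.
    move=> k i; split; [exact: cst_continuous|by []|].
    by move=> t; rewrite (_ : (0 : family) k i t = 0)// normc0.
  by rewrite /hbound /nsum esum1 ?lee_fin ?sqr_ge0// => k _; rewrite mulr0 expr0n.
have U0 k : 0 <= msize (U k) by have [M hM] := Ub k; exact: msize_ge0 hM.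
have V0 k : 0 <= msize (V k) by have [M hM] := Vb k; exact: msize_ge0 hM.
pose c : C := (a%:C)%C.
apply: (@majorant_pred _ (fun k => normc c * msize (U k) + msize (V k)) (normc c * A + B)).
- move=> k; have [M hM] := Ub k; have [M' hM'] := Vb k.
  have -> : (a *: U + V) k = (fun i t => c * U k i t + V k i t).
    by apply/funext => i; apply/funext => t; rewrite -scalerc.
  apply: mode_boundedD; last exact: mode_bounded_msize hM'.
  by apply: mode_boundedM; exact: mode_bounded_msize hM.
- by move=> k; rewrite addr_ge0// mulr_ge0// normc_ge0.
- by rewrite addr_ge0// mulr_ge0// normc_ge0.
- apply: hboundD => //; first by rewrite mulr_ge0// normc_ge0.
    by move=> k; rewrite mulr_ge0// normc_ge0.
  by apply: hboundZ => //; exact: normc_ge0.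
Qed.

HB.instance Definition _ :=
  GRing.isSubmodClosed.Build R family wspace_pred wspace_submod_closed.
HB.instance Definition _ := [SubChoice_isSubLmodule of wspace by <:].

Implicit Types (U V W : wspace).

Lemma wspace_bounded W k : mode_bounded (W k) (msize (W k)).
Proof. by have /asboolP[h _] := valP W; have [M] := h k; exact: mode_bounded_msize. Qed.

Lemma wsize_ge0 W k : 0 <= msize (W k).
Proof. exact: msize_ge0 (wspace_bounded W k). Qed.

Lemma wsize_ge W k i t : normc (W k i t) <= msize (W k).
Proof. exact: le_msize (wspace_bounded W k). Qed.

Lemma wspaceDE V W k i t : (V + W) k i t = V k i t + W k i t.
Proof. by []. Qed.

Lemma wspaceZE (a : R) W k i t : (a *: W) k i t = a *: W k i t.
Proof. by []. Qed.

Lemma wspaceBE V W k i t : (V - W) k i t = V k i t - W k i t.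
Proof. by []. Qed.

Lemma wspace0E k i t : (0 : wspace) k i t = 0.
Proof. by []. Qed.

Definition wnorm (rho : R) W : R := fine (hnorm sigma rho (fun k => Complex (msize (W k)) 0)).

Let normc_size W k : normc (Complex (msize (W k)) 0) = msize (W k).
Proof. by rewrite /= expr0n addr0 sqrtr_sqr ger0_norm// wsize_ge0. Qed.

Lemma wnorm_ge0 rho W : 0 <= wnorm rho W.
Proof. by rewrite fine_ge0// hnorm_ge0. Qed.

Lemma wnorm_bound rho W : rho <= r -> hbound sigma rho (fun k => msize (W k)) (wnorm rho W).
Proof.
move=> rr; have /asboolP[_ [M [M0 hM]]] := valP W.
have h : (hnorm sigma rho (fun k => Complex (msize (W k)) 0%R) <= M%:E)%E.
  apply/hnorm_leP => //; under [X in hbound _ _ X _]eq_fun do rewrite normc_size.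
  by apply: hbound_wmono rr _ hM => k; exact: wsize_ge0.
have : (hnorm sigma rho (fun k => Complex (msize (W k)) 0%R) <= (wnorm rho W)%:E)%E.
  by rewrite fineK// ge0_fin_numE ?hnorm_ge0// (le_lt_trans h) ?ltry.
move=> /hnorm_leP-/(_ (wnorm_ge0 _ _)).
by under [X in hbound _ _ X _]eq_fun do rewrite normc_size.
Qed.

Lemma wnorm_le rho W M : 0 <= M -> hbound sigma rho (fun k => msize (W k)) M -> wnorm rho W <= M.
Proof.
move=> M0 hM; rewrite -lee_fin.
have h : (hnorm sigma rho (fun k => Complex (msize (W k)) 0%R) <= M%:E)%E.
  by apply/hnorm_leP => //; under [X in hbound _ _ X _]eq_fun do rewrite normc_size.
by rewrite fineK// ge0_fin_numE ?hnorm_ge0// (le_lt_trans h) ?ltry.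
Qed.

Lemma wnorm_le_majorant rho W (m : K -> R) M : 0 <= M ->
  (forall k i t, normc (W k i t) <= m k) -> hbound sigma rho m M -> wnorm rho W <= M.
Proof.
move=> M0 Wm mM; apply: wnorm_le => //; apply: hbound_le mM => k; first exact: wsize_ge0.
by apply: msize_le => i t; exact: Wm.
Qed.

Lemma wnorm_mono rho rho' W : rho <= rho' -> rho' <= r -> wnorm rho W <= wnorm rho' W.
Proof.
move=> rr rr'; apply: wnorm_le; first exact: wnorm_ge0.
by apply: (hbound_wmono rr); [move=> k; exact: wsize_ge0|exact: wnorm_bound].
Qed.

Lemma wnormD rho V W : rho <= r -> wnorm rho (V + W) <= wnorm rho V + wnorm rho W.
Proof.
move=> rr; apply: (@wnorm_le_majorant _ _ (fun k => msize (V k) + msize (W k))).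
- by rewrite addr_ge0// wnorm_ge0.
- move=> k i t; rewrite wspaceDE; apply: le_trans (le_normcD _ _) _.
  by apply: lerD; exact: wsize_ge.
- apply: hboundD; rewrite ?wnorm_ge0//; try by move=> k; exact: wsize_ge0.
  exact: wnorm_bound. exact: wnorm_bound.
Qed.

Lemma cscalew_subproof (c : C) W : (fun k i t => c * W k i t) \in wspace_pred.
Proof.
have /asboolP[_ [A [A0 WA]]] := valP W.
apply: (@majorant_pred _ (fun k => normc c * msize (W k)) (normc c * A)).
- by move=> k; apply: mode_boundedM; exact: wspace_bounded.
- by move=> k; rewrite mulr_ge0 ?normc_ge0// wsize_ge0.
- by rewrite mulr_ge0 ?normc_ge0.
- by apply: hboundZ => //; [exact: normc_ge0|move=> k; exact: wsize_ge0].
Qed.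

Definition cscalew (c : C) W : wspace := WSpace (cscalew_subproof c W).

Lemma cscalewE (c : C) W k i t : cscalew c W k i t = c * W k i t.
Proof. by []. Qed.

Lemma wnorm_cscale rho (c : C) W : rho <= r -> wnorm rho (cscalew c W) <= normc c * wnorm rho W.
Proof.
move=> rr; apply: (@wnorm_le_majorant _ _ (fun k => normc c * msize (W k))).
- by rewrite mulr_ge0 ?normc_ge0// wnorm_ge0.
- by move=> k i t; rewrite cscalewE normcM ler_wpM2l ?normc_ge0// wsize_ge.
- apply: hboundZ; [exact: normc_ge0|by move=> k; exact: wsize_ge0|exact: wnorm_bound].
Qed.

Lemma wspace_eqP V W : (forall k i t, V k i t = W k i t) -> V = W.
Proof.
by move=> h; apply: val_inj; apply/funext => k; apply/funext => i; apply/funext => t; exact: h.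
Qed.

Lemma scalew_cscale (a : R) W : a *: W = cscalew (a%:C)%C W.
Proof. by apply: wspace_eqP => k i t; rewrite wspaceZE cscalewE scalerc. Qed.

Lemma wnormZ rho (a : R) W : rho <= r -> wnorm rho (a *: W) <= `|a| * wnorm rho W.
Proof.
move=> rr; rewrite scalew_cscale; apply: le_trans (wnorm_cscale _ _ rr) _.
by rewrite /= expr0n addr0 sqrtr_sqr.
Qed.

Lemma wnorm_eq0 W : wnorm r W = 0 -> W = 0.
Proof.
move=> W0; apply: wspace_eqP => k i t; apply: eq0_normc.
have := wnorm_bound W (lexx r); rewrite W0 => /hbound_entry h.
have {}h := h k (lexx _) (wsize_ge0 W).
apply/eqP; rewrite eq_le normc_ge0 andbT (le_trans (wsize_ge W k i t))//.
by rewrite -(pmulr_rle0 _ (rweight_gt0 sigma r k)).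
Qed.

(** Minkowski's inequality bounds the sum of the sizes, and the entries then
converge by dominated convergence. *)
Lemma wspace_complete (x : nat -> wspace) (c q : R) : 0 < c -> 0 < q -> q < 1 ->
  (forall n, wnorm r (x n) <= c * q ^+ n) ->
  exists y, forall n, wnorm r (y - \sum_(i < n) x i) <= c * q ^+ n / (1 - q).
Proof.
move=> c0 q0 q1 hx; have q2 : 0 < 1 - q by rewrite subr_gt0.
have cq m : 0 < c * q ^+ m by rewrite mulr_gt0// exprn_gt0.
have xm m : hbound sigma r (fun k => msize (x m k)) (c * q ^+ m).
  by apply: hbound_mono (wnorm_bound _ (lexx r)) => //; exact: wnorm_ge0.
have s0 m k : 0 <= msize (x m k) by exact: wsize_ge0.
have S0 : 0 <= c / (1 - q) by rewrite divr_ge0// ltW.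
have [fin hS] := hbound_series S0 s0 cq (nsum_geometric (ltW c0) (ltW q0) q1) xm.
pose T k := fine (nsum (fun m => msize (x m k))).
have TE k : nsum (fun m => msize (x m k)) = (T k)%:E.
  by rewrite fineK// ge0_fin_numE ?fin// nsum_ge0.
have ax k i t : asum (fun m => x m k i t).
  by apply: asum_le (fin k) => m; exact: wsize_ge.
pose Y k i t := csum (fun m => x m k i t).
have hY : Y \in wspace_pred.
  apply: (majorant_pred (m := T) (M := c / (1 - q))) => //.
    move=> k i; split.
    - move=> t; apply: (@csum_dominated _ _ _ _ _ _ _ (fun m => msize (x m k))).
      + exact: fin.
      + by near=> s => m; exact: wsize_ge.
      + by move=> m; exact: wsize_ge.
      + by move=> m; have [cx _ _] := wspace_bounded (x m) k i; exact: cx.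
    - move=> t; congr csum; apply/funext => m.
      by have [_ hh _] := wspace_bounded (x m) k i; exact: hh.
    - move=> t; apply: (@csum_norm_le _ _ _ (fun m => msize (x m k))).
        by move=> m; exact: wsize_ge.
      by rewrite TE.
  by move=> k; rewrite fine_ge0// nsum_ge0.
exists (WSpace hY) => n.
have cn : 0 < c * q ^+ n by [].
have [fin2 hS2] := @hbound_series R d sigma r (fun j k => msize (x (n + j)%N k))
   (fun j => (c * q ^+ n) * q ^+ j) (c * q ^+ n / (1 - q)) (divr_ge0 (ltW cn) (ltW q2))
   (fun j k => s0 (n + j)%N k) (fun j => mulr_gt0 cn (exprn_gt0 j q0))
   (nsum_geometric (ltW cn) (ltW q0) q1)
   (fun j => eq_ind _ (hbound sigma r _) (xm (n + j)%N) _ (etrans (congr1 _ (exprD q n j)) (mulrA _ _ _))).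
apply: wnorm_le_majorant hS2; first by rewrite divr_ge0 ?(ltW cn) ?(ltW q2).
move=> k i t.
pose B : {fset nat} := [fset m in iota 0 n]%fset.
have sumE : (\sum_(m < n) x m) k i t = psum (fun m => x m k i t) B.
  have E : forall s : seq nat, (\sum_(m <- s) x m) k i t = \sum_(m <- s) x m k i t.
    by elim=> [|m s ih]; rewrite ?big_nil// !big_cons wspaceDE ih.
  by rewrite -(@psum_iota _ x) E.
rewrite wspaceBE sumE -csum_off//.
apply: (@csum_norm_le _ _ _ (fun m => if (m < n)%N then 0 else msize (x m k))).
  move=> m; rewrite !inE mem_iota add0n /=; case: ifP => _; first by rewrite normc0.
  exact: wsize_ge.
have F2 : nsum (fun j => msize (x (n + j)%N k)) \is a fin_num.
  by rewrite ge0_fin_numE ?fin2// nsum_ge0.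
by rewrite fineK//; exact: (nsum_shift n (fun m => s0 m k)).
Unshelve. all: by end_near. Qed.

End wspace.

(** * The flat problem, mode by mode *)

Section mode_operator.
Variables (R : realType) (d : nat).
Local Notation C := (Rcomplex R).
Local Notation K := 'rV[int]_d.
Implicit Types (k : K) (g : R -> C) (e : 'I_d -> R -> C).

Definition isym k (j : 'I_d) : C := Complex 0 (k ord0 j)%:~R.

Definition div_symbol k e : R -> C := fun t => \sum_(j < d) isym k j * e j t.

Definition decay (q : R) (t : R) : R := expR (- q * Num.max 0 t).

(** With flux [N] and potential [phi], the combination [N - |k| phi] grows like
[e^(|k| t)] unless it is the bounded solution. The rate [|k| + 1/2] accounts
for the stored weight [e^(t/2)]. The frequency zero carries no wave. *)
Definition wave_out k g e : R -> C := fun t =>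
  if k == 0 then 0 else
  - outgoing (norm2 R k + 2^-1) (fun t => norm2 R k *: g t - div_symbol k e t) t.

(** The combination [N + |k| phi] decays, with rate [|k| - 1/2 >= 1/2] after
weighting. Its initial value is that of the other wave, so that the two waves
contribute nothing to the Dirichlet data. *)
Definition wave_in k g e : R -> C := fun t =>
  if k == 0 then 0 else
  incoming (norm2 R k - 2^-1) (fun t => - (norm2 R k *: g t) - div_symbol k e t) t
  + decay (norm2 R k - 2^-1) t *: wave_out k g e 0.

(** The response of a mode to the flux [g] of the gradient and to the slopes
[e]: half the sum of the waves is the flux and half their difference, divided
by [|k|], the potential. *)
Definition mode_solve k g e : comp d -> R -> C := fun i t =>
  match i with
  | None => 2^-1 *: (wave_out k g e t + wave_in k g e t)
  | Some None => 2^-1 *: (wave_out k g e t + wave_in k g e t) + g t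
  | Some (Some j) =>
      (2 * norm2 R k)^-1 *: (isym k j * (wave_in k g e t - wave_out k g e t)) - e j t
  end.

Lemma normc_isym k j : normc (isym k j) = `|(k ord0 j)%:~R|.
Proof. by rewrite /= expr0n add0r sqrtr_sqr. Qed.

Lemma normc_isym_le k j : normc (isym k j) <= norm2 R k.
Proof. by rewrite normc_isym coord_le_norm2. Qed.

Lemma half_line_bounded0 : half_line_bounded (fun=> 0 : C) 0.
Proof. by split => // [t|t]; [exact: cvg_cst|rewrite normc0]. Qed.

Lemma half_line_boundedZ (a : R) (f : R -> C) M : half_line_bounded f M ->
  half_line_bounded (fun t => a *: f t) (`|a| * M).
Proof.
have -> : (fun t => a *: f t) = (fun t => (a%:C)%C * f t) by apply/funext => t; rewrite scalerc.
have -> : `|a| = normc (a%:C)%C by rewrite /= expr0n addr0 sqrtr_sqr.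
exact: half_line_boundedM.
Qed.

Lemma half_line_boundedN (f : R -> C) M : half_line_bounded f M ->
  half_line_bounded (fun t => - f t) M.
Proof.
move=> [cf hf fM]; split.
- by move=> t; apply: cvgN; exact: cf.
- by move=> t; rewrite hf.
- by move=> t; rewrite normcN.
Qed.

Lemma half_line_boundedB (f g : R -> C) A B : half_line_bounded f A -> half_line_bounded g B ->
  half_line_bounded (fun t => f t - g t) (A + B).
Proof. by move=> hf hg; apply: half_line_boundedD => //; exact: half_line_boundedN. Qed.

Lemma half_line_bounded_le (f : R -> C) A B : A <= B -> half_line_bounded f A -> half_line_bounded f B.
Proof. by move=> AB [cf hf fM]; split => // t; exact: le_trans AB. Qed.

Lemma half_line_bounded_sum (I : Type) (s : seq I) (f : I -> R -> C) (A : I -> R) :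
  (forall i, half_line_bounded (f i) (A i)) ->
  half_line_bounded (fun t => \sum_(i <- s) f i t) (\sum_(i <- s) A i).
Proof.
move=> h; elim: s => [|i s ih].
  by under eq_fun do rewrite big_nil; rewrite big_nil; exact: half_line_bounded0.
under eq_fun do rewrite big_cons; rewrite big_cons; exact: half_line_boundedD.
Qed.

Lemma decay_continuous q : continuous (decay q).
Proof.
move=> t; apply: (@continuous_comp _ _ _ (fun t : R => Num.max 0 t) (fun s => expR (- q * s))).
  exact: max0_continuous.
exact: continuous_expRM.
Qed.

Lemma decay_le1 q t : 0 <= q -> decay q t <= 1.
Proof.
by move=> q0; rewrite /decay -[leRHS]expR0 ler_expR mulNr oppr_le0 mulr_ge0// le_max lexx.
Qed.

Lemma half_line_bounded_decay q (z : C) : 0 <= q ->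
  half_line_bounded (fun t => decay q t *: z) (normc z).
Proof.
move=> q0; split.
- move=> t; apply: cvgZl; exact: decay_continuous.
- by move=> t; rewrite /decay maxA maxxx.
- by move=> t; rewrite normcZ ger0_norm ?expR_ge0// ler_piMl ?normc_ge0 ?decay_le1.
Qed.

Section bounds.
Variables (k : K) (g : R -> C) (e : 'I_d -> R -> C) (B : R).
Hypothesis B0 : 0 <= B.
Hypothesis hg : half_line_bounded g (d%:R * B).
Hypothesis he : forall j, half_line_bounded (e j) B.
Local Notation p := (norm2 R k).

Let dB0 : 0 <= d%:R * B.
Proof. by rewrite mulr_ge0. Qed.

Lemma half_line_bounded_div : half_line_bounded (div_symbol k e) (p * (d%:R * B)).
Proof.
have : half_line_bounded (div_symbol k e) (\sum_(j < d) normc (isym k j) * B).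
  by apply: half_line_bounded_sum => j; exact: half_line_boundedM.
apply: half_line_bounded_le.
rewrite mulrCA -[d in d%:R]card_ord mulr_natl -sumr_const.
by apply: ler_sum => j _; rewrite ler_wpM2r ?normc_isym_le.
Qed.

Let src1 : half_line_bounded (fun t => p *: g t - div_symbol k e t) (2 * p * (d%:R * B)).
Proof.
have := half_line_boundedB (half_line_boundedZ p hg) half_line_bounded_div.
apply: half_line_bounded_le; rewrite ger0_norm ?norm2_ge0//; lra.
Qed.

Let src2 : half_line_bounded (fun t => - (p *: g t) - div_symbol k e t) (2 * p * (d%:R * B)).
Proof.
have := half_line_boundedB (half_line_boundedN (half_line_boundedZ p hg)) half_line_bounded_div.
apply: half_line_bounded_le; rewrite ger0_norm ?norm2_ge0//; lra.
Qed.

Lemma wave_out_bounded : half_line_bounded (wave_out k g e) (4 * (d%:R * B)).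
Proof.
rewrite /wave_out; case: eqVneq => [_|k0].
  by apply: half_line_bounded_le half_line_bounded0; rewrite mulr_ge0.
have p1 := norm2_ge1 R k0; have q0 : 0 < p + 2^-1 by lra.
have [[cu hu _ _] uM] := outgoingP q0 src1.
apply: half_line_boundedN; split => // t; apply: le_trans (uM t) _.
rewrite mulrA ler_pdivrMr//.
have : 0 <= p * (d%:R * B) by rewrite mulr_ge0//; lra.
have := dB0; rewrite !mulrDr; lra.
Qed.

Lemma wave_in_bounded : half_line_bounded (wave_in k g e) (12 * (d%:R * B)).
Proof.
have := wave_out_bounded; rewrite /wave_in /wave_out; case: eqVneq => [_ _|k0 hout].
  by apply: half_line_bounded_le half_line_bounded0; rewrite mulr_ge0.
have p1 := norm2_ge1 R k0; have q0 : 0 < p - 2^-1 by lra.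
have [[cu hu _ _] uM] := incomingP q0 src2.
have [_ _ o0] := hout.
have h1 : half_line_bounded (incoming (p - 2^-1) (fun t => - (p *: g t) - div_symbol k e t)) (8 * (d%:R * B)).
  split => // t; apply: le_trans (uM t) _; rewrite mulrA ler_pdivrMr//.
  rewrite -mulrA; have : 0 <= (p - 1) * (d%:R * B) by rewrite mulr_ge0//; lra.
  lra.
have h2 := half_line_bounded_decay (- outgoing (p + 2^-1) (fun t => p *: g t - div_symbol k e t) 0) (ltW q0).
apply: half_line_bounded_le (half_line_boundedD h1 h2).
by have := o0 0; lra.
Qed.

(** The sources enter the wave equations multiplied by [|k|], and solving them
divides by [|k|]: the response is of order zero, uniformly in the frequency. *)
Lemma mode_solve_bounded : mode_bounded (mode_solve k g e) ((9 * d%:R + 1) * B).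
Proof.
have ho := wave_out_bounded; have hi := wave_in_bounded; have dB := dB0.
have hs := half_line_boundedZ 2^-1 (half_line_boundedD ho hi).
have n2 : `|2^-1| = 2^-1 :> R by rewrite ger0_norm.
case=> [[j|]|].
- have [p0|pn] := eqVneq p 0.
    have := half_line_boundedN (he j).
    have -> : mode_solve k g e (Some (Some j)) = (fun t => - e j t).
      by apply/funext => t; rewrite /mode_solve p0 mulr0 invr0 scale0r add0r.
    apply: half_line_bounded_le; have := B0; lra.
  have pp : 0 < p by rewrite lt_def pn norm2_ge0.
  have := half_line_boundedB (half_line_boundedZ (2 * p)^-1
    (half_line_boundedM (isym k j) (half_line_boundedB hi ho))) (he j).
  move=> h; apply: half_line_bounded_le h; rewrite [leRHS]mulrDl mul1r lerD2r.
  rewrite ger0_norm ?invr_ge0 ?mulr_ge0 ?norm2_ge0//.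
  rewrite ler_pdivrMl ?mulr_gt0//.
  have : normc (isym k j) * (12 * (d%:R * B) + 4 * (d%:R * B)) <= p * (12 * (d%:R * B) + 4 * (d%:R * B)).
    by rewrite ler_wpM2r ?normc_isym_le// addr_ge0// mulr_ge0.
  have : 0 <= p * (d%:R * B) by rewrite mulr_ge0 ?norm2_ge0.
  lra.
- have := half_line_boundedD hs hg; apply: half_line_bounded_le; rewrite n2.
  by have := B0; lra.
- by move: hs; apply: half_line_bounded_le; rewrite n2; have := B0; lra.
Qed.

End bounds.

Lemma div_symbol_linear k (c : C) e e' :
  div_symbol k (fun j t => c * e j t + e' j t) = (fun t => c * div_symbol k e t + div_symbol k e' t).
Proof.
apply/funext => t; rewrite /div_symbol mulr_sumr -big_split/=.
by apply: eq_bigr => j _; rewrite mulrDr mulrCA.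
Qed.

Section linear.
Variables (k : K) (c : C) (g g' : R -> C) (e e' : 'I_d -> R -> C) (B B' : R).
Hypothesis (B0 : 0 <= B) (B'0 : 0 <= B').
Hypothesis hg : half_line_bounded g (d%:R * B).
Hypothesis he : forall j, half_line_bounded (e j) B.
Hypothesis hg' : half_line_bounded g' (d%:R * B').
Hypothesis he' : forall j, half_line_bounded (e' j) B'.
Local Notation p := (norm2 R k).
Let G t := c * g t + g' t.
Let E j t := c * e j t + e' j t.

Lemma wave_out_linear t : wave_out k G E t = c * wave_out k g e t + wave_out k g' e' t.
Proof.
rewrite /wave_out; case: eqVneq => [_|k0]; first by rewrite mulr0 addr0.
have p1 := norm2_ge1 R k0; have q0 : 0 < p + 2^-1 by lra.
have h1 := half_line_boundedB (half_line_boundedZ p hg) (half_line_bounded_div k B0 he).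
have h2 := half_line_boundedB (half_line_boundedZ p hg') (half_line_bounded_div k B'0 he').
have := outgoing_linear c q0 h1 h2; rewrite /G /E div_symbol_linear.
have -> : (fun t => c * (p *: g t - div_symbol k e t) + (p *: g' t - div_symbol k e' t)) =
   (fun t => p *: (c * g t + g' t) - (c * div_symbol k e t + div_symbol k e' t)).
  by apply/funext => s; rewrite scalerDr scaler_mulrc mulrBr opprD addrACA.
by move=> ->; rewrite opprD mulrN.
Qed.

Lemma wave_in_linear t : wave_in k G E t = c * wave_in k g e t + wave_in k g' e' t.
Proof.
rewrite /wave_in wave_out_linear; case: eqVneq => [_|k0]; first by rewrite mulr0 addr0.
have p1 := norm2_ge1 R k0; have q0 : 0 < p - 2^-1 by lra.
have h1 := half_line_boundedB (half_line_boundedN (half_line_boundedZ p hg)) (half_line_bounded_div k B0 he).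
have h2 := half_line_boundedB (half_line_boundedN (half_line_boundedZ p hg')) (half_line_bounded_div k B'0 he').
have := incoming_linear c q0 h1 h2; rewrite /G /E div_symbol_linear.
have -> : (fun t => c * (- (p *: g t) - div_symbol k e t) + (- (p *: g' t) - div_symbol k e' t)) =
   (fun t => - (p *: (c * g t + g' t)) - (c * div_symbol k e t + div_symbol k e' t)).
  by apply/funext => s; rewrite scalerDr scaler_mulrc mulrBr mulrN [in RHS]opprD [in RHS]opprD addrACA.
by move=> ->; rewrite scalerDr scaler_mulrc mulrDr addrACA.
Qed.

Lemma mode_solve_linear i t : mode_solve k G E i t = c * mode_solve k g e i t + mode_solve k g' e' i t.
Proof.
case: i => [[j|]|] /=; rewrite wave_in_linear wave_out_linear.
- by rewrite !scalerc /E; ring.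
- by rewrite !scalerc /G; ring.
- by rewrite !scalerc; ring.
Qed.

End linear.

End mode_operator.

(** * The Dirichlet-Neumann operator as a power series *)

Lemma linear_add (R : realType) (V W : lmodType R) (T : V -> W) : linear T ->
  forall x y, T (x + y) = T x + T y.
Proof. by move=> lT x y; rewrite -{1}[x]scale1r lT scale1r. Qed.

Lemma linear_sub (R : realType) (V W : lmodType R) (T : V -> W) : linear T ->
  forall x y, T (x - y) = T x - T y.
Proof. by move=> lT x y; rewrite addrC -scaleN1r lT scaleN1r addrC. Qed.

Section convolution.
Variables (R : realType) (d : nat).
Local Notation C := (Rcomplex R).
Local Notation K := 'rV[int]_d.
Implicit Types (u v : K -> C) (a m : K -> R).

(** The Fourier coefficients of the product of a function of [x] and a function
of [(x, t)]. *)
Definition fconv u (f : K -> R -> C) (k : K) (t : R) : C := csum (fun l => u (k - l) * f l t).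

Lemma asum_conv u (f : K -> R -> C) a m k t :
  (forall l, normc (u l) <= a l) -> (forall l, normc (f l t) <= m l) ->
  (nsum (fun l => a (k - l) * m l)%R < +oo)%E -> asum (fun l => u (k - l) * f l t).
Proof.
by move=> ua fm; apply: asum_le => l; rewrite normcM ler_pM ?normc_ge0.
Qed.

Lemma fconv_bounded u (f : K -> R -> C) a m k :
  (forall l, normc (u l) <= a l) -> (forall l, half_line_bounded (f l) (m l)) ->
  (nsum (fun l => a (k - l) * m l)%R < +oo)%E ->
  half_line_bounded (fconv u f k) (rconv a m k).
Proof.
move=> ua fm fin.
have b l t : normc (u (k - l) * f l t) <= a (k - l) * m l.
  by rewrite normcM ler_pM ?normc_ge0//; have [_ _] := fm l; exact.
have ab0 l : 0 <= a (k - l) * m l by apply: le_trans (b l 0); exact: normc_ge0.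
split.
- move=> t; apply: (@csum_dominated _ _ _ _ _ _ _ (fun l => a (k - l) * m l)) => //.
  + by near=> s => l; exact: b.
  + by move=> l; apply: cvg_mulc; have [cf _ _] := fm l; exact: cf.
- by move=> t; congr csum; apply/funext => l; have [_ hf _] := fm l; rewrite hf.
- move=> t; apply: (@csum_norm_le _ _ _ (fun l => a (k - l) * m l)) => //.
  by rewrite /rconv fineK// ge0_fin_numE// nsum_ge0.
Unshelve. all: by end_near. Qed.

Definition grad u (j : 'I_d) : K -> C := fun k => isym R k j * u k.

Definition jweight u (k : K) : R := japanese R k * normc (u k).

Lemma jweight_ge0 u k : 0 <= jweight u k.
Proof. by apply: mulr_ge0; [exact: ltW (japanese_gt0 R k)|exact: normc_ge0]. Qed.

Lemma normc_grad u j k : normc (grad u j k) <= jweight u k.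
Proof.
by rewrite normcM ler_wpM2r ?normc_ge0// (le_trans (normc_isym_le _ _ _))// norm2_le_japanese.
Qed.

End convolution.

Section operator.
Variables (R : realType) (d : nat) (d0 : (0 < d)%N) (sigma s r0 : R).
Hypothesis sigma_ge0 : 0 <= sigma.
Hypothesis r0_large : d.+1%:R <= 2 * r0.
Hypothesis r0s : r0 <= s - 1.
Local Notation C := (Rcomplex R).
Local Notation K := 'rV[int]_d.
Local Notation X := (sobolev d sigma s).
Local Notation W := (wspace d sigma (s - 1)).
Implicit Types (u v : X) (w : W).

Definition snorm (rho : R) u : R := fine (hnorm sigma rho u).

Lemma snorm_ge0 rho u : 0 <= snorm rho u.
Proof. by rewrite fine_ge0// hnorm_ge0. Qed.

Lemma snormE u : snorm s u = `|u|.
Proof. by rewrite /snorm -sobolev_normE. Qed.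

Lemma hnorm_fin_le rho u : rho <= s -> hnorm sigma rho u \is a fin_num.
Proof.
move=> rs; rewrite ge0_fin_numE ?hnorm_ge0//.
have : (hnorm sigma s u <= `|u|%:E)%E by rewrite sobolev_normE.
move=> /(hnorm_leP _ _ _ (normr_ge0 u)).1 h.
apply: le_lt_trans (ltry `|u|); apply/hnorm_leP => //.
by apply: (hbound_wmono rs) h => k; exact: normc_ge0.
Qed.

Lemma snorm_hnorm rho u : rho <= s -> (snorm rho u)%:E = hnorm sigma rho u.
Proof. by move=> rs; rewrite fineK// hnorm_fin_le. Qed.

Lemma snormD (rho : R) u v : rho <= s -> snorm rho (u + v) <= snorm rho u + snorm rho v.
Proof.
move=> rs; have := @Defs.hnormD R d sigma rho u v.
have <- : hcoef (u + v) = (u : K -> C) + (v : K -> C) by apply/funext => k.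
by rewrite -!(snorm_hnorm _ rs) -EFinD lee_fin.
Qed.

Lemma snorm_hbound rho u : rho <= s -> hbound sigma rho (fun k => normc (u k)) (snorm rho u).
Proof. by move=> rs; apply/hnorm_leP; rewrite ?snorm_ge0// snorm_hnorm. Qed.

Lemma snorm_jweight rho u : rho <= s - 1 -> hbound sigma rho (jweight u) (snorm (rho + 1) u).
Proof. by move=> rs; apply/hbound_japanese; apply: snorm_hbound; rewrite -lerBrDr. Qed.

Lemma snorm_mono rho rho' u : rho <= rho' -> rho' <= s -> snorm rho u <= snorm rho' u.
Proof.
move=> rr rs; rewrite -lee_fin snorm_hnorm ?(le_trans rr)//.
apply/hnorm_leP; first exact: snorm_ge0.
by apply: (hbound_wmono rr); [move=> k; exact: normc_ge0|exact: snorm_hbound].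
Qed.

Let r0_ge0 : 0 <= r0.
Proof. by have : 0 <= d.+1%:R :> R by []; have := r0_large; lra. Qed.

(** With [b] the vertical and [V] the horizontal velocity in coordinates that
follow the surface [u], these are the products [grad u . V] and [d_j u b]. They
are linear in the surface and contain no derivative of the velocities. *)
Definition source_flux u w (k : K) : R -> C :=
  fun t => \sum_(j < d) fconv (grad u j) (fun l => w l (Some (Some j))) k t.

Definition source_slope u w (k : K) (j : 'I_d) : R -> C :=
  fconv (grad u j) (fun l => w l (Some None)) k.

Local Notation gamma u w := (rconv (jweight u) (fun l => msize (w l))).

Let wsize0 w l : 0 <= msize (w l). Proof. exact: wsize_ge0. Qed.

(** The sources are products with one derivative of the surface; the tame
convolution estimate applies with the regularity of the surface raised by one.
*)
Lemma tame_gamma rho u w : r0 <= rho -> rho <= s - 1 ->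
  (forall k, (nsum (fun l => jweight u (k - l) * msize (w l))%R < +oo)%E) /\
  hbound sigma rho (gamma u w) (2 `^ rho * lattice_const R d *
    (snorm (r0 + 1) u * wnorm rho w + snorm (rho + 1) u * wnorm r0 w)).
Proof.
move=> hr rs; have r'0 : 0 <= rho by exact: le_trans hr.
by apply: (tame_conv d0 sigma_ge0 r0_large r'0 (snorm_ge0 _ _) (snorm_ge0 _ _)
  (wnorm_ge0 _ _) (wnorm_ge0 _ _) (jweight_ge0 u) (wsize0 w));
  [apply: snorm_jweight|apply: snorm_jweight|apply: wnorm_bound|apply: wnorm_bound].
Qed.

Let mixed_ge0 rho u w : 0 <= snorm (r0 + 1) u * wnorm rho w + snorm (rho + 1) u * wnorm r0 w.
Proof.
by apply: addr_ge0; apply: mulr_ge0; [exact: snorm_ge0|exact: wnorm_ge0|exact: snorm_ge0|exact: wnorm_ge0].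
Qed.

Let tame_const_ge0 rho : 0 <= 2 `^ rho * lattice_const R d.
Proof. by apply: mulr_ge0; [exact: powR_ge0|exact: lattice_const_ge0]. Qed.

Let fin_gamma u w k : (nsum (fun l => jweight u (k - l) * msize (w l))%R < +oo)%E.
Proof. by have [h _] := tame_gamma u w r0s (lexx _). Qed.

Lemma gamma_ge0 u w k : 0 <= gamma u w k.
Proof. by apply: rconv_ge0 => l; [exact: jweight_ge0|exact: wsize_ge0]. Qed.

Lemma source_slope_bounded u w k j : half_line_bounded (source_slope u w k j) (gamma u w k).
Proof.
by apply: fconv_bounded => // l; [exact: normc_grad|exact: wspace_bounded].
Qed.

Lemma source_flux_bounded u w k : half_line_bounded (source_flux u w k) (d%:R * gamma u w k).
Proof.
have := @half_line_bounded_sum R _ (index_enum 'I_d) (fun j => fconv (grad u j) (fun l => w l (Some (Some j))) k) (fun=> gamma u w k).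
rewrite sumr_const card_ord mulr_natl; apply => j.
by apply: fconv_bounded => // l; [exact: normc_grad|exact: wspace_bounded].
Qed.

Definition op_family u w (k : K) : comp d -> R -> C :=
  mode_solve k (source_flux u w k) (source_slope u w k).

Lemma op_family_bounded u w k : mode_bounded (op_family u w k) ((9 * d%:R + 1) * gamma u w k).
Proof.
apply: mode_solve_bounded; [exact: gamma_ge0|exact: source_flux_bounded|].
by move=> j; exact: source_slope_bounded.
Qed.

Let c9 : 0 <= 9 * d%:R + 1 :> R. Proof. by rewrite addr_ge0// mulr_ge0. Qed.

Lemma op_subproof u w : op_family u w \in wspace_pred sigma (s - 1).
Proof.
have [_ h] := tame_gamma u w r0s (lexx _); apply/asboolP; split.
  by move=> k; exists ((9 * d%:R + 1) * gamma u w k); exact: op_family_bounded.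
exists ((9 * d%:R + 1) * (2 `^ (s - 1) * lattice_const R d *
    (snorm (r0 + 1) u * wnorm (s - 1) w + snorm (s - 1 + 1) u * wnorm r0 w))); split.
  by apply: mulr_ge0 => //; apply: mulr_ge0; [exact: tame_const_ge0|exact: mixed_ge0].
apply: hbound_le (hboundZ c9 (gamma_ge0 u w) h) => k.
  by apply: msize_ge0; exact: op_family_bounded.
by apply: msize_le => i t; have [_ _] := op_family_bounded u w k i; exact.
Qed.

(** The velocities of the potential solve [w = flat psi + op eta w]; the
operator is bilinear, of order zero in [w], and small when the surface is. *)
Definition op u w : W := WSpace (op_subproof u w).

Definition op_const : R := (9 * d%:R + 1) * (2 `^ s * lattice_const R d).

Lemma op_const_ge0 : 0 <= op_const.
Proof. by apply: mulr_ge0 => //; exact: tame_const_ge0. Qed.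

Lemma op_tame rho u w : r0 <= rho -> rho <= s - 1 ->
  wnorm rho (op u w) <= op_const * (snorm (r0 + 1) u * wnorm rho w + snorm (rho + 1) u * wnorm r0 w).
Proof.
move=> hr rs; have [_ h] := tame_gamma u w hr rs.
have S0 : 0 <= snorm (r0 + 1) u * wnorm rho w + snorm (rho + 1) u * wnorm r0 w.
  exact: mixed_ge0.
apply: (@le_trans _ _ ((9 * d%:R + 1) * (2 `^ rho * lattice_const R d *
    (snorm (r0 + 1) u * wnorm rho w + snorm (rho + 1) u * wnorm r0 w)))).
  apply: wnorm_le_majorant (hboundZ c9 (gamma_ge0 u w) h).
    by apply: mulr_ge0 => //; apply: mulr_ge0; [exact: tame_const_ge0|exact: mixed_ge0].
  by move=> k i t; have [_ _] := op_family_bounded u w k i; exact.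
rewrite /op_const -!mulrA ler_wpM2l// !mulrA ler_wpM2r// ler_wpM2r ?lattice_const_ge0//.
rewrite ler_powR ?ler1n//; lra.
Qed.

Let fconv_linr u j (c : C) w w' i k t :
  fconv (grad u j) (fun l t => c * w l i t + w' l i t) k t =
  c * fconv (grad u j) (fun l => w l i) k t + fconv (grad u j) (fun l => w' l i) k t.
Proof.
have a1 : asum (fun l => grad u j (k - l) * w l i t).
  apply: (@asum_conv R d _ (fun l => w l i) (jweight u) (fun l => msize (w l))) => [l|l|]; [exact: normc_grad|exact: wsize_ge|exact: fin_gamma].
have a2 : asum (fun l => grad u j (k - l) * w' l i t).
  apply: (@asum_conv R d _ (fun l => w' l i) (jweight u) (fun l => msize (w' l))) => [l|l|]; [exact: normc_grad|exact: wsize_ge|exact: fin_gamma].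
rewrite /fconv -csumMl// -csumD//; last exact: asumMl.
by congr csum; apply/funext => l; rewrite mulrDr mulrCA.
Qed.

Lemma op_linear_right u (c : C) w w' : op u (cscalew c w + w') = cscalew c (op u w) + op u w'.
Proof.
apply: wspace_eqP => k i t; rewrite wspaceDE cscalewE.
rewrite -(mode_solve_linear k c (gamma_ge0 u w k) (gamma_ge0 u w' k) (source_flux_bounded u w k)
  (source_slope_bounded u w k) (source_flux_bounded u w' k) (source_slope_bounded u w' k)).
congr (mode_solve k _ _ i t); apply/funext => x.
  rewrite /source_flux mulr_sumr -big_split/=; apply: eq_bigr => j _.
  by rewrite -fconv_linr.
by apply/funext => z; rewrite /source_slope -fconv_linr.
Qed.

Let fconv_linl u v j (a : R) w i k t :
  fconv (grad (a *: u + v) j) (fun l => w l i) k t =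
  (a%:C)%C * fconv (grad u j) (fun l => w l i) k t + fconv (grad v j) (fun l => w l i) k t.
Proof.
have a1 : asum (fun l => grad u j (k - l) * w l i t).
  apply: (@asum_conv R d _ (fun l => w l i) (jweight u) (fun l => msize (w l))) => [l|l|]; [exact: normc_grad|exact: wsize_ge|exact: fin_gamma].
have a2 : asum (fun l => grad v j (k - l) * w l i t).
  apply: (@asum_conv R d _ (fun l => w l i) (jweight v) (fun l => msize (w l))) => [l|l|]; [exact: normc_grad|exact: wsize_ge|exact: fin_gamma].
rewrite /fconv -csumMl// -csumD//; last exact: asumMl.
congr csum; apply/funext => l; rewrite /grad.
have -> : (a *: u + v) (k - l) = (a%:C)%C * u (k - l) + v (k - l).
  by rewrite -scalerc.
by ring.
Qed.

Lemma op_linear_left (a : R) u v w : op (a *: u + v) w = a *: op u w + op v w.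
Proof.
rewrite scalew_cscale; apply: wspace_eqP => k i t; rewrite wspaceDE cscalewE.
rewrite -(mode_solve_linear k (a%:C)%C (gamma_ge0 u w k) (gamma_ge0 v w k) (source_flux_bounded u w k)
  (source_slope_bounded u w k) (source_flux_bounded v w k) (source_slope_bounded v w k)).
congr (mode_solve k _ _ i t); apply/funext => x.
  rewrite /source_flux mulr_sumr -big_split/=; apply: eq_bigr => j _.
  by rewrite -fconv_linl.
by apply/funext => z; rewrite /source_slope -fconv_linl.
Qed.

Lemma op_linear u : linear (op u).
Proof. by move=> a w w'; rewrite scalew_cscale op_linear_right -scalew_cscale. Qed.

(** The harmonic extension to a half-space, with velocities of size [|k| e^(-
|k| t)] and multiplied by the weight [e^(t/2)]. *)
Definition flat_family (u : K -> C) (k : K) : comp d -> R -> C := fun i t =>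
  match i with
  | Some (Some j) => decay (norm2 R k - 2^-1) t *: (isym R k j * u k)
  | _ => decay (norm2 R k - 2^-1) t *: (norm2 R k *: u k)
  end.

Lemma flat_family_bounded (u : K -> C) k : mode_bounded (flat_family u k) (jweight u k).
Proof.
have [k0|kn] := eqVneq k 0.
  have z i : flat_family u k i = fun=> 0.
    apply/funext => t; rewrite /flat_family k0 norm2_0 scale0r scaler0.
    case: i => [[j|]|] //; have -> : isym R (0 : K) j = 0; last by rewrite mul0r scaler0.
    by rewrite /isym mxE.
  move=> i; rewrite z; apply: half_line_bounded_le (half_line_bounded0 R); exact: jweight_ge0.
have p1 := norm2_ge1 R kn; have q0 : 0 <= norm2 R k - 2^-1 by lra.
case=> [[j|]|] /=; apply: half_line_bounded_le (half_line_bounded_decay _ q0).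
- exact: normc_grad.
- by rewrite normcZ ger0_norm ?norm2_ge0// ler_wpM2r ?normc_ge0// norm2_le_japanese.
- by rewrite normcZ ger0_norm ?norm2_ge0// ler_wpM2r ?normc_ge0// norm2_le_japanese.
Qed.

Lemma flat_subproof u : flat_family u \in wspace_pred sigma (s - 1).
Proof.
apply/asboolP; split; first by move=> k; exists (jweight u k); exact: flat_family_bounded.
exists (snorm (s - 1 + 1) u); split; first exact: snorm_ge0.
apply: hbound_le (snorm_jweight u (lexx _)) => k.
  by apply: msize_ge0; exact: flat_family_bounded.
by apply: msize_le => i t; have [_ _] := flat_family_bounded u k i; exact.
Qed.

Definition flat u : W := WSpace (flat_subproof u).

Lemma wnorm_flat rho u : rho <= s - 1 -> wnorm rho (flat u) <= snorm (rho + 1) u.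
Proof.
move=> rs; apply: wnorm_le_majorant (snorm_jweight u rs); first exact: snorm_ge0.
by move=> k i t; have [_ _] := flat_family_bounded u k i; exact.
Qed.

Lemma flat_linear (c : C) u v : flat (Defs.cscale c u + v) = cscalew c (flat u) + flat v.
Proof.
apply: wspace_eqP => k i t; rewrite wspaceDE cscalewE.
have E : (Defs.cscale c u + v) k = c * u k + v k by [].
have F z : flat z k i t = flat_family z k i t by [].
by rewrite !F /flat_family E; case: i {F} => [[j|]|]; rewrite !scalerc; ring.
Qed.

Lemma boundary_flux_subproof w : (fun k => w k None 0) \in sobolev_pred sigma (s - 1).
Proof.
apply/sobolev_predP; apply: le_lt_trans (ltry (wnorm (s - 1) w)).
apply/hnorm_leP; first exact: wnorm_ge0.
apply: hbound_le (wnorm_bound w (lexx _)) => k; first exact: normc_ge0.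
exact: wsize_ge.
Qed.

Definition boundary_flux w : sobolev d sigma (s - 1) := Sobolev (boundary_flux_subproof w).

Lemma boundary_flux_le w : `|boundary_flux w| <= wnorm (s - 1) w.
Proof.
rewrite -lee_fin sobolev_normE; apply/hnorm_leP; first exact: wnorm_ge0.
apply: hbound_le (wnorm_bound w (lexx _)) => k; first exact: normc_ge0.
exact: wsize_ge.
Qed.

Lemma boundary_flux_linear (c : C) w w' :
  boundary_flux (cscalew c w + w') = Defs.cscale c (boundary_flux w) + boundary_flux w'.
Proof. by apply: val_inj; apply/funext => k. Qed.

Local Notation Y := (sobolev d sigma (s - 1)).
Local Notation N := (wnorm (s - 1)).
Local Notation L := (wnorm r0).

(** Smallness of the surface makes [op_const] times its low norm at most [1/4];
the tame estimate has two such terms, so the operator contracts the low norm by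
[1/2]. *)
Definition dn_radius : R := (4 * op_const + 1)^-1.

Lemma dn_radius_gt0 : 0 < dn_radius.
Proof. by rewrite invr_gt0; have := op_const_ge0; lra. Qed.

Definition small u : Prop := snorm (r0 + 1) u < dn_radius.

Let small_le u : small u -> op_const * snorm (r0 + 1) u <= 4^-1.
Proof.
move=> hu; have c0 := op_const_ge0; have D0 : 0 < 4 * op_const + 1 by lra.
apply: (@le_trans _ _ (op_const * dn_radius)); first by rewrite ler_wpM2l// ltW.
by rewrite /dn_radius ler_pdivrMr// mulrDr; lra.
Qed.

Let LN w : L w <= N w. Proof. exact: wnorm_mono. Qed.

Lemma op_low u w : small u -> L (op u w) <= 2^-1 * L w.
Proof.
move=> /small_le h; apply: le_trans (op_tame u w (lexx r0) r0s) _.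
have := ler_wpM2r (wnorm_ge0 r0 w) h; rewrite -mulrA; lra.
Qed.

Lemma op_high u w : small u -> N (op u w) <= 2^-1 * N w + (op_const * `|u|) * L w.
Proof.
move=> /small_le h; apply: le_trans (op_tame u w r0s (lexx _)) _.
rewrite subrK snormE mulrDr [op_const * (`|u| * _)]mulrA lerD2r mulrA.
by apply: le_trans (ler_wpM2r (wnorm_ge0 _ w) h) _; have := wnorm_ge0 (s - 1) w; lra.
Qed.

Lemma op_bound u w : N (op u w) <= (2 * op_const * `|u|) * N w.
Proof.
apply: le_trans (op_tame u w r0s (lexx _)) _; rewrite subrK snormE.
have h1 : snorm (r0 + 1) u * N w <= `|u| * N w.
  rewrite ler_wpM2r ?wnorm_ge0// -snormE snorm_mono//; have := r0s; lra.
have h2 : `|u| * L w <= `|u| * N w by rewrite ler_wpM2l.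
have := ler_wpM2l op_const_ge0 (lerD h1 h2); lra.
Qed.

Lemma solution_operator u : small u -> exists S : W -> W,
  [/\ forall w, S w = w + op u (S w),
      forall w y, y = w + op u y -> y = S w &
      forall w, N (S w) <= 4 * (N w + 4 * (op_const * `|u|) * L w)].
Proof.
move=> hu; have lam0 : 0 <= op_const * `|u| by apply: mulr_ge0 => //; exact: op_const_ge0.
have ND (x y : W) : N (x + y) <= N x + N y by exact: (wnormD x y (lexx _)).
have NZ (a : R) (x : W) : N (a *: x) <= `|a| * N x by exact: (wnormZ a x (lexx _)).
have C := @wspace_complete R d sigma (s - 1).
exists (resolvent (@wnorm_ge0 _ _ _ _ _) ND NZ (@wnorm_eq0 _ _ _ _) (@wnorm_ge0 _ _ _ _ _) LN C
  (op_linear u) lam0 (fun w => op_low w hu) (fun w => op_high w hu)); split.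
- by move=> w; exact: resolventP.
- by move=> w y; exact: resolvent_unique.
- by move=> w; exact: resolvent_le.
Qed.

Definition bounded_op (T : W -> W) (M : R) : Prop :=
  [/\ forall c w w', T (cscalew c w + w') = cscalew c (T w) + T w', 0 <= M &
      forall w, N (T w) <= M * N w].

Lemma bounded_op_linear T M : bounded_op T M -> linear T.
Proof. by move=> [h _ _] a w w'; rewrite scalew_cscale h -scalew_cscale. Qed.

Definition solve u : W -> W :=
  if pselect (small u) is left h then projT1 (cid (solution_operator h)) else fun=> 0.

Lemma solveP u w : small u -> solve u w = w + op u (solve u w).
Proof.
by move=> hu; rewrite /solve; case: pselect => // h; case: cid => S [].
Qed.

Lemma solve_unique u w y : small u -> y = w + op u y -> y = solve u w.
Proof.
by move=> hu; rewrite /solve; case: pselect => // h; case: cid => S /= [_ + _]; apply.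
Qed.

(** Linear in the high norm of the surface: this is the tame estimate of the
Dirichlet-Neumann operator before the boundary values are taken. *)
Lemma solve_le u w : small u -> N (solve u w) <= 4 * (N w + 4 * (op_const * `|u|) * L w).
Proof.
by move=> hu; rewrite /solve; case: pselect => // h; case: cid => S /= [_ _ +]; apply.
Qed.

Definition solve_const u : R := 4 * (1 + 4 * (op_const * `|u|)).

Lemma solve_const_ge0 u : 0 <= solve_const u.
Proof.
have : 0 <= op_const * `|u| by apply: mulr_ge0 => //; exact: op_const_ge0.
by rewrite /solve_const; lra.
Qed.

Lemma solve_bounded u : small u -> bounded_op (solve u) (solve_const u).
Proof.
move=> hu; split; last 2 first.
- exact: solve_const_ge0.
- move=> w; apply: le_trans (solve_le w hu) _.
  have lam0 : 0 <= op_const * `|u| by apply: mulr_ge0 => //; exact: op_const_ge0.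
  have := ler_wpM2l lam0 (LN w); rewrite /solve_const; lra.
move=> c w w'; apply/esym/(solve_unique hu).
have cD (x y : W) : cscalew c (x + y) = cscalew c x + cscalew c y.
  by apply: wspace_eqP => k i t; rewrite wspaceDE !cscalewE wspaceDE mulrDr.
rewrite op_linear_right {1}(solveP w hu) {1}(solveP w' hu) cD.
exact: addrACA.
Qed.

Lemma solve_bounded_ex u : exists M, bounded_op (solve u) M.
Proof.
have [hu|hu] := pselect (small u); first by exists (solve_const u); exact: solve_bounded.
exists 0; have z w : solve u w = 0 by rewrite /solve; case: pselect.
split => //.
  move=> c w w'; rewrite !z addr0; apply: wspace_eqP => k i t.
  by rewrite cscalewE wspace0E mulr0.
by move=> w; rewrite z mul0r -(scale0r (0 : W)) (le_trans (wnormZ _ _ (lexx _)))// normr0 mul0r.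
Qed.

Lemma bounded_op_comp S T A B : bounded_op S A -> bounded_op T B ->
  bounded_op (S \o T) (A * B).
Proof.
move=> [lS A0 SA] [lT B0 TB]; split; first by move=> c w w' /=; rewrite lT lS.
  exact: mulr_ge0.
by move=> w /=; apply: le_trans (SA _) _; rewrite -mulrA ler_wpM2l.
Qed.

Lemma op_bounded_op u : bounded_op (op u) (2 * op_const * `|u|).
Proof.
split; [exact: op_linear_right| |exact: op_bound].
apply: mulr_ge0 => //; apply: mulr_ge0 => //; exact: op_const_ge0.
Qed.

Let flux_op_subproof T M : bounded_op T M ->
  (fun psi : X => boundary_flux (T (flat psi))) \in @bop_pred R d sigma s sigma (s - 1).
Proof.
move=> [lT M0 TM]; apply/asboolP; split.
  by move=> c u v; rewrite flat_linear lT boundary_flux_linear.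
exists M => u; apply: le_trans (boundary_flux_le _) _; apply: le_trans (TM _) _.
rewrite ler_wpM2l//; apply: le_trans (wnorm_flat u (lexx _)) _.
by rewrite subrK snormE.
Qed.

Definition flux_op T M (h : bounded_op T M) : bop d sigma s sigma (s - 1) :=
  Bop (flux_op_subproof h).

Lemma flux_opE T M (h : bounded_op T M) psi : flux_op h psi = boundary_flux (T (flat psi)).
Proof. by []. Qed.

Lemma flux_op_le T M (h : bounded_op T M) : `|flux_op h| <= M.
Proof.
apply: opnorm_le => psi p1; rewrite flux_opE; have [_ M0 TM] := h.
apply: le_trans (boundary_flux_le _) _; apply: le_trans (TM _) _.
rewrite -[leRHS]mulr1 ler_wpM2l//; apply: le_trans (wnorm_flat psi (lexx _)) _.
by rewrite subrK snormE.
Qed.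

Lemma bop_eqP (S T : bop d sigma s sigma (s - 1)) : (forall psi, S psi = T psi) -> S = T.
Proof. by move=> h; apply: val_inj; apply/funext => psi; exact: h. Qed.

Definition dno (eta : rsobolev d sigma s) : bop d sigma s sigma (s - 1) :=
  flux_op (projT2 (cid (solve_bounded_ex eta))).

Lemma dnoE eta psi : dno eta psi = boundary_flux (solve eta (flat psi)).
Proof. by []. Qed.

Lemma dno_tame (eta : rsobolev d sigma s) psi : small eta ->
  (hnorm sigma (s - 1)%R (dno eta psi) <=
     (4 + 16 * op_const)%:E * (hnorm sigma s psi +
       hnorm sigma s eta * hnorm sigma (r0 + 1)%R psi))%E.
Proof.
move=> hu; have rs : r0 + 1 <= s by have := r0s; lra.
rewrite -(sobolev_normE psi) -(sobolev_normE (rval eta)) -(sobolev_normE (dno eta psi)).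
rewrite -(snorm_hnorm psi rs).
suff h : `|dno eta psi| <= (4 + 16 * op_const) * (`|psi| + `|rval eta| * snorm (r0 + 1) psi).
  by rewrite -lee_fin EFinM EFinD EFinM in h.
rewrite dnoE.
apply: le_trans (boundary_flux_le _) _; apply: le_trans (solve_le _ hu) _.
have h1 : N (flat psi) <= `|psi|.
  by apply: le_trans (wnorm_flat psi (lexx _)) _; rewrite subrK snormE.
have h2 := wnorm_flat psi r0s.
have lam0 : 0 <= op_const * `|rval eta| by apply: mulr_ge0 => //; exact: op_const_ge0.
have h3 := ler_wpM2l lam0 h2.
have c0 := op_const_ge0.
have h4 : 0 <= op_const * `|psi| by exact: mulr_ge0.
have h5 : 0 <= `|rval eta| * snorm (r0 + 1) psi by apply: mulr_ge0 => //; exact: snorm_ge0.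
lra.
Qed.

Section analyticity.
Variable eta0 : rsobolev d sigma s.
Hypothesis small0 : small eta0.
Local Notation B := (rsobolev d sigma s).

Let C0 := solve_const eta0.
Let kappa := C0 * (2 * op_const).

Let C0_ge0 : 0 <= C0. Proof. exact: solve_const_ge0. Qed.

Let kappa_ge0 : 0 <= kappa.
Proof. by apply: mulr_ge0 => //; apply: mulr_ge0 => //; exact: op_const_ge0. Qed.

(** The expansion of a resolvent: the operator is linear in the surface, so the
inverse at [eta0 + h] is the sum of the products [S op(h) S ... op(h) S] with
[S] the inverse at [eta0]. *)
Fixpoint taylor n : ('I_n -> B) -> W -> W :=
  match n with
  | 0%N => fun _ w => solve eta0 w
  | m.+1 => fun h w => solve eta0 (op (h ord_max) (taylor (fun i => h (widen_ord (leqnSn m) i)) w))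
  end.

Lemma taylor_bounded n (h : 'I_n -> B) :
  bounded_op (taylor h) (C0 * kappa ^+ n * \prod_(i < n) `|h i|).
Proof.
elim: n h => [|n ih] h.
  by rewrite big_ord0 expr0 !mulr1; exact: solve_bounded.
have := bounded_op_comp (solve_bounded small0)
  (bounded_op_comp (op_bounded_op (h ord_max)) (ih (fun i => h (widen_ord (leqnSn n) i)))).
rewrite (_ : C0 * kappa ^+ n.+1 * \prod_(i < n.+1) `|h i| = solve_const eta0 * (2 * op_const * `|rval (h ord_max)| *
   (C0 * kappa ^+ n * \prod_(i < n) `|h (widen_ord (leqnSn n) i)|)))//.
rewrite big_ord_recr/= exprS -/C0 [in LHS]/kappa -/(rval (h ord_max)).
set P := \prod_(i < n) _; have -> : `|h ord_max| = `|rval (h ord_max)| by [].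
by rewrite /kappa; ring.
Qed.

Definition taylor_coef n (h : 'I_n -> B) : bop d sigma s sigma (s - 1) :=
  flux_op (taylor_bounded h).

Let upd n (x : 'I_n -> B) (i : 'I_n) (h : B) := fun j => if j == i then h else x j.

Let solve_linear : linear (solve eta0). Proof. exact: bounded_op_linear (solve_bounded small0). Qed.

Lemma taylor_multilinear n (i : 'I_n) (x : 'I_n -> B) (a : R) (h h' : B) w :
  taylor (upd x i (a *: h + h')) w = a *: taylor (upd x i h) w + taylor (upd x i h') w.
Proof.
elim: n i x => [[]//|n ih] i x /=.
have [->|im] := eqVneq i ord_max.
  have E g : (fun j => upd x ord_max g (widen_ord (leqnSn n) j)) = (fun j => x (widen_ord (leqnSn n) j)).
    apply/funext => j; rewrite /upd; case: eqP => // /(congr1 val)/= jn.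
    by have := ltn_ord j; rewrite jn ltnn.
  rewrite !E /upd eqxx.
  have -> : rval (a *: h + h') = a *: rval h + rval h' by [].
  by rewrite op_linear_left solve_linear.
have ilt : (i < n)%N by rewrite ltn_neqAle -ltnS ltn_ord andbT; apply: contraNneq im => e; apply/eqP/val_inj.
pose i' := Ordinal ilt.
have E g : (fun j => upd x i g (widen_ord (leqnSn n) j)) = upd (fun j => x (widen_ord (leqnSn n) j)) i' g.
  by apply/funext => j; rewrite /upd -!val_eqE.
have M g : upd x i g ord_max = x ord_max by rewrite /upd eq_sym (negbTE im).
by rewrite !E !M ih op_linear solve_linear.
Qed.

Let flux_linear (a : R) w w' : boundary_flux (a *: w + w') = a *: boundary_flux w + boundary_flux w'.
Proof. by rewrite scalew_cscale boundary_flux_linear -scale_cscale. Qed.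

Lemma taylor_coef_multilinear n : multilinear (@taylor_coef n).
Proof.
move=> i x a h h'; apply: bop_eqP => psi.
have E g : taylor_coef (fun j => if j == i then g else x j) psi = boundary_flux (taylor (upd x i g) (flat psi)) by [].
transitivity (a *: taylor_coef (fun j => if j == i then h else x j) psi + taylor_coef (fun j => if j == i then h' else x j) psi).
  by rewrite !E taylor_multilinear flux_linear.
by [].
Qed.

Lemma taylor_coef_le n (x : 'I_n -> B) : `|taylor_coef x| <= C0 * kappa ^+ n * \prod_(i < n) `|x i|.
Proof. exact: flux_op_le. Qed.

Let solveB w w' : solve eta0 (w - w') = solve eta0 w - solve eta0 w'.
Proof. exact: linear_sub solve_linear w w'. Qed.

Let opB u w w' : op u (w - w') = op u w - op u w'.
Proof. exact: linear_sub (op_linear u) w w'. Qed.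

Let solution_increment (h : B) w : small (eta0 + h) ->
  solve (eta0 + h) w - solve eta0 w = solve eta0 (op h (solve (eta0 + h) w)).
Proof.
move=> sh; set z := solve (eta0 + h) w.
have zE : z = (w + op h z) + op eta0 z.
  rewrite {1}/z (solveP w sh) -/z -addrA; congr (_ + _).
  have -> : rval (eta0 + h) = 1 *: rval eta0 + rval h by rewrite scale1r.
  by rewrite op_linear_left scale1r addrC.
rewrite {1}(solve_unique small0 zE) (linear_add solve_linear w (op h z)).
by rewrite (addrC (solve eta0 w)) addrK.
Qed.

Let remainder_op (h : B) n : W -> W := iter n (fun w => solve eta0 (op h w)) \o solve (eta0 + h).

Let remainder_bounded (h : B) n : small (eta0 + h) ->
  bounded_op (remainder_op h n) ((kappa * `|h|) ^+ n * solve_const (eta0 + h)).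
Proof.
move=> sh; elim: n => [|n ih]; first by rewrite expr0 mul1r; exact: solve_bounded.
have := bounded_op_comp (solve_bounded small0) (bounded_op_comp (op_bounded_op h) ih).
rewrite (_ : (kappa * `|h|) ^+ n.+1 * _ = solve_const eta0 * (2 * op_const * `|rval h| *
   ((kappa * `|h|) ^+ n * solve_const (eta0 + h))))//.
have -> : `|h| = `|rval h| by [].
by rewrite exprS {1}/kappa -/C0; ring.
Qed.

Let remainder_step (h : B) n w : small (eta0 + h) ->
  remainder_op h n w - @taylor n (fun=> h) w = remainder_op h n.+1 w.
Proof.
move=> sh; elim: n => [|n ih]; first exact: solution_increment.
have -> : remainder_op h n.+1 w = solve eta0 (op h (remainder_op h n w)) by [].
have -> : remainder_op h n.+2 w = solve eta0 (op h (remainder_op h n.+1 w)) by [].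
by rewrite -ih opB solveB.
Qed.

Let fluxB w w' : boundary_flux (w - w') = boundary_flux w - boundary_flux w'.
Proof. exact: linear_sub flux_linear w w'. Qed.

Let taylor_series (h : B) := series (fun n => @taylor_coef n (fun=> h)).

Let remainderE (h : B) n psi : small (eta0 + h) ->
  (dno (eta0 + h) - taylor_series h n) psi = boundary_flux (remainder_op h n (flat psi)).
Proof.
move=> sh; elim: n => [|n ih].
  by rewrite /taylor_series /series /= big_geq// subr0.
have -> : taylor_series h n.+1 = taylor_series h n + @taylor_coef n (fun=> h).
  by rewrite /taylor_series /series /= big_nat_recr.
rewrite opprD addrA -remainder_step// fluxB -ih.
by [].
Qed.

(** The remainder after [n] terms contains [n] factors [h], so the series
converges geometrically for small [h]. *)
Lemma dno_analytic : analytic_at dno eta0.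
Proof.
have rs : r0 + 1 <= s by have := r0s; lra.
pose gap := dn_radius - snorm (r0 + 1) eta0.
have gap0 : 0 < gap by rewrite subr_gt0.
have k1 : 0 < 2 * (kappa + 1) by rewrite mulr_gt0// ltr_wpDl.
(* The increment must keep the surface small and make the ratio of the series
at most one half. *)
pose rad := Num.min gap (2 * (kappa + 1))^-1.
have rad0 : 0 < rad by rewrite lt_min gap0 invr_gt0.
have kr : kappa * rad <= 2^-1.
  apply: (@le_trans _ _ (kappa * (2 * (kappa + 1))^-1)).
    by rewrite ler_wpM2l// ge_min lexx orbT.
  by rewrite ler_pdivrMr// mulrA mulVf// mul1r lerDl.
have kr0 : 0 <= kappa * rad by rewrite mulr_ge0// ltW.
exists (@taylor_coef), (fun n => C0 * kappa ^+ n), rad; split => //.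
- exact: taylor_coef_multilinear.
- exact: taylor_coef_le.
- have -> : (fun n => C0 * kappa ^+ n * rad ^+ n) = geometric C0 (kappa * rad).
    by apply/funext => n; rewrite -mulrA -exprMn.
  by apply: is_cvg_geometric_series; rewrite ger0_norm//; lra.
move=> h hr; have sh : small (eta0 + h).
  apply: le_lt_trans (snormD eta0 h rs) _.
  have : snorm (r0 + 1) h <= `|h|.
    by have := snorm_mono h rs (lexx _); rewrite snormE.
  have : `|h| < gap by apply: lt_le_trans hr _; rewrite ge_min lexx.
  by rewrite /gap; lra.
have q1 : kappa * `|h| <= 2^-1.
  by apply: le_trans kr; rewrite ler_wpM2l// ltW.
have q0 : 0 <= kappa * `|h| by rewrite mulr_ge0.
apply/cvgrPdist_lt => e e0; have Ch := solve_const_ge0 (eta0 + h).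
have [n0 hn0] := @geometric_small R (solve_const (eta0 + h)) 2^-1 e Ch (ltac:(lra)) (ltac:(lra)) e0.
exists n0 => // n /= n0n; apply: le_lt_trans hn0.
apply: (@le_trans _ _ ((kappa * `|h|) ^+ n * solve_const (eta0 + h))).
  have := flux_op_le (remainder_bounded n sh).
  have -> // : flux_op (remainder_bounded n sh) = dno (eta0 + h) - taylor_series h n.
  by apply: bop_eqP => psi; rewrite remainderE.
rewrite mulrC ler_wpM2l//.
apply: (@le_trans _ _ (2^-1 ^+ n)); first by rewrite lerXn2r ?nnegrE.
by rewrite ler_wiXn2l//; lra.
Qed.

End analyticity.

End operator.

(** * Fourier series in coordinates that follow the surface *)

Section complex_calculus.
Variables (R : realType) (V : normedModType R).
Local Notation C := (Rcomplex R).

Lemma derive_ReIm (f : V -> C) p v (df : C) :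
  is_derive p v (fun x => complex.Re (f x)) (complex.Re df) ->
  is_derive p v (fun x => complex.Im (f x)) (complex.Im df) -> is_derive p v f df.
Proof.
move=> hr hi; have := is_derive_complex hr hi.
have -> : (fun x => Complex (complex.Re (f x)) (complex.Im (f x)) : C) = f.
  by apply/funext => x; rewrite -complexE.
by rewrite -complexE.
Qed.

(** Multiplication of complex values is reduced to four real products. *)
Lemma dMc (f g : V -> C) p v df dg : is_derive p v f df -> is_derive p v g dg ->
  is_derive p v (fun x => f x * g x) (f p * dg + df * g p).
Proof.
move=> hf hg; have rf := is_derive_Re hf; have mf := is_derive_Im hf.
have rg := is_derive_Re hg; have mg := is_derive_Im hg.
have ReM (x y : C) : complex.Re (x * y) = complex.Re x * complex.Re y - complex.Im x * complex.Im y.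
  by case: x y => a b [c d].
have ImM (x y : C) : complex.Im (x * y) = complex.Re x * complex.Im y + complex.Im x * complex.Re y.
  by case: x y => a b [c d].
apply: derive_ReIm.
  under eq_fun do rewrite ReM.
  apply: derive_eq (dB (dM rf rg) (dM mf mg)) _.
  by case: (f p) (g p) df dg {hf hg rf mf rg mg} => a b [c e] [a' b'] [c' e'] /=; ring.
under eq_fun do rewrite ImM.
apply: derive_eq (dD (dM rf mg) (dM mf rg)) _.
by case: (f p) (g p) df dg {hf hg rf mf rg mg} => a b [c e] [a' b'] [c' e'] /=; ring.
Qed.

Lemma dZc (f : V -> R) (g : V -> C) p v df dg : is_derive p v f df -> is_derive p v g dg ->
  is_derive p v (fun x => f x *: g x) (f p *: dg + df *: g p).
Proof.
move=> hf hg; have rg := is_derive_Re hg; have mg := is_derive_Im hg.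
have ReZ (a : R) (y : C) : complex.Re (a *: y) = a * complex.Re y by case: y.
have ImZ (a : R) (y : C) : complex.Im (a *: y) = a * complex.Im y by case: y.
apply: derive_ReIm.
  under eq_fun do rewrite ReZ.
  apply: derive_eq (dM hf rg) _.
  by case: (g p) dg {hg rg mg} => c e [c' e'].
under eq_fun do rewrite ImZ.
apply: derive_eq (dM hf mg) _.
by case: (g p) dg {hg rg mg} => c e [c' e'].
Qed.

Lemma dsum (W : normedModType R) (I : Type) (s : seq I) (f : I -> V -> W) (df : I -> W) p v :
  (forall i, is_derive p v (f i) (df i)) ->
  is_derive p v (fun x => \sum_(i <- s) f i x) (\sum_(i <- s) df i).
Proof.
move=> h; elim: s => [|i s ih].
  by under eq_fun do rewrite big_nil; rewrite big_nil; exact: dcst.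
by under eq_fun do rewrite big_cons; rewrite big_cons; exact: dD.
Qed.

End complex_calculus.

Section characters.
Variable R : realType.
Local Notation C := (Rcomplex R).

Lemma dcomp_line (f : R -> C) (th : R -> R) (t : R) df dth :
  is_derive (th t) (1 : R) f df -> is_derive t (1 : R) th dth ->
  is_derive t (1 : R) (fun x => f (th x)) (dth *: df).
Proof.
move=> hf ht; apply: derive_ReIm.
  apply: derive_eq (is_derive1_comp (is_derive_Re hf) ht) _.
  by case: df hf => a b _ /=; rewrite mulrC.
apply: derive_eq (is_derive1_comp (is_derive_Im hf) ht) _.
by case: df hf => a b _ /=; rewrite mulrC.
Qed.

Variable d : nat.
Local Notation K := 'rV[int]_d.

Definition kdot (k : K) (v : 'rV[R]_d) : R := \sum_(j < d) (k ord0 j)%:~R * v ord0 j.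

Lemma kdotD k v w : kdot k (v + w) = kdot k v + kdot k w.
Proof. by rewrite -big_split/=; apply: eq_bigr => j _; rewrite mxE mulrDr. Qed.

Lemma kdotZ k a v : kdot k (a *: v) = a * kdot k v.
Proof. by rewrite mulr_sumr; apply: eq_bigr => j _; rewrite mxE mulrCA. Qed.

Lemma kdotDl k l v : kdot (k + l) v = kdot k v + kdot l v.
Proof. by rewrite -big_split/=; apply: eq_bigr => j _; rewrite mxE intrD mulrDl. Qed.

Lemma kdotNl k v : kdot (- k) v = - kdot k v.
Proof. by rewrite -sumrN; apply: eq_bigr => j _; rewrite mxE mulrNz mulNr. Qed.

Lemma kdot_evec k j : kdot k (evec R j) = (k ord0 j)%:~R.
Proof.
rewrite /kdot (bigD1 j)//= big1 ?addr0 => [|i ij]; first by rewrite mxE !eqxx mulr1.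
by rewrite mxE (negbTE ij) andbF mulr0.
Qed.

Lemma expiE k (x : 'rV[R]_d) : expi k x = Complex (cos (kdot k x)) (sin (kdot k x)).
Proof. by []. Qed.

Lemma normc_expi k (x : 'rV[R]_d) : normc (expi k x) = 1.
Proof. by rewrite expiE /= cos2Dsin2 sqrtr1. Qed.

Lemma expiD k l (x : 'rV[R]_d) : expi (k + l) x = expi k x * expi l x.
Proof.
rewrite !expiE kdotDl cosD sinD; apply/eqP; rewrite eq_complex /=.
by rewrite eqxx addrC eqxx.
Qed.

Lemma expiN k (x : 'rV[R]_d) : expi (- k) x = ((expi k x)^*)%C.
Proof. by rewrite !expiE kdotNl cosN sinN. Qed.

Lemma expi_periodic k (x : 'rV[R]_d) j : expi k (x + (2 * pi) *: evec R j) = expi k x.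
Proof.
rewrite !expiE kdotD kdotZ kdot_evec.
have two_pi : pi *+ 2 = 2 * pi :> R by rewrite mulr_natl.
have Pn (m : nat) (u : R) : cos (u + 2 * (pi : R) * m%:R) = cos u /\ sin (u + 2 * (pi : R) * m%:R) = sin u.
  elim: m u => [|m ih] u; first by rewrite mulr0 addr0.
  have -> : m.+1%:R = m%:R + 1 :> R by rewrite natr1.
  rewrite mulrDr mulr1 addrA -two_pi cosD2pi sinD2pi two_pi; exact: ih.
have P (t : R) (n : int) : cos (t + 2 * (pi : R) * n%:~R) = cos t /\ sin (t + 2 * (pi : R) * n%:~R) = sin t.
  case: n => n; first by rewrite -pmulrn; exact: Pn.
  rewrite NegzE mulrNz mulrN -pmulrn.
  have [h1 h2] := Pn n.+1 (t - 2 * pi * n.+1%:R).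
  by move: h1 h2; rewrite subrK => -> ->.
by have [-> ->] := P (kdot k x) (k ord0 j).
Qed.

Definition dsymbol (k : K) (v : 'rV[R]_d) : C := Complex 0 (kdot k v).

Lemma dsymbolE k v : dsymbol k v = \sum_(j < d) v ord0 j *: isym R k j.
Proof.
rewrite /dsymbol /kdot.
have : forall s : seq 'I_d, Complex 0 (\sum_(j <- s) (k ord0 j)%:~R * v ord0 j) = \sum_(j <- s) v ord0 j *: isym R k j.
  elim=> [|j s ih]; first by rewrite !big_nil.
  rewrite !big_cons -ih; apply/eqP; rewrite eq_complex /= mulr0 addr0 eqxx /=.
  by rewrite mulrC.
exact.
Qed.

Lemma is_derive_expi_line k (x v : 'rV[R]_d) (t : R) :
  is_derive t (1 : R) (fun t : R => expi k (t *: v + x)) (dsymbol k v * expi k (t *: v + x)).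
Proof.
have hk : is_derive t (1 : R) (fun t : R => kdot k (t *: v + x)) (kdot k v).
  under eq_fun do rewrite kdotD kdotZ mulrC.
  apply: derive_eq (dD (dMl (kdot k v) (is_derive_id t 1)) (dcst _ _ _)) _.
  by rewrite addr0 mulr1.
rewrite [in X in is_derive _ _ X _](_ : (fun t : R => expi k (t *: v + x)) =
  (fun t : R => Complex (cos (kdot k (t *: v + x))) (sin (kdot k (t *: v + x)))))//.
apply: derive_eq (is_derive_complex (is_derive1_comp (is_derive_cos _) hk) (is_derive1_comp (is_derive_sin _) hk)) _.
rewrite /dsymbol expiE; apply/eqP; rewrite eq_complex; apply/andP; split; apply/eqP => /=; ring.
Qed.

End characters.

Section series.
Variables (R : realType) (d : nat).
Local Notation C := (Rcomplex R).
Local Notation K := 'rV[int]_d.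
Local Notation point := ('rV[R]_d * R)%type.
Implicit Types (h : 'rV[R]_d -> R) (f : K -> R -> C) (u : K -> C) (m : K -> R).

(** The function with Fourier coefficients [f k t] at depth [t] below the
surface [h]. *)
Definition series_at h f (p : point) : C := csum (fun k => f k (h p.1 - p.2) * expi k p.1).

Definition dfam f (l : 'I_d) : K -> R -> C := fun k t => isym R k l * f k t.

Definition bounded_family f m := (forall k, half_line_bounded (f k) (m k)) /\ (nsum m < +oo)%E.

Lemma normcM_expi (z : C) k (x : 'rV[R]_d) : normc (z * expi k x) = normc z.
Proof. by rewrite normcM normc_expi mulr1. Qed.

Lemma bounded_family_asum f m t (x : 'rV[R]_d) : bounded_family f m -> asum (fun k => f k t * expi k x).
Proof. by move=> [hf mf]; apply: asum_le mf => k; rewrite normcM_expi; have [_ _] := hf k; exact. Qed.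

Lemma bounded_familyD f g m m' : (forall k, 0 <= m k) -> (forall k, 0 <= m' k) -> bounded_family f m -> bounded_family g m' ->
  bounded_family (fun k t => f k t + g k t) (fun k => m k + m' k).
Proof.
move=> m0 m0' [hf mf] [hg mg]; split; first by move=> k; exact: half_line_boundedD.
exact: nsum_ltyD.
Qed.

Lemma bounded_familyN f m : bounded_family f m -> bounded_family (fun k t => - f k t) m.
Proof. by move=> [hf mf]; split => // k; exact: half_line_boundedN. Qed.

Lemma series_atD h f g m m' p : bounded_family f m -> bounded_family g m' ->
  series_at h (fun k t => f k t + g k t) p = series_at h f p + series_at h g p.
Proof.
move=> hf hg; rewrite /series_at -csumD; [|exact: bounded_family_asum hf|exact: bounded_family_asum hg].
by congr csum; apply/funext => k; rewrite mulrDl.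
Qed.

Lemma series_atN h f m p : bounded_family f m ->
  series_at h (fun k t => - f k t) p = - series_at h f p.
Proof.
move=> hf; rewrite /series_at -csumN; last exact: bounded_family_asum hf.
by congr csum; apply/funext => k; rewrite mulNr.
Qed.

Lemma csum0 (I : choiceType) : csum (fun _ : I => 0 : C) = 0.
Proof.
have e := @csumMl R I 0 (fun=> 0) (asum0 R I); rewrite mul0r in e.
by rewrite e mul0r.
Qed.

Lemma csum_sum (I : choiceType) (J : Type) (s : seq J) (u : J -> I -> C) :
  (forall j, asum (u j)) -> asum (fun i => \sum_(j <- s) u j i) /\
  csum (fun i => \sum_(j <- s) u j i) = \sum_(j <- s) csum (u j).
Proof.
move=> au; elim: s => [|j s [ih1 ih2]].
  under eq_fun do rewrite big_nil; rewrite big_nil csum0; split => //; exact: asum0.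
under eq_fun do rewrite big_cons; rewrite big_cons -ih2; split; first exact: asumD.
exact: csumD.
Qed.

Lemma series_at_sum (J : Type) (s : seq J) h (f : J -> K -> R -> C) (m : J -> K -> R) p :
  (forall j, bounded_family (f j) (m j)) ->
  series_at h (fun k t => \sum_(j <- s) f j k t) p = \sum_(j <- s) series_at h (f j) p.
Proof.
move=> hf; rewrite /series_at -(csum_sum s (fun j => bounded_family_asum _ _ (hf j))).2.
by congr csum; apply/funext => k; rewrite mulr_suml.
Qed.

Lemma cvg_mul (T : Type) (F : set_system T) (FF : Filter F) (f g : T -> C) (a b : C) :
  f x @[x --> F] --> a -> g x @[x --> F] --> b -> f x * g x @[x --> F] --> a * b.
Proof.
move=> hf hg; have rf := cvg_Re FF hf; have mf := cvg_Im FF hf.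
have rg := cvg_Re FF hg; have mg := cvg_Im FF hg.
have -> : a * b = Complex (complex.Re a * complex.Re b - complex.Im a * complex.Im b)
  (complex.Re a * complex.Im b + complex.Im a * complex.Re b).
  by case: (a) (b) => ? ? [? ?].
have -> : (fun x => f x * g x) = fun x => Complex (complex.Re (f x) * complex.Re (g x) - complex.Im (f x) * complex.Im (g x))
  (complex.Re (f x) * complex.Im (g x) + complex.Im (f x) * complex.Re (g x)) : C.
  by apply/funext => x; case: (f x) (g x) => ? ? [? ?].
apply: cvg_complex; [apply: cvgB|apply: cvgD]; exact: cvgM.
Qed.

Lemma cvg_sumr (W : normedModType R) (T I : Type) (F : set_system T) (FF : Filter F) (s : seq I)
    (f : I -> T -> W) (a : I -> W) : (forall i, f i x @[x --> F] --> a i) ->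
  \sum_(i <- s) f i x @[x --> F] --> \sum_(i <- s) a i.
Proof.
move=> h; elim: s => [|i s ih].
  by under eq_fun do rewrite big_nil; rewrite big_nil; exact: cvg_cst.
by under eq_fun do rewrite big_cons; rewrite big_cons; exact: cvgD.
Qed.

Lemma kdot_continuous k : continuous (kdot k : 'rV[R]_d -> R).
Proof.
move=> x; rewrite /kdot; apply: (@cvg_sumr R _ _ (nbhs x) (nbhs_filter x)) => j; apply: cvgM; first exact: cvg_cst.
exact: coord_continuous.
Qed.

Lemma expi_continuous k : continuous (expi k : 'rV[R]_d -> C).
Proof.
move=> x; have -> : (expi k : 'rV[R]_d -> C) = fun x => Complex (cos (kdot k x)) (sin (kdot k x)) : C by [].
apply: (@cvg_complex _ _ _ (nbhs_filter x)).
  by apply: (@continuous_comp _ _ _ (kdot k) cos); [exact: kdot_continuous|exact: continuous_cos].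
by apply: (@continuous_comp _ _ _ (kdot k) sin); [exact: kdot_continuous|exact: continuous_sin].
Qed.

Lemma series_at_continuous h f m : continuous h -> bounded_family f m -> continuous (series_at h f).
Proof.
move=> ch [hf mf] p; apply: (@csum_dominated _ _ _ _ _ _ _ m) => //.
- by near=> q => k; rewrite normcM_expi; have [_ _] := hf k; exact.
- by move=> k; rewrite normcM_expi; have [_ _] := hf k; exact.
move=> k; apply: cvg_mul; last first.
  by apply: (@continuous_comp _ _ _ (fun q : point => q.1) (expi k)); [exact: cvg_fst|exact: expi_continuous].
apply: (@continuous_comp _ _ _ (fun q : point => h q.1 - q.2) (f k)); last by have [cf _ _] := hf k; exact: cf.
apply: cvgB; last exact: cvg_snd.
by apply: (@continuous_comp _ _ _ (fun q : point => q.1) h); [exact: cvg_fst|exact: ch].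
Unshelve. all: by end_near. Qed.

End series.

Section series_derivative.
Variables (R : realType) (d : nat).
Local Notation C := (Rcomplex R).
Local Notation K := 'rV[int]_d.
Local Notation point := ('rV[R]_d * R)%type.
Implicit Types (h : 'rV[R]_d -> R) (f : K -> R -> C) (u : K -> C) (m : K -> R).

Lemma normc_sum (I : Type) (s : seq I) (F : I -> C) : normc (\sum_(i <- s) F i) <= \sum_(i <- s) normc (F i).
Proof.
elim: s => [|i s ih]; first by rewrite !big_nil normc0.
by rewrite !big_cons; apply: le_trans (le_normcD _ _) _; rewrite lerD2l.
Qed.

Definition vsize (v : 'rV[R]_d) : R := \sum_(j < d) `|v ord0 j|.

Lemma vsize_ge0 v : 0 <= vsize v.
Proof. by apply: sumr_ge0 => j _. Qed.

Lemma normc_dsymbol (k : K) v : normc (dsymbol k v) <= japanese R k * vsize v.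
Proof.
rewrite dsymbolE; apply: le_trans (normc_sum _ _) _; rewrite /vsize mulr_sumr.
apply: ler_sum => j _; rewrite normcZ mulrC ler_wpM2r//.
exact: le_trans (normc_isym_le _ _ _) (norm2_le_japanese _ _).
Qed.

(** Differentiation along a line that stays below the surface: each derivative
hits either the depth or a character. The depth contributes through the slope
of the surface, the character through a factor [i k]. *)
Lemma series_at_derive h (dh : R -> R) f f' m m' (p v : point) (D r : R) : 0 < r ->
  (forall t : R, `|t| < r -> is_derive t (1 : R) (fun t : R => h (t *: v.1 + p.1)) (dh t)) ->
  (forall t : R, `|t| < r -> `|dh t| <= D) ->
  (forall t : R, `|t| < r -> t * v.2 + p.2 < h (t *: v.1 + p.1)) ->
  (forall k (t : R), 0 < t -> is_derive t (1 : R) (f k) (f' k t)) ->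
  (forall k, half_line_bounded (f k) (m k)) -> bounded_family f' m' ->
  (nsum (fun k => japanese R k * m k)%R < +oo)%E ->
  is_derive p v (series_at h f)
    ((dh 0 - v.2) *: series_at h f' p + \sum_(l < d) v.1 ord0 l *: series_at h (dfam f l) p).
Proof.
move=> r0 hdh hD hb hf fm [f'm m'oo] jm.
have m0 k : 0 <= m k by have [_ _ h0] := fm k; apply: le_trans (h0 0); exact: normc_ge0.
have m'0 k : 0 <= m' k by have [_ _ h0] := f'm k; apply: le_trans (h0 0); exact: normc_ge0.
have j1 k : m k <= japanese R k * m k by rewrite ler_peMl.
have moo : (nsum m < +oo)%E by apply: nsum_lty_le jm.
apply/is_derive_line.
pose th (t : R) : R := h (t *: v.1 + p.1) - (t * v.2 + p.2).
have dth t : `|t| < r -> is_derive t (1 : R) th (dh t - v.2).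
  move=> tr; apply: dB; first exact: hdh.
  have -> : (fun y : R => y * v.2 + p.2) = (fun y : R => v.2 * y + p.2) by apply/funext => y; rewrite mulrC.
  by apply: derive_eq (dD (dMl v.2 (is_derive_id t 1)) (dcst _ _ _)) _; rewrite addr0 mulr1.
pose u k t := f k (th t) * expi k (t *: v.1 + p.1).
pose du k t := f k (th t) * (dsymbol k v.1 * expi k (t *: v.1 + p.1)) +
  ((dh t - v.2) *: f' k (th t)) * expi k (t *: v.1 + p.1).
pose M k := vsize v.1 * (japanese R k * m k) + (D + `|v.2|) * m' k.
have D0 : 0 <= D by apply: le_trans (hD 0 _); rewrite ?normr_ge0 ?normr0.
have Moo : (nsum M < +oo)%E.
  apply: nsum_ltyD.
  - by move=> k; apply: mulr_ge0; [exact: vsize_ge0|exact: le_trans (m0 k) (j1 k)].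
  - by move=> k; apply: mulr_ge0 => //; exact: addr_ge0.
  - by apply: nsum_ltyZ => //; [exact: vsize_ge0|move=> k; exact: le_trans (m0 k) (j1 k)].
  - by apply: nsum_ltyZ => //; exact: addr_ge0.
have key : is_derive (0 : R) (1 : R) (fun t => csum (u^~ t)) (csum (du^~ 0)).
  apply: (@is_derive_csum R K u du M 0 r r0 Moo) => [k t|k t|t]; rewrite ?subr0 => tr.
  - apply: dMc; last exact: is_derive_expi_line.
    apply: dcomp_line (dth t tr); apply: hf.
    by rewrite subr_gt0 hb.
  - apply: le_trans (le_normcD _ _) _; rewrite /M; apply: lerD.
      rewrite mulrA normcM_expi normcM mulrC [vsize _ * _]mulrC mulrAC.
      apply: ler_pM; [exact: normc_ge0|exact: normc_ge0|exact: normc_dsymbol|].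
      by have [_ _] := fm k; exact.
    rewrite normcM_expi normcZ; apply: ler_pM; [exact: normr_ge0|exact: normc_ge0| |].
      by apply: le_trans (ler_normB _ _) _; rewrite lerD2r hD.
    by have [_ _] := f'm k; exact.
  apply: asum_le moo => k; rewrite normcM_expi; have [_ _] := fm k; exact.
have key2 : is_derive (0 : R) (1 : R) (fun t : R => series_at h f (t *: v + p)) (csum (du^~ 0)) by exact: key.
apply: derive_eq key2 _.
have E k : du k 0 = (dh 0 - v.2) *: (f' k (h p.1 - p.2) * expi k p.1) +
    \sum_(l < d) v.1 ord0 l *: (dfam f l k (h p.1 - p.2) * expi k p.1).
  rewrite /du /th scale0r mul0r !add0r addrC; congr (_ + _); first by rewrite !scalerc mulrA.
  rewrite dsymbolE mulr_suml mulr_sumr; apply: eq_bigr => l _; rewrite /dfam !scalerc; ring.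
have A1 : asum (fun k => f' k (h p.1 - p.2) * expi k p.1).
  by apply: (@bounded_family_asum _ _ f' m').
have A2 l : asum (fun k => dfam f l k (h p.1 - p.2) * expi k p.1).
  apply: asum_le jm => k; rewrite normcM_expi normcM; apply: ler_pM; [exact: normc_ge0|exact: normc_ge0| |].
    exact: le_trans (normc_isym_le _ _ _) (norm2_le_japanese _ _).
  by have [_ _] := fm k; exact.
have [S1 S2] := csum_sum (index_enum 'I_d) (fun l => asumZ (v.1 ord0 l) (A2 l)).
transitivity (csum (fun k => (dh 0 - v.2) *: (f' k (h p.1 - p.2) * expi k p.1) +
  \sum_(l < d) v.1 ord0 l *: (dfam f l k (h p.1 - p.2) * expi k p.1))).
  by congr csum; apply/funext => k; exact: E.
rewrite csumD//; last exact: asumZ.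
rewrite csumZ// S2; congr (_ + _); apply: eq_bigr => l _; exact: csumZ.
Qed.

Lemma fourier_continuous u : asum u -> continuous (fourier u).
Proof.
move=> au x.
apply: (@csum_dominated R K _ _ (nbhs_filter x) _ _ (fun k => normc (u k))) => //.
- by apply: nearW => y k; rewrite normcM_expi.
- by move=> k; rewrite normcM_expi.
by move=> k; apply: cvg_mulc; exact: expi_continuous.
Qed.

Lemma fourier_derive u (x v : 'rV[R]_d) : (nsum (jweight u) < +oo)%E ->
  is_derive x v (fourier u) (\sum_(l < d) v ord0 l *: fourier (grad u l) x).
Proof.
move=> ju; apply/is_derive_line.
have hb0 : bounded_family (fun (k : K) (_ : R) => 0 : C) (fun=> 0).
  split; first by move=> k; exact: half_line_bounded0.
  by rewrite /nsum esum1.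
have h := @series_at_derive (fun=> 1) (fun=> 0) (fun k _ => u k) (fun=> fun=> 0)
  (fun k => normc (u k)) (fun=> 0) (x, 0) (v, 0) 0 1 ltr01.
have {}h := h (fun _ _ => dcst _ _ _) (fun _ _ => _) _ (fun _ _ _ => dcst _ _ _) _ hb0 ju.
have hz : series_at (fun=> (1 : R)) (fun (k : K) _ => 0 : C) (x, 0) = 0.
  rewrite /series_at -[RHS](csum0 R K); congr csum; apply/funext => k; exact: mul0r.
move: h; rewrite /= hz scaler0 add0r => h.
have {}h : is_derive ((x, 0) : point) ((v, 0) : point) (series_at (fun=> 1) (fun k _ => u k)) (\sum_(l < d) v ord0 l *: fourier (grad u l) x).
  apply: h => [|t _|k].
  - by rewrite normr0.
  - by rewrite mulr0 addr0.
  - by split=> // t; exact: cvg_cst.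
move/is_derive_line in h.
by have -> : (fun t : R => fourier u (t *: v + x)) = (fun t : R => series_at (fun=> 1) (fun k _ => u k) (t *: ((v, 0) : point) + (x, 0))).
Qed.

(** Conjugation of the sum amounts to the change of index [k] to [- k]. *)
Lemma fourier_real u x : asum u -> (forall k, u (- k) = ((u k)^*)%C) -> complex.Im (fourier u x) = 0.
Proof.
move=> au hu.
have a : asum (fun k => u k * expi k x) by apply: asum_le au => k; rewrite normcM_expi.
have e : fourier u x = ((fourier u x)^*)%C.
  have cD : {morph (fun z : C => (z^*)%C : C) : a b / a + b} by move=> [? ?] [? ?]; apply/eqP; rewrite eq_complex /= opprD !eqxx.
  have cn (z : C) : normc ((z^*)%C) <= 1 * normc z by case: z => a1 b1; rewrite mul1r /= sqrrN.
  rewrite -[RHS](@csum_additive R K (fun z : C => (z^*)%C) 1 _ cD ler01 cn)//.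
    rewrite -(@csum_reindex R K K -%R -%R); [|exact: opprK|exact: opprK|].
      congr csum; apply/funext => k /=; rewrite expiN hu.
      by case: (u k) (expi k x) => ? ? [? ?]; apply/eqP; rewrite eq_complex /=; apply/andP; split; apply/eqP; ring.
    by apply: asum_additive a => //; exact: cn.
move: e; case: (fourier u x) => a1 b1 /eqP; rewrite eq_complex /= eqxx /= => /eqP; lra.
Qed.

Lemma nsum_conv_lty (a m : K -> R) : (forall k, 0 <= a k) -> (forall k, 0 <= m k) ->
  (nsum a < +oo)%E -> (nsum m < +oo)%E ->
  (\esum_(k in setT) nsum (fun l => a (k - l) * m l)%R < +oo)%E.
Proof.
move=> a0 m0 ao mo; rewrite /nsum esum_exchange; last by move=> *; rewrite lee_fin mulr_ge0.
apply: (@le_lt_trans _ _ (nsum (fun l => fine (nsum a) * m l))%R); last first.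
  by apply: nsum_ltyZ => //; rewrite fine_ge0// nsum_ge0.
apply: le_esum => l _.
rewrite (_ : \esum_(i in setT) (a (i - l) * m l)%:E = nsum (fun i => m l * a (i - l))%R); last first.
  by rewrite /nsum; congr esum; apply/funext => i; rewrite mulrC.
rewrite nsumZ// (@nsum_reindex R K K (fun i => i - l) (fun i => i + l) a); last 2 first.
- by move=> i; rewrite subrK.
- by move=> i; rewrite addrK.
have fin : nsum a \is a fin_num by rewrite ge0_fin_numE// nsum_ge0.
by rewrite EFinM (fineK fin) muleC.
Qed.

(** Coefficients of a product: exchange the sums and split the character [e^(i
k x)] as [e^(i (k - l) x) e^(i l x)]. *)
Lemma series_at_conv h u f m p : asum u -> bounded_family f m ->
  series_at h (fconv u f) p = fourier u p.1 * series_at h f p.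
Proof.
move=> au [fm mo]; set t := h p.1 - p.2; set x := p.1.
have m0 k : 0 <= m k by have [_ _ h0] := fm k; apply: le_trans (h0 0); exact: normc_ge0.
have ft k : normc (f k t) <= m k by have [_ _] := fm k; exact.
pose a (k l : K) : C := u (k - l) * f l t * expi k x.
have fin : (\esum_(k in setT) nsum (fun l => normc (a k l)) < +oo)%E.
  apply: le_lt_trans (nsum_conv_lty (fun k => normc_ge0 (u k)) m0 au mo).
  apply: le_esum => k _; apply: le_nsum => l; rewrite normcM_expi normcM.
  by rewrite ler_wpM2l ?normc_ge0.
have ar k : asum (fun l => u (k - l) * f l t).
  by apply: le_lt_trans (asum_row fin k); apply: le_nsum => l; rewrite normcM_expi.
have -> : series_at h (fconv u f) p = csum (fun k => csum (a k)).
  rewrite /series_at -/t -/x; congr csum; apply/funext => k.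
  rewrite /fconv mulrC -csumMl//; congr csum; apply/funext => l; exact: mulrC.
rewrite csum_exchange//.
have aux l : asum (fun k => u (k - l) * expi (k - l) x).
  have : asum (u \o (fun k => k - l)).
    rewrite /asum (_ : (fun i => _) = (fun k => normc (u k)) \o (fun i : K => i - l))//.
    rewrite (@nsum_reindex R K K (fun i => i - l) (fun i => i + l))// => i; rewrite ?subrK ?addrK//.
  by apply: asum_le => k; rewrite normcM_expi.
have E l : csum (a^~ l) = fourier u x * (f l t * expi l x).
  rewrite (_ : a^~ l = fun k => (f l t * expi l x) * (u (k - l) * expi (k - l) x)); last first.
    apply/funext => k; rewrite /a; have -> : expi k x = expi (k - l) x * expi l x by rewrite -expiD subrK.
    ring.
  rewrite csumMl// mulrC; congr (_ * _).
  apply: (@csum_reindex R K K (fun k => k - l) (fun k => k + l) (fun k => u k * expi k x)).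
  - by move=> k; rewrite subrK.
  - by move=> k; rewrite addrK.
  by apply: asum_le au => k; rewrite normcM_expi.
rewrite -csumMl; last by apply: (@bounded_family_asum _ _ f m).
by congr csum; apply/funext => l; exact: E.
Qed.

End series_derivative.

(** * Harmonicity from a first-order system *)

(** Pointwise identities between complex combinations with real coefficients
are polynomial identities between real and imaginary parts. *)
Ltac by_parts := apply/eqP; rewrite eq_complex; apply/andP; split; apply/eqP => /=; ring.

Section smooth.
Variables (R : realType) (V W : normedModType R).

Lemma derive_on_open (D : set V) (f g : V -> W) p v df : open D -> D p ->
  (forall q, D q -> f q = g q) -> is_derive p v g df -> is_derive p v f df.
Proof.
move=> oD Dp fg; apply: near_eq_is_derive.
by apply: filterS (open_nbhs_nbhs (conj oD Dp)) => q Dq; rewrite fg.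
Qed.

Lemma dinv (f : V -> R) p v df : f p != 0 -> is_derive p v f df ->
  is_derive p v (fun x => (f x)^-1) (- ((f p)^-1 * (f p)^-1 * df)).
Proof.
move=> n0 /is_derive_line h; apply/is_derive_line.
have n0' : f (0 *: v + p) != 0 by rewrite scale0r add0r.
have := @is_deriveV R (fun t => f (t *: v + p)) 0 df 1 n0' h.
by rewrite scale0r add0r scaleNr -exprVn expr2.
Qed.

End smooth.

Section smooth_on.
Variables (R : realType) (d : nat).
Local Notation C := (Rcomplex R).
Local Notation point := ('rV[R]_d * R)%type.
Variable D : set point.
Hypothesis oD : open D.
Implicit Types (f g : point -> C).

(** A continuous formula for the directional derivatives on an open set
establishes continuous differentiability there. *)
Lemma C1_on_is_derive f (df : point -> point -> C) :
  (forall v p, D p -> is_derive p v f (df v p)) ->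
  (forall v, continuous (df v)) -> C1_on D f.
Proof.
move=> h cdf v p Dp; have [hd he] := h v p Dp; split => //.
have E q : D q -> 'D_v f q = df v q by move=> Dq; have [_ ->] := h v q Dq.
rewrite /prop_for /continuous_at E//; apply: cvg_trans (cdf v p).
apply: near_eq_cvg; apply: filterS (open_nbhs_nbhs (conj oD Dp)) => q Dq.
by rewrite E.
Qed.

Lemma C1_on_congr f g : (forall q, D q -> f q = g q) -> C1_on D g -> C1_on D f.
Proof.
move=> fg h v p Dp.
have hv q : D q -> is_derive q v f ('D_v g q).
  move=> Dq; apply: (derive_on_open oD Dq fg); have [hd _] := h v q Dq.
  exact: derivableP.
have E q : D q -> 'D_v f q = 'D_v g q by move=> Dq; have [_ ->] := hv q Dq.
have [hd _] := hv p Dp; split => //; have [_ hc] := h v p Dp.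
rewrite /prop_for /continuous_at E//; apply: cvg_trans hc.
apply: near_eq_cvg; apply: filterS (open_nbhs_nbhs (conj oD Dp)) => q Dq.
by rewrite E.
Qed.

End smooth_on.

Section harmonic.
Variables (R : realType) (d : nat).
Local Notation C := (Rcomplex R).
Local Notation point := ('rV[R]_d * R)%type.

Lemma sum_evec (F : 'I_d -> C) j : \sum_(l < d) evec R j ord0 l *: F l = F j.
Proof.
rewrite (bigD1 j)//= big1 ?addr0 => [|i ij]; first by rewrite mxE !eqxx scale1r.
by rewrite mxE (negbTE ij) andbF scale0r.
Qed.

Lemma sum_evecR (F : 'I_d -> R) j : \sum_(l < d) evec R j ord0 l * F l = F j.
Proof.
rewrite (bigD1 j)//= big1 ?addr0 => [|i ij]; first by rewrite mxE !eqxx mul1r.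
by rewrite mxE (negbTE ij) andbF mul0r.
Qed.

Variables (h : 'rV[R]_d -> R) (hj : 'I_d -> 'rV[R]_d -> R) (hjl : 'I_d -> 'I_d -> 'rV[R]_d -> R).
Variables (Phi N B T : point -> C) (V Psi M Q : 'I_d -> point -> C) (P : 'I_d -> 'I_d -> point -> C).
Hypothesis ch : continuous h.
Hypothesis chj : forall j, continuous (hj j).
Hypothesis chjl : forall l j, continuous (hjl l j).
Hypothesis cT : continuous T.
Hypothesis cB : continuous B.
Hypothesis cV : forall j, continuous (V j).
Hypothesis cQ : forall j, continuous (Q j).
Hypothesis cP : forall l j, continuous (P l j).

(** The directional derivative of the depth [h x - y]. *)
Definition slope (v p : point) : R := \sum_(l < d) v.1 ord0 l * hj l p.1 - v.2.

Local Notation D := (below h).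
Hypothesis dPhi : forall v p, D p -> is_derive p v Phi (- (slope v p *: B p) + \sum_(l < d) v.1 ord0 l *: Psi l p).
Hypothesis dflux : forall v p, D p -> is_derive p v N (slope v p *: T p + \sum_(l < d) v.1 ord0 l *: M l p).
Hypothesis dPsi : forall j v p, D p -> is_derive p v (Psi j) (- (slope v p *: Q j p) + \sum_(l < d) v.1 ord0 l *: P l j p).
Hypothesis dhj : forall j x v, is_derive x v (hj j) (\sum_(l < d) v ord0 l * hjl l j x).
Hypothesis fluxE : forall p, B p = N p + \sum_(j < d) hj j p.1 *: V j p.
Hypothesis PsiE : forall j p, Psi j p = V j p + hj j p.1 *: B p.
Hypothesis TE : forall p, T p = \sum_(j < d) (P j j p - hjl j j p.1 *: B p - hj j p.1 *: Q j p).
Hypothesis QE : forall j p, Q j p = M j p + \sum_(l < d) (hjl j l p.1 *: V l p +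
  hj l p.1 *: (P j l p - hjl j l p.1 *: B p - hj l p.1 *: Q j p)).

Lemma below_open : open D.
Proof.
have -> : D = [set p : point | 0 < h p.1 - p.2].
  by apply/seteqP; split => p /=; rewrite /below /= subr_gt0.
apply: (@open_comp _ _ (fun p : point => h p.1 - p.2) [set y | 0 < y]); last exact: open_gt.
move=> p _; apply: cvgB; last exact: cvg_snd.
by apply: (@continuous_comp _ _ _ (fun q : point => q.1) h); [exact: cvg_fst|exact: ch].
Qed.

Let q (x : 'rV[R]_d) : R := 1 + \sum_(j < d) hj j x * hj j x.
Let q_gt0 x : 0 < q x.
Proof. by rewrite ltr_pwDl// sumr_ge0// => j _; rewrite -expr2 sqr_ge0. Qed.

Let q_neq0 x : q x != 0. Proof. by rewrite gt_eqF. Qed.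

Let qB p : q p.1 *: B p = N p + \sum_(j < d) hj j p.1 *: Psi j p.
Proof.
under eq_bigr do rewrite PsiE scalerDr scalerA.
rewrite big_split/= addrA -fluxE -scaler_suml -{2}[B p]scale1r -scalerDl.
by [].
Qed.

Let E p : C := (q p.1)^-1 *: (T p - \sum_(j < d) hj j p.1 *: Q j p).

Let qE p : q p.1 *: E p = T p - \sum_(j < d) hj j p.1 *: Q j p.
Proof. by rewrite /E scalerA (mulfV (q_neq0 _)) scale1r. Qed.

Definition vertical_grad (v p : point) : C := slope v p *: E p + \sum_(l < d) v.1 ord0 l *: Q l p.

Let dhj_point j v p : is_derive p v (fun p : point => hj j p.1) (\sum_(l < d) v.1 ord0 l * hjl l j p.1).
Proof. by apply/is_derive_line; have /is_derive_line := dhj j p.1 v.1. Qed.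

Let qQ l p : q p.1 *: Q l p = M l p + \sum_(j < d) (hj j p.1 *: P l j p + hjl l j p.1 *: (Psi j p - (2 * hj j p.1) *: B p)).
Proof.
rewrite /q scalerDl scale1r {1}QE scaler_suml -addrA -big_split/=; congr (_ + _).
apply: eq_bigr => j _; rewrite PsiE.
by move: (Q l p) (V j p) (B p) (P l j p) => [? ?] [? ?] [? ?] [? ?]; by_parts.
Qed.

(** [B] is the quotient of [N + grad h . Psi] by [1 + |grad h|^2], hence
differentiable, although its modes were not constructed as differentiable
functions of the depth. The gradient of this quotient has the shape of the
gradient of a Fourier series below the surface, with [E] in the role of the
derivative in depth. *)
Lemma derive_vertical v p : D p -> is_derive p v B (vertical_grad v p).
Proof.
move=> Dp; pose dq : R := \sum_(j < d) (hj j p.1 * (\sum_(l < d) v.1 ord0 l * hjl l j p.1) + (\sum_(l < d) v.1 ord0 l * hjl l j p.1) * hj j p.1).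
have hq : is_derive p v (fun p : point => q p.1) dq.
  have h0 := dD (dcst p v (1 : R)) (dsum (index_enum 'I_d) (fun j => dM (dhj_point j v p) (dhj_point j v p))).
  by rewrite add0r in h0.
have hqi : is_derive p v (fun p : point => (q p.1)^-1) (- ((q p.1)^-1 * (q p.1)^-1 * dq)).
  by apply: dinv.
have hX := dD (dflux v Dp) (dsum (index_enum 'I_d) (fun j => dZc (dhj_point j v p) (dPsi j v Dp))).
have EB : B = fun p => (q p.1)^-1 *: (N p + \sum_(j < d) hj j p.1 *: Psi j p).
  by apply/funext => p'; rewrite -qB scalerA mulVf// scale1r.
rewrite EB; apply: derive_eq (dZc hqi hX) _.
rewrite -qB scalerA mulNr; set qi := (q p.1)^-1.
rewrite -[qi * qi * dq * q p.1]mulrA [dq * _]mulrC mulrA -(mulrA qi qi) [qi * q p.1]mulVf// mulr1.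
rewrite scaleNr -scalerA -scalerBr.
apply: (@scalerI _ _ (q p.1)); first exact: q_neq0.
rewrite scalerA /qi (mulfV (q_neq0 _)) scale1r /vertical_grad scalerDr.
rewrite [q p.1 *: (slope v p *: _)]scalerA [q p.1 * _]mulrC -scalerA qE.
have -> : q p.1 *: (\sum_(l < d) v.1 ord0 l *: Q l p) = \sum_(l < d) v.1 ord0 l *: M l p +
    \sum_(j < d) (hj j p.1 *: (\sum_(l < d) v.1 ord0 l *: P l j p) +
      (\sum_(l < d) v.1 ord0 l * hjl l j p.1) *: (Psi j p - (2 * hj j p.1) *: B p)).
  rewrite scaler_sumr.
  under [RHS in _ + RHS]eq_bigr => j _ do rewrite scaler_sumr scaler_suml -big_split/=.
  rewrite exchange_big/= -big_split/=; apply: eq_bigr => l _.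
  rewrite scalerA mulrC -scalerA qQ scalerDr; congr (_ + _).
  rewrite scaler_sumr; apply: eq_bigr => j _.
  by rewrite scalerDr !scalerA [hj j p.1 * _]mulrC.
have HA : \sum_(j < d) (hj j p.1 *: (- (slope v p *: Q j p) + \sum_(l < d) v.1 ord0 l *: P l j p) +
      (\sum_(l < d) v.1 ord0 l * hjl l j p.1) *: Psi j p) - dq *: B p =
    - (slope v p *: \sum_(j < d) hj j p.1 *: Q j p) +
    \sum_(j < d) (hj j p.1 *: (\sum_(l < d) v.1 ord0 l *: P l j p) +
      (\sum_(l < d) v.1 ord0 l * hjl l j p.1) *: (Psi j p - (2 * hj j p.1) *: B p)).
  rewrite /dq scaler_suml scaler_sumr -!sumrN -!big_split/=; apply: eq_bigr => j _.
  set Y : C := \sum_(l < d) _ *: _; set dh : R := \sum_(l < d) _.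
  move: Y dh (Q j p) (B p) (Psi j p) (slope v p) (hj j p.1) => [? ?] ? [? ?] [? ?] [? ?] ? ?.
  by_parts.
by rewrite -addrA HA scalerBr addrACA.
Qed.

Definition horizontal_grad j (v p : point) : C := - (slope v p *: Q j p) + \sum_(l < d) v.1 ord0 l *: P l j p
  - (hj j p.1 *: vertical_grad v p + (\sum_(l < d) v.1 ord0 l * hjl l j p.1) *: B p).

Lemma derive_horizontal j v p : D p -> is_derive p v (V j) (horizontal_grad j v p).
Proof.
move=> Dp; have EV : V j = fun p => Psi j p - hj j p.1 *: B p.
  by apply/funext => p'; rewrite PsiE addrK.
rewrite EV; apply: dB (dPsi j v Dp) _.
exact: dZc (dhj_point j v p) (derive_vertical v Dp).
Qed.

Definition potential_grad (v p : point) : C := v.2 *: B p + \sum_(l < d) v.1 ord0 l *: V l p.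

Lemma derive_potential v p : D p -> is_derive p v Phi (potential_grad v p).
Proof.
move=> Dp; apply: derive_eq (dPhi v Dp) _.
under eq_bigr do rewrite PsiE scalerDr scalerA.
rewrite big_split/= -scaler_suml /slope addrCA addrC; congr (_ + _).
by rewrite scalerBl opprB subrK.
Qed.

Let continuous_sumZ (c : 'I_d -> R) (F : 'I_d -> point -> C) :
  (forall l, continuous (F l)) -> continuous (fun p => \sum_(l < d) c l *: F l p).
Proof.
move=> cF p; apply: (@cvg_sumr R _ _ _ (nbhs p) (nbhs_filter p)) => l.
apply: cvgZr; exact: cF.
Qed.

Let cont1 (f : 'rV[R]_d -> R) : continuous f -> continuous (fun p : point => f p.1).
Proof. by move=> cf p; apply: (@continuous_comp _ _ _ (fun q : point => q.1) f); [exact: cvg_fst|exact: cf]. Qed.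

Let slope_continuous v : continuous (slope v).
Proof.
move=> p; apply: cvgB; last exact: cvg_cst.
apply: (@cvg_sumr R _ _ _ (nbhs p) (nbhs_filter p)) => l.
by apply: cvgM; [exact: cvg_cst|exact: cont1].
Qed.

Let E_continuous : continuous E.
Proof.
move=> p; apply: cvgZ; last first.
  apply: cvgB; first exact: cT.
  apply: (@cvg_sumr R _ _ _ (nbhs p) (nbhs_filter p)) => l.
  by apply: cvgZ; [exact: cont1|exact: cQ].
apply: cvgV; first exact: q_neq0.
apply: cvgD; first exact: cvg_cst.
apply: (@cvg_sumr R _ _ _ (nbhs p) (nbhs_filter p)) => l.
by apply: cvgM; exact: cont1.
Qed.

Lemma vertical_grad_continuous v : continuous (vertical_grad v).
Proof.
move=> p; apply: cvgD; last exact: continuous_sumZ.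
by apply: cvgZ; [exact: slope_continuous|exact: E_continuous].
Qed.

Lemma horizontal_grad_continuous j v : continuous (horizontal_grad j v).
Proof.
move=> p; apply: cvgB.
  apply: cvgD; last exact: continuous_sumZ.
  by apply: cvgN; apply: cvgZ; [exact: slope_continuous|exact: cQ].
apply: cvgD; first by apply: cvgZ; [exact: cont1|exact: vertical_grad_continuous].
apply: cvgZ; last exact: cB.
apply: (@cvg_sumr R _ _ _ (nbhs p) (nbhs_filter p)) => l.
by apply: cvgM; [exact: cvg_cst|exact: cont1].
Qed.

Let dPhi_continuous v : continuous (fun p => potential_grad v p).
Proof.
move=> p; apply: cvgD; last exact: continuous_sumZ.
by apply: cvgZr; exact: cB.
Qed.

Lemma dxE j p : D p -> dx j Phi p = V j p.
Proof.
move=> Dp; have [_ e] := derive_potential (evec R j, 0) Dp.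
by rewrite /dx e /potential_grad /= scale0r add0r sum_evec.
Qed.

Lemma dyE p : D p -> dy Phi p = B p.
Proof.
move=> Dp; have [_ e] := derive_potential (0, 1) Dp.
rewrite /dy e /potential_grad /= scale1r big1 ?addr0// => l _; by rewrite mxE scale0r.
Qed.

(** With the derivative of [V j] in direction [j] expressed by [Psi] and [B],
all terms involving [B] cancel by the formula for the divergence [T], and the
remaining ones by the definition of [E]. *)
Lemma laplacian0 p : D p -> laplacian Phi p = 0.
Proof.
move=> Dp; rewrite /laplacian.
have e1 j : dx j (dx j Phi) p = horizontal_grad j (evec R j, 0) p.
  by have [_ e] := derive_on_open below_open Dp (@dxE j) (derive_horizontal j (evec R j, 0) Dp).
have -> : dy (dy Phi) p = vertical_grad (0, 1) p.
  by have [_ e] := derive_on_open below_open Dp dyE (derive_vertical (0, 1) Dp).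
have sj j : slope (evec R j, 0) p = hj j p.1 by rewrite /slope /= subr0 sum_evecR.
have sy : slope (0, 1) p = - 1.
  by rewrite /slope /= big1 ?sub0r// => l _; rewrite mxE mul0r.
rewrite (eq_bigr (fun j => (P j j p - hjl j j p.1 *: B p - hj j p.1 *: Q j p) - hj j p.1 *: Q j p - (hj j p.1 * hj j p.1) *: E p)); last first.
  move=> j _; rewrite e1 /horizontal_grad /vertical_grad /= !sj !sum_evec sum_evecR.
  move: (Q j p) (B p) (P j j p) (E p) => [? ?] [? ?] [? ?] [? ?]; by_parts.
rewrite sumrB [X in X - _ + _]sumrB -TE -scaler_suml /vertical_grad sy scaleN1r /= [X in _ + (_ + X)]big1 => [|l _]; last by rewrite mxE scale0r.
have -> : \sum_(i < d) hj i p.1 * hj i p.1 = q p.1 - 1 by rewrite /q addrAC subrr add0r.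
by rewrite -qE scalerBl scale1r addr0 subKr subrr.
Qed.

Lemma harmonic_below : harmonic_on D Phi.
Proof.
split; last exact: laplacian0.
have h1 : C1_on D Phi.
  exact: (@C1_on_is_derive R d D below_open Phi potential_grad derive_potential dPhi_continuous).
split=> // v.
apply: (@C1_on_congr R d D below_open ('D_v Phi) (potential_grad v)).
  by move=> p Dp; have [_] := derive_potential v Dp.
apply: (@C1_on_is_derive R d D below_open (potential_grad v) (fun w p => v.2 *: vertical_grad w p + \sum_(l < d) v.1 ord0 l *: horizontal_grad l w p)).
  move=> w p Dp; apply: dD; first exact: dZ (derive_vertical w Dp).
  by apply: dsum => l; apply: dZ; exact: derive_horizontal.
move=> w p; apply: cvgD; first by apply: cvgZr; exact: vertical_grad_continuous.
by apply: continuous_sumZ => l; exact: horizontal_grad_continuous.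
Qed.

End harmonic.

(** * The equations of a mode *)

Section mode_ode.
Variables (R : realType) (d : nat).
Local Notation C := (Rcomplex R).
Local Notation K := 'rV[int]_d.
Variables (k : K) (g : R -> C) (e : 'I_d -> R -> C) (B : R).
Hypothesis kn0 : k != 0.
Hypothesis B0 : 0 <= B.
Hypothesis hg : half_line_bounded g (d%:R * B).
Hypothesis he : forall j, half_line_bounded (e j) B.
Local Notation p := (norm2 R k).

Lemma decay_eq q (t : R) : 0 <= t -> decay q t = expR (- q * t).
Proof. by move=> t0; rewrite /decay; have -> : Num.max 0 t = t by apply/max_idPr. Qed.

Lemma is_derive_decay q (t : R) : 0 < t -> is_derive t (1 : R) (decay q) (- q * decay q t).
Proof.
move=> t0; rewrite decay_eq ?ltW//; apply: near_eq_is_derive (is_derive_expRM (- q) t).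
have := open_nbhs_nbhs (conj (@open_gt R 0) t0).
by apply: filterS => u /= u0; rewrite decay_eq// ltW.
Qed.

Lemma decay0 q : decay q (0 : R) = 1.
Proof. by rewrite decay_eq// mulr0 expR0. Qed.

Let p1 : 1 <= p. Proof. exact: norm2_ge1. Qed.

Lemma wave_out_derive (t : R) : 0 < t -> is_derive t (1 : R) (wave_out k g e)
  ((p + 2^-1) *: wave_out k g e t + (p *: g t - div_symbol k e t)).
Proof.
move=> t0; have q0 : 0 < p + 2^-1 by have := p1; lra.
have src := half_line_boundedB (half_line_boundedZ p hg) (half_line_bounded_div k B0 he).
have [[_ _ du _] _] := outgoingP q0 src; rewrite /wave_out (negbTE kn0).
by apply: derive_eq (dN (du t t0)) _; rewrite opprB scalerN addrC.
Qed.

Lemma wave_in_derive (t : R) : 0 < t -> is_derive t (1 : R) (wave_in k g e)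
  (- ((p - 2^-1) *: wave_in k g e t) - p *: g t - div_symbol k e t).
Proof.
move=> t0; have q0 : 0 < p - 2^-1 by have := p1; lra.
have src := half_line_boundedB (half_line_boundedN (half_line_boundedZ p hg)) (half_line_bounded_div k B0 he).
have [[_ _ _ du] _] := incomingP q0 src; rewrite /wave_in (negbTE kn0).
apply: derive_eq (dD (du t t0) (dZc (is_derive_decay (p - 2^-1) t0) (dcst t (1 : R) (wave_out k g e 0)))) _.
rewrite scaler0 add0r; set I := incoming _ _ t; move: I (wave_out k g e 0) (g t) (div_symbol k e t) => [? ?] [? ?] [? ?] [? ?].
by_parts.
Qed.

Lemma wave_in0 : wave_in k g e 0 = wave_out k g e 0.
Proof.
have q0 : 0 < p - 2^-1 by have := p1; lra.
have src := half_line_boundedB (half_line_boundedN (half_line_boundedZ p hg)) (half_line_bounded_div k B0 he).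
have [[_ _ i0 _] _] := incomingP q0 src.
by rewrite /wave_in (negbTE kn0) i0 add0r decay0 scale1r.
Qed.

Lemma unweight_derive (f : R -> C) df (t : R) : 0 < t -> is_derive t (1 : R) f df ->
  is_derive t (1 : R) (fun t => decay 2^-1 t *: f t) (decay 2^-1 t *: (df - 2^-1 *: f t)).
Proof.
move=> t0 hf; apply: derive_eq (dZc (is_derive_decay 2^-1 t0) hf) _.
by move: (f t) df {hf} => [? ?] [? ?]; by_parts.
Qed.

Lemma sum_isym2 : \sum_(j < d) isym R k j * isym R k j = (- (p ^+ 2))%:C%C.
Proof.
rewrite /norm2 sqr_sqrtr; last by apply: sumr_ge0 => j _; exact: sqr_ge0.
rewrite -sumrN rmorph_sum/=; apply: eq_bigr => j _; rewrite expr2; by_parts.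
Qed.

Variable z : C.
Local Notation dq := (decay (p - 2^-1)).

Let dq_derive (t : R) : 0 < t -> is_derive t (1 : R) (fun t => dq t *: z) ((- (p - 2^-1) * dq t) *: z).
Proof.
move=> t0; apply: derive_eq (dZc (is_derive_decay (p - 2^-1) t0) (dcst t (1 : R) z)) _.
by rewrite scaler0 add0r.
Qed.

(** The potential is [(w - u) / (2 |k|)] in terms of the two waves, plus the
harmonic extension of the boundary value [z]; the weight [e^(t/2)] is still
present. *)
Definition mode_potential (t : R) : C :=
  dq t *: z + (2 * p)^-1 *: (wave_in k g e t - wave_out k g e t).

Lemma mode_potential0 : mode_potential 0 = z.
Proof. by rewrite /mode_potential decay0 scale1r wave_in0 subrr scaler0 addr0. Qed.

(** Minus the vertical velocity, because depth is measured downwards. *)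
Lemma mode_potential_derive (t : R) : 0 < t ->
  is_derive t (1 : R) (fun t => decay 2^-1 t *: mode_potential t)
   (- (decay 2^-1 t *: (dq t *: (p *: z) + mode_solve k g e (Some None) t))).
Proof.
move=> t0; have pn : p != 0 by rewrite gt_eqF// (lt_le_trans ltr01 p1).
apply: derive_eq (unweight_derive t0 (dD (dq_derive t0) (dZ (2 * p)^-1 (dB (wave_in_derive t0) (wave_out_derive t0))))) _.
rewrite /mode_solve.
move: z (wave_in k g e t) (wave_out k g e t) (g t) (div_symbol k e t) (decay 2^-1 t) (dq t) => [? ?] [? ?] [? ?] [? ?] [? ?] ? ?.
by apply/eqP; rewrite eq_complex; apply/andP; split; apply/eqP => /=; field.
Qed.

(** The divergence of the horizontal velocities: this is incompressibility. *)
Lemma mode_flux_derive (t : R) : 0 < t ->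
  is_derive t (1 : R) (fun t => decay 2^-1 t *: (dq t *: (p *: z) + mode_solve k g e None t))
   (\sum_(j < d) isym R k j * (decay 2^-1 t *: (dq t *: (isym R k j * z) + mode_solve k g e (Some (Some j)) t))).
Proof.
move=> t0; have pn : p != 0 by rewrite gt_eqF// (lt_le_trans ltr01 p1).
have h1 : is_derive t (1 : R) (fun t => dq t *: (p *: z)) ((- (p - 2^-1) * dq t) *: (p *: z)).
  apply: derive_eq (dZc (is_derive_decay (p - 2^-1) t0) (dcst t (1 : R) (p *: z))) _.
  by rewrite scaler0 add0r.
apply: derive_eq (unweight_derive t0 (dD h1 (dZ 2^-1 (dD (wave_out_derive t0) (wave_in_derive t0))))) _.
have -> : \sum_(j < d) isym R k j * (decay 2^-1 t *: (dq t *: (isym R k j * z) + mode_solve k g e (Some (Some j)) t)) =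
   decay 2^-1 t *: ((\sum_(j < d) isym R k j * isym R k j) * mode_potential t - div_symbol k e t).
  rewrite /div_symbol mulr_suml -sumrB scaler_sumr; apply: eq_bigr => j _.
  rewrite /mode_solve /mode_potential !scalerc; ring.
rewrite sum_isym2 /mode_potential.
move: z (wave_in k g e t) (wave_out k g e t) (g t) (div_symbol k e t) (decay 2^-1 t) (dq t) => [? ?] [? ?] [? ?] [? ?] [? ?] ? ?.
by apply/eqP; rewrite eq_complex; apply/andP; split; apply/eqP => /=; field.
Qed.

Lemma mode_slope j (t : R) : isym R k j * mode_potential t =
  dq t *: (isym R k j * z) + mode_solve k g e (Some (Some j)) t + e j t.
Proof. rewrite /mode_solve /mode_potential !scalerc; ring. Qed.

Lemma mode_potential_bounded : half_line_bounded mode_potential (normc z + 8 * (d%:R * B)).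
Proof.
have dB : 0 <= d%:R * B by apply: mulr_ge0.
have q0 : 0 <= p - 2^-1 by have := p1; lra.
have h := half_line_boundedD (half_line_bounded_decay z q0) (half_line_boundedZ (2 * p)^-1 (half_line_boundedB (wave_in_bounded k B0 hg he) (wave_out_bounded k B0 hg he))).
apply: half_line_bounded_le h; rewrite lerD2l ger0_norm; last by rewrite invr_ge0; have := p1; lra.
rewrite ler_pdivrMl; last by have := p1; lra.
have := ler_wpM2r dB p1; lra.
Qed.

End mode_ode.

Lemma unweight_bounded (R : realType) (f : R -> Rcomplex R) M : half_line_bounded f M ->
  half_line_bounded (fun t => decay 2^-1 t *: f t) M.
Proof.
move=> [cf hf fM]; split.
- by move=> t; apply: cvgZ; [exact: decay_continuous|exact: cf].
- by move=> t; rewrite /decay maxA maxxx -hf.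
- move=> t; rewrite normcZ ger0_norm ?expR_ge0//.
  by apply: le_trans (fM t); rewrite ler_piMl ?normc_ge0// decay_le1.
Qed.

(** A family in the space of index [s - 1] still has an absolutely convergent
Fourier series after one differentiation when [s - 2] is at least [(d + 1) /
2]. *)
Lemma japanese_nsum (R : realType) d (d0 : (0 < d)%N) (sigma s : R) (f : 'rV[int]_d -> R) A :
  0 <= sigma -> d.+1%:R <= 2 * (s - 2) -> 0 <= A -> (forall k, 0 <= f k) ->
  hbound sigma (s - 1) f A -> (nsum (fun k => japanese R k * f k)%R < +oo)%E.
Proof.
move=> sg hs A0 f0; have -> : s - 1 = (s - 2) + 1 by ring.
move=> hA; have h := (@hbound_japanese R d sigma (s - 2) f A).2 hA.
have jf0 k : 0 <= japanese R k * f k by apply: mulr_ge0 => //; exact: ltW (japanese_gt0 R k).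
exact: le_lt_trans (hbound_nsum d0 sg hs A0 jf0 h) (ltry _).
Qed.

Section convolution_family.
Variables (R : realType) (d : nat).
Local Notation C := (Rcomplex R).
Local Notation K := 'rV[int]_d.
Variables (u : K -> C) (f : K -> R -> C) (m : K -> R).
Hypothesis au : asum u.
Hypothesis bf : bounded_family f m.

Let m0 k : 0 <= m k.
Proof. by have [fm _] := bf; have [_ _ h0] := fm k; apply: le_trans (h0 0); exact: normc_ge0. Qed.

Let fin : (\esum_(k in setT) nsum (fun l => normc (u (k - l)) * m l)%R < +oo)%E.
Proof. have [_ mo] := bf; exact: (@nsum_conv_lty R d (fun k => normc (u k)) m (fun k => normc_ge0 (u k)) m0 au mo). Qed.

Let row0 k : (0 <= nsum (fun l => normc (u (k - l)) * m l)%R)%E.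
Proof. by apply: nsum_ge0 => j; rewrite mulr_ge0 ?normc_ge0. Qed.

Let row k : (nsum (fun l => normc (u (k - l)) * m l)%R < +oo)%E.
Proof. exact: (esum_lty_all (g := fun k => nsum (fun l => normc (u (k - l)) * m l)%R) k row0 fin). Qed.

Lemma asum_conv_row k t : asum (fun l => u (k - l) * f l t).
Proof.
apply: (@asum_conv R d u f (fun k => normc (u k)) m k t _ _ (row k)) => // l.
by have [fm _] := bf; have [_ _] := fm l; exact.
Qed.

Lemma bounded_family_conv : bounded_family (fconv u f) (rconv (fun k => normc (u k)) m).
Proof.
have [fm _] := bf; split; first by move=> k; exact: fconv_bounded.
rewrite /nsum; under eq_esum do rewrite /rconv fineK ?ge0_fin_numE//.
exact: fin.
Qed.

End convolution_family.

Section surface.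
Variables (R : realType) (d : nat) (eta : 'rV[int]_d -> Rcomplex R).
Hypothesis eta_real : forall k, eta (- k) = ((eta k)^*)%C.
Hypothesis jeta : (nsum (fun k => japanese R k * jweight eta k)%R < +oo)%E.
Local Notation C := (Rcomplex R).
Local Notation K := 'rV[int]_d.
Local Notation point := ('rV[R]_d * R)%type.
Local Notation h := (real_fourier eta).

Definition surf1 j (x : 'rV[R]_d) : R := complex.Re (fourier (grad eta j) x).
Definition surf2 l j (x : 'rV[R]_d) : R := complex.Re (fourier (grad (grad eta j) l) x).

Let jw : (nsum (jweight eta) < +oo)%E.
Proof. by apply: nsum_lty_le jeta => k; rewrite ler_peMl// jweight_ge0. Qed.

Lemma asum_surface : asum eta.
Proof. by apply: nsum_lty_le jw => k; rewrite /jweight ler_peMl// normc_ge0. Qed.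

Lemma jweight_grad (u : K -> C) j k : jweight (grad u j) k <= japanese R k * jweight u k.
Proof. by apply: ler_wpM2l; [exact: ltW (japanese_gt0 R k)|exact: normc_grad]. Qed.

Lemma nsum_jweight_grad j : (nsum (jweight (grad eta j)) < +oo)%E.
Proof. by apply: nsum_lty_le jeta => k; exact: jweight_grad. Qed.

Lemma asum_grad j : asum (grad eta j).
Proof. by apply: nsum_lty_le jw => k; exact: normc_grad. Qed.

Lemma asum_grad2 l j : asum (grad (grad eta j) l).
Proof. by apply: nsum_lty_le (nsum_jweight_grad j) => k; exact: normc_grad. Qed.

Lemma grad_real (u : K -> C) j : (forall k, u (- k) = ((u k)^*)%C) ->
  forall k, grad u j (- k) = ((grad u j k)^*)%C.
Proof.
move=> hu k; rewrite /grad hu /isym mxE mulrNz.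
case: (u k) => a b; apply/eqP; rewrite eq_complex /=; apply/andP; split; apply/eqP; ring.
Qed.

Let realE (z : C) : complex.Im z = 0 -> forall y : C, z * y = complex.Re z *: y.
Proof. by case: z => a b /= -> y; rewrite scalerc. Qed.

Lemma fourier_surf1 j x (y : C) : fourier (grad eta j) x * y = surf1 j x *: y.
Proof. by apply: realE; apply: fourier_real; [exact: asum_grad|exact: grad_real]. Qed.

Lemma fourier_surf2 l j x (y : C) : fourier (grad (grad eta j) l) x * y = surf2 l j x *: y.
Proof.
by apply: realE; apply: fourier_real; [exact: asum_grad2|apply: grad_real; exact: grad_real].
Qed.

Let Re_sumZ (c : 'I_d -> R) (z : 'I_d -> C) : complex.Re (\sum_(l < d) c l *: z l) = \sum_(l < d) c l * complex.Re (z l).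
Proof.
elim: (index_enum 'I_d) => [|l I ih]; first by rewrite !big_nil.
by rewrite !big_cons -ih; case: (z l) (\sum_(j <- I) _) => ? ? [? ?].
Qed.

Let Re_continuous (f : 'rV[R]_d -> C) : continuous f -> continuous (fun x => complex.Re (f x)).
Proof. by move=> cf x; apply: (@cvg_Re _ _ _ (nbhs_filter x)); exact: cf. Qed.

Lemma surface_derive x v : is_derive x v h (\sum_(l < d) v ord0 l * surf1 l x).
Proof. by have /is_derive_Re := fourier_derive x v jw; rewrite Re_sumZ. Qed.

Lemma surf1_derive j x v : is_derive x v (surf1 j) (\sum_(l < d) v ord0 l * surf2 l j x).
Proof. by have /is_derive_Re := fourier_derive x v (nsum_jweight_grad j); rewrite Re_sumZ. Qed.

Lemma surface_continuous : continuous h.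
Proof. by apply: Re_continuous; apply: fourier_continuous; exact: asum_surface. Qed.

Lemma surf1_continuous j : continuous (surf1 j).
Proof. by apply: Re_continuous; apply: fourier_continuous; exact: asum_grad. Qed.

Lemma surf2_continuous l j : continuous (surf2 l j).
Proof. by apply: Re_continuous; apply: fourier_continuous; exact: asum_grad2. Qed.

Lemma Re_fourier_le (u : K -> C) x : asum u -> `|complex.Re (fourier u x)| <= fine (nsum (fun k => normc (u k))).
Proof.
move=> au; apply: le_trans (normc_Re _) _.
apply: (@csum_norm_le _ _ _ (fun k => normc (u k))) => [k|]; first by rewrite normcM_expi.
by rewrite fineK// ge0_fin_numE//; apply: nsum_ge0 => k; exact: normc_ge0.
Qed.

Lemma surface_periodic x j : h (x + (2 * pi) *: evec R j) = h x.
Proof.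
congr complex.Re; rewrite /fourier; congr (@summability.sum _ R (Rcomplex R) _).
by apply/funext => k; rewrite expi_periodic.
Qed.

(** Below the surface the depth stays positive along short segments, where the
modes are differentiable. *)
Lemma series_derive_below f f' m m' (v p : point) : below h p ->
  (forall k (t : R), 0 < t -> is_derive t (1 : R) (f k) (f' k t)) ->
  (forall k, half_line_bounded (f k) (m k)) -> bounded_family f' m' ->
  (nsum (fun k => japanese R k * m k)%R < +oo)%E ->
  is_derive p v (series_at h f) (slope surf1 v p *: series_at h f' p +
    \sum_(l < d) v.1 ord0 l *: series_at h (dfam f l) p).
Proof.
move=> Dp hf fm f'm jm.
have cth : continuous (fun t : R => h (t *: v.1 + p.1) - (t * v.2 + p.2)).
  move=> t; apply: cvgB.
    apply: (@continuous_comp _ _ _ (fun t : R => t *: v.1 + p.1) h); last exact: surface_continuous.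
    by apply: cvgD; [apply: cvgZl; exact: cvg_id|exact: cvg_cst].
  by apply: cvgD; [apply: cvgMl; exact: cvg_id|exact: cvg_cst].
have th0 : 0 < h ((0 : R) *: v.1 + p.1) - (0 * v.2 + p.2).
  by rewrite scale0r mul0r !add0r subr_gt0.
have [r r0 hr] : exists2 r : R, 0 < r & forall t : R, `|t| < r -> 0 < h (t *: v.1 + p.1) - (t * v.2 + p.2).
  have : \forall t \near (0 : R), 0 < h (t *: v.1 + p.1) - (t * v.2 + p.2).
    exact: (cth 0 _ (open_nbhs_nbhs (conj (@open_gt R 0) th0))).
  move=> /nbhs_ballP[r r0 hr]; exists r => // t tr; apply: hr.
  by rewrite /ball /= sub0r normrN.
pose dh (t : R) : R := \sum_(l < d) v.1 ord0 l * surf1 l (t *: v.1 + p.1).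
pose D : R := \sum_(l < d) `|v.1 ord0 l| * fine (nsum (fun k => normc (grad eta l k))).
have hd := @series_at_derive R d h dh f f' m m' p v D r r0.
have -> : slope surf1 v p = dh 0 - v.2 by rewrite /slope /dh scale0r add0r.
apply: hd => // [t _|t _|t tr].
- apply/is_derive_line; have /is_derive_line := surface_derive (t *: v.1 + p.1) v.1.
  apply: near_eq_is_derive; near=> u; congr h.
  by rewrite scaler1 scalerDl addrA.
- apply: le_trans (ler_norm_sum _ _ _) _; apply: ler_sum => l _; rewrite normrM ler_wpM2l//.
  by apply: Re_fourier_le; exact: asum_grad.
- by rewrite -subr_gt0; exact: hr.
Unshelve. all: by end_near. Qed.

(** The Leibniz rule on the Fourier side: [k = (k - l) + l]. *)
Lemma series_dfam_conv u f m l p : (nsum (jweight u) < +oo)%E -> bounded_family f m ->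
  (nsum (fun k => japanese R k * m k)%R < +oo)%E ->
  series_at h (dfam (fconv u f) l) p =
  fourier (grad u l) p.1 * series_at h f p + fourier u p.1 * series_at h (dfam f l) p.
Proof.
move=> ju bf jm; have [fm mo] := bf.
have m0 k : 0 <= m k by have [_ _ h0] := fm k; apply: le_trans (h0 0); exact: normc_ge0.
have au : asum u by apply: nsum_lty_le ju => k; rewrite /jweight ler_peMl// normc_ge0.
have ag : asum (grad u l) by apply: nsum_lty_le ju => k; exact: normc_grad.
have bdf : bounded_family (dfam f l) (fun k => japanese R k * m k).
  split=> // k; apply: half_line_bounded_le (half_line_boundedM (isym R k l) (fm k)).
  by rewrite ler_wpM2r// (le_trans (normc_isym_le _ _ _))// norm2_le_japanese.
rewrite -(series_at_conv h p ag bf) -(series_at_conv h p au bdf).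
set t := h p.1 - p.2.
rewrite /series_at -csumD.
- congr csum; apply/funext => k; rewrite -mulrDl; congr (_ * _); rewrite -/t /dfam /fconv.
  rewrite -csumMl; last exact: (asum_conv_row au bf).
  rewrite -csumD; [|exact: (asum_conv_row ag bf)|exact: (asum_conv_row au bdf)].
  congr csum; apply/funext => i; rewrite /grad.
  have -> : isym R k l = isym R (k - i) l + isym R i l.
    by rewrite /isym !mxE rmorphB /=; apply/eqP; rewrite eq_complex /= addr0 subrK !eqxx.
  ring.
- by apply: (bounded_family_asum _ _ (bounded_family_conv ag bf)).
- by apply: (bounded_family_asum _ _ (bounded_family_conv au bdf)).
Qed.

End surface.

(** * The potential *)

Lemma nsum_lty1 (R : realType) (I : choiceType) (i0 : I) (c : R) : 0 <= c ->
  (nsum (fun i => if i == i0 then c else 0%R) < +oo)%E.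
Proof.
move=> c0; have -> : nsum (fun i => if i == i0 then c else 0%R) = \esum_(i in [set i0]) c%:E.
  rewrite [RHS]esum_mkcond; apply: eq_esum => i _; case: eqVneq => [->|/eqP n]; first by rewrite mem_set.
  by rewrite memNset.
by rewrite esum_set1 ?ltry// lee_fin.
Qed.

Section potential.
Variables (R : realType) (d : nat) (d0 : (0 < d)%N) (sigma s r0 : R).
Hypothesis sigma_ge0 : 0 <= sigma.
Hypothesis r0_large : d.+1%:R <= 2 * r0.
Hypothesis r0s : r0 <= s - 1.
Hypothesis s_large : d.+1%:R <= 2 * (s - 2).
Local Notation C := (Rcomplex R).
Local Notation K := 'rV[int]_d.
Local Notation point := ('rV[R]_d * R)%type.
Variables (eta : rsobolev d sigma s) (psi : sobolev d sigma s) (w : wspace d sigma (s - 1)).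
Hypothesis wE : w = flat psi + op d0 sigma_ge0 r0_large r0s eta w.
Local Notation h := (real_fourier eta).
Local Notation half := (decay 2^-1).
Implicit Types (k : K) (t : R).

Let mw k := msize (w k).
Let mg : K -> R := rconv (jweight eta) mw.
Let g k := source_flux eta w k.
Let e k := source_slope eta w k.

Let mw0 k : 0 <= mw k. Proof. exact: wsize_ge0. Qed.

Let mg0 k : 0 <= mg k. Proof. exact: gamma_ge0. Qed.

Let j0 k : 0 <= japanese R k. Proof. exact: ltW (japanese_gt0 R k). Qed.

Let hg k : half_line_bounded (g k) (d%:R * mg k).
Proof. exact: (source_flux_bounded d0 sigma_ge0 r0_large r0s eta w k). Qed.

Let he k j : half_line_bounded (e k j) (mg k).
Proof. exact: (source_slope_bounded d0 sigma_ge0 r0_large r0s eta w k j). Qed.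

Let jmw : (nsum (fun k => japanese R k * mw k)%R < +oo)%E.
Proof. exact: (japanese_nsum d0 sigma_ge0 s_large (wnorm_ge0 _ _) mw0 (wnorm_bound w (lexx _))). Qed.

Let jmg : (nsum (fun k => japanese R k * mg k)%R < +oo)%E.
Proof.
have [_ hb] := tame_gamma d0 sigma_ge0 r0_large r0s eta w r0s (lexx _).
apply: (japanese_nsum d0 sigma_ge0 s_large _ mg0 hb).
have sn (r : R) : 0 <= snorm r eta by exact: snorm_ge0.
have wn (r : R) : 0 <= wnorm r w by exact: wnorm_ge0.
by apply: mulr_ge0; [apply: mulr_ge0; [exact: powR_ge0|exact: lattice_const_ge0]|apply: addr_ge0; exact: mulr_ge0].
Qed.

Let jjw (u : sobolev d sigma s) : (nsum (fun k => japanese R k * jweight u k)%R < +oo)%E.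
Proof.
exact: (japanese_nsum d0 sigma_ge0 s_large (snorm_ge0 _ _) (jweight_ge0 u) (snorm_jweight u (lexx _))).
Qed.

Let eta_real k : eta (- k) = ((eta k)^*)%C.
Proof. by have /asboolP := valP eta; exact. Qed.

Let jeta := jjw eta.

Let drop_j (m : K -> R) : (forall k, 0 <= m k) -> (nsum (fun k => japanese R k * m k)%R < +oo)%E -> (nsum m < +oo)%E.
Proof. by move=> m0; apply: nsum_lty_le => k; rewrite ler_peMl. Qed.

(** The families of modes with the exponential weight undone. *)
Let fam i k t : C := half t *: w k i t.
Let fN := fam None.
Let fb := fam (Some None).
Let fV j := fam (Some (Some j)).
Let fe j : K -> R -> C := fconv (grad eta j) fb.

Let fam_bounded i k : half_line_bounded (fam i k) (mw k).
Proof. by apply: unweight_bounded; exact: wspace_bounded. Qed.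

Let fam_family i : bounded_family (fam i) mw.
Proof. by split; [exact: fam_bounded|exact: drop_j]. Qed.

Let half_conv j i k t : half t *: fconv (grad eta j) (fun l => w l i) k t = fconv (grad eta j) (fam i) k t.
Proof.
rewrite /fconv -csumZ.
  by congr csum; apply/funext => l; rewrite /fam scaler_mulrc.
apply: (@asum_conv R d _ (fun l => w l i) (jweight eta) mw) => [l|l|]; [exact: normc_grad|exact: wsize_ge|].
by have [hf _] := tame_gamma d0 sigma_ge0 r0_large r0s eta w r0s (lexx _); exact: hf.
Qed.

Let feE j k t : fe j k t = half t *: e k j t.
Proof. exact: (esym (half_conv j (Some None) k t)). Qed.

Let famE i k t : fam i k t = half t *: (flat_family psi k i t + mode_solve k (g k) (e k) i t).
Proof. by rewrite /fam {1}wE. Qed.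

Let fNE k t : fN k t = half t *: (flat_family psi k None t + mode_solve k (g k) (e k) None t).
Proof. exact: famE. Qed.

Let fbE k t : fb k t = half t *: (flat_family psi k (Some None) t + mode_solve k (g k) (e k) (Some None) t).
Proof. exact: famE. Qed.

Let fVE j k t : fV j k t = half t *: (flat_family psi k (Some (Some j)) t + mode_solve k (g k) (e k) (Some (Some j)) t).
Proof. exact: famE. Qed.

Let U : R -> C := outgoing 2^-1 (g 0).

Let UP : outgoing_spec 2^-1 (g 0) U /\ forall t, normc (U t) <= 2 * (d%:R * mg 0 / 2^-1).
Proof. by apply: outgoingP; [rewrite invr_gt0|exact: hg]. Qed.

(** At frequency zero the potential is the primitive of the vertical velocity,
written with the bounded solution of [U' = U / 2 - g], since [e^(- t/2) U] has
derivative [- e^(- t/2) g]. *)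
Let phi k t : C := if k == 0 then (psi 0 - U 0) + half t *: U t
  else half t *: mode_potential k (g k) (e k) (psi k) t.

Let phi0 k : phi k 0 = psi k.
Proof.
rewrite /phi decay0 scale1r; case: eqVneq => [->|kn]; first by rewrite subrK.
by rewrite scale1r (mode_potential0 kn (mg0 k) (hg k) (he k)).
Qed.

(** A majorant of the modes of the potential; the last summand is the
integration constant at frequency zero. *)
Let mphi k := normc (psi k) + 8 * (d%:R * mg k) + (if k == 0 then normc (U 0) else 0).

Let phi_bounded k : half_line_bounded (phi k) (mphi k).
Proof.
rewrite /phi /mphi; have [->|kn] := eqVneq k 0.
  have [[cU hU _ _] Ub] := UP.
  have hc : half_line_bounded (fun=> psi 0 - U 0) (normc (psi 0) + normc (U 0)).
    split=> // [t|t]; first exact: cvg_cst.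
    by apply: le_trans (le_normcD _ _) _; rewrite normcN.
  have hU' : half_line_bounded U (2 * (d%:R * mg 0 / 2^-1)) by [].
  apply: half_line_bounded_le (half_line_boundedD hc (unweight_bounded hU')).
  have : 0 <= d%:R * mg 0 by apply: mulr_ge0.
  by rewrite invrK; lra.
rewrite addr0; apply: unweight_bounded.
exact: (mode_potential_bounded kn (mg0 k) (hg k) (he k) (psi k)).
Qed.

Let isym0 j : isym R (0 : K) j = 0.
Proof. by rewrite /isym mxE. Qed.

Let slopeE j k t : isym R k j * phi k t = fV j k t + fe j k t.
Proof.
rewrite feE fVE -scalerDr /phi; have [->|kn] := eqVneq k 0.
  by rewrite isym0 mul0r /= isym0 !mul0r scaler0 !scaler0 sub0r add0r addNr scaler0.
rewrite -scaler_mulrc; congr (_ *: _).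
exact: (mode_slope k (g k) (e k) (psi k) j t).
Qed.

Let fluxE k t : fb k t = fN k t + \sum_(j < d) fconv (grad eta j) (fV j) k t.
Proof.
rewrite fbE fNE.
under eq_bigr do rewrite -half_conv.
by rewrite -scaler_sumr -scalerDr /= addrA.
Qed.

Let phi_derive k t : 0 < t -> is_derive t (1 : R) (phi k) (- fb k t).
Proof.
move=> t0; rewrite /phi fbE; have [->|kn] := eqVneq k 0.
  have [[_ _ dU _] _] := UP.
  apply: derive_eq (dD (dcst _ _ _) (unweight_derive t0 (dU t t0))) _.
  rewrite add0r /= /wave_out /wave_in eqxx norm2_0 scale0r scaler0 add0r !addr0 scaler0 add0r.
  by rewrite addrAC subrr sub0r scalerN.
exact: (mode_potential_derive kn (mg0 k) (hg k) (he k) (psi k) t0).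
Qed.

Let flux_derive k t : 0 < t -> is_derive t (1 : R) (fN k) (\sum_(j < d) isym R k j * fV j k t).
Proof.
move=> t0; have [->|kn] := eqVneq k 0.
  have -> : \sum_(j < d) isym R 0 j * fV j 0 t = 0 by rewrite big1// => j _; rewrite isym0 mul0r.
  have -> : fN 0 = fun=> 0; last exact: dcst.
  apply/funext => u; rewrite fNE /= /wave_out /wave_in eqxx norm2_0 scale0r scaler0 addr0.
  by rewrite !scaler0 addr0 scaler0.
under eq_bigr do rewrite fVE.
have -> : fN k = fun t => half t *: (decay (norm2 R k - 2^-1) t *: (norm2 R k *: psi k) + mode_solve k (g k) (e k) None t).
  by apply/funext => u; rewrite fNE.
exact: (mode_flux_derive kn (mg0 k) (hg k) (he k) (psi k) t0).
Qed.

Let jpsi : (nsum (fun k => japanese R k * normc (psi k))%R < +oo)%E.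
Proof. exact: (drop_j (jweight_ge0 psi) (jjw psi)). Qed.

Let mphi0 k : 0 <= mphi k.
Proof. by have [_ _ h0] := phi_bounded k; apply: le_trans (h0 0); exact: normc_ge0. Qed.

Let jmphi : (nsum (fun k => japanese R k * mphi k)%R < +oo)%E.
Proof.
have a0 k : 0 <= japanese R k * normc (psi k) by apply: mulr_ge0 => //; exact: normc_ge0.
have b0 k : 0 <= japanese R k * mg k by exact: mulr_ge0.
have d8 : 0 <= 8 * d%:R :> R by apply: mulr_ge0.
have c0 (k : K) : 0 <= (if k == 0 then japanese R (0 : K) * normc (U 0) else 0).
  by case: ifP => // _; apply: mulr_ge0 => //; exact: normc_ge0.
have ab0 k : 0 <= 8 * d%:R * (japanese R k * mg k) by exact: mulr_ge0.
have cc : 0 <= japanese R (0 : K) * normc (U 0) by apply: mulr_ge0 => //; exact: normc_ge0.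
have s0 k : 0 <= japanese R k * normc (psi k) + 8 * d%:R * (japanese R k * mg k) by exact: addr_ge0.
apply: nsum_lty_le (nsum_ltyD s0 c0 (nsum_ltyD a0 ab0 jpsi (nsum_ltyZ d8 b0 jmg)) (nsum_lty1 (0 : K) cc)) => k.
by rewrite /mphi !mulrDr; case: eqVneq => [->|_]; lra.
Qed.

Let conv_family i j : bounded_family (fconv (grad eta j) (fam i)) mg.
Proof.
split; last exact: drop_j.
move=> k; apply: fconv_bounded => [l|l|]; [exact: normc_grad|exact: fam_bounded|].
by have [hf _] := tame_gamma d0 sigma_ge0 r0_large r0s eta w r0s (lexx _); exact: hf.
Qed.

Let fe_family j : bounded_family (fe j) mg := conv_family (Some None) j.

Let dfam_family f m l : bounded_family f m -> (forall k, 0 <= m k) ->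
  (nsum (fun k => japanese R k * m k)%R < +oo)%E -> bounded_family (dfam f l) (fun k => japanese R k * m k).
Proof.
move=> [fm _] m0 jm; split=> // k; apply: half_line_bounded_le (half_line_boundedM (isym R k l) (fm k)).
by rewrite ler_wpM2r// (le_trans (normc_isym_le _ _ _))// norm2_le_japanese.
Qed.

Let phi_family : bounded_family phi mphi.
Proof. by split; [exact: phi_bounded|exact: drop_j]. Qed.

Let ms k := mw k + mg k.
Let ms0 k : 0 <= ms k. Proof. exact: addr_ge0. Qed.

Let jms : (nsum (fun k => japanese R k * ms k)%R < +oo)%E.
Proof.
have a0 k : 0 <= japanese R k * mw k by exact: mulr_ge0.
have b0 k : 0 <= japanese R k * mg k by exact: mulr_ge0.
by apply: nsum_lty_le (nsum_ltyD a0 b0 jmw jmg) => k; rewrite mulrDr.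
Qed.

Let dphiE j : dfam phi j = fun k t => fV j k t + fe j k t.
Proof. by apply/funext => k; apply/funext => t; exact: slopeE. Qed.

Let slope_family j : bounded_family (dfam phi j) ms.
Proof. by rewrite dphiE; apply: bounded_familyD => //; exact: fam_family. Qed.

Let div_fam k t : C := \sum_(j < d) dfam (fV j) j k t.

Let div_family : bounded_family div_fam (fun k => \sum_(j < d) japanese R k * mw k).
Proof.
have hf j : bounded_family (dfam (fV j) j) (fun k => japanese R k * mw k) by apply: dfam_family => //; exact: fam_family.
split; first by move=> k; apply: half_line_bounded_sum => j; have [h _] := hf j.
apply: nsum_lty_le (nsum_ltyZ (c := d%:R) _ _ jmw) => // k; last exact: mulr_ge0.
by rewrite sumr_const card_ord mulr_natl.
Qed.

Let Phi : point -> C := series_at h phi.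
Let N : point -> C := series_at h fN.
Let B : point -> C := series_at h fb.
Let T : point -> C := series_at h div_fam.
Let V j : point -> C := series_at h (fV j).
Let Psi j : point -> C := series_at h (dfam phi j).
Let M j : point -> C := series_at h (dfam fN j).
Let Q j : point -> C := series_at h (dfam fb j).
Let P l j : point -> C := series_at h (dfam (dfam phi j) l).
Local Notation h1 := (surf1 eta).
Local Notation h2 := (surf2 eta).

Let ch : continuous h. Proof. exact: surface_continuous. Qed.

Let cont f m : bounded_family f m -> continuous (series_at h f).
Proof. exact: series_at_continuous. Qed.

Let dPhi v p : below h p -> is_derive p v Phi (- (slope h1 v p *: B p) + \sum_(l < d) v.1 ord0 l *: Psi l p).
Proof.
move=> Dp.
apply: derive_eq (series_derive_below jeta v Dp phi_derive phi_bounded (bounded_familyN (fam_family (Some None))) jmphi) _.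
by rewrite (series_atN _ _ (fam_family (Some None))) scalerN.
Qed.

Let dflux v p : below h p -> is_derive p v N (slope h1 v p *: T p + \sum_(l < d) v.1 ord0 l *: M l p).
Proof.
by move=> Dp; exact: (series_derive_below jeta v Dp flux_derive (fam_bounded None) div_family jmw).
Qed.

Let dPsi j v p : below h p -> is_derive p v (Psi j) (- (slope h1 v p *: Q j p) + \sum_(l < d) v.1 ord0 l *: P l j p).
Proof.
move=> Dp; have [sb _] := slope_family j.
have hQ : bounded_family (dfam fb j) (fun k => japanese R k * mw k) by apply: dfam_family => //; exact: fam_family.
have hd k (t : R) : 0 < t -> is_derive t (1 : R) (dfam phi j k) (- dfam fb j k t).
  by move=> t0; rewrite /dfam -mulrN; apply: is_derive_mulc; exact: phi_derive.
apply: derive_eq (series_derive_below jeta v Dp hd sb (bounded_familyN hQ) jms) _.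
by rewrite (series_atN _ _ hQ) scalerN.
Qed.

Let fluxS p : B p = N p + \sum_(j < d) h1 j p.1 *: V j p.
Proof.
have -> : B p = series_at h (fun k t => fN k t + \sum_(j < d) fconv (grad eta j) (fV j) k t) p.
  by rewrite /B; congr (series_at h _ p); apply/funext => k; apply/funext => t; exact: fluxE.
have hs : bounded_family (fun k t => \sum_(j < d) fconv (grad eta j) (fV j) k t) (fun k => \sum_(j < d) mg k).
  split; first by move=> k; apply: half_line_bounded_sum => j; have [hb _] := conv_family (Some (Some j)) j.
  apply: nsum_lty_le (nsum_ltyZ (c := d%:R) _ mg0 (drop_j mg0 jmg)) => // k.
  by rewrite sumr_const card_ord mulr_natl.
rewrite (series_atD h p (fam_family None) hs); congr (_ + _).
rewrite (series_at_sum _ h p (fun j => conv_family (Some (Some j)) j)); apply: eq_bigr => j _.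
by rewrite (series_at_conv h p (asum_grad jeta j) (fam_family (Some (Some j)))) fourier_surf1.
Qed.

Let PsiS j p : Psi j p = V j p + h1 j p.1 *: B p.
Proof.
rewrite /Psi dphiE (series_atD h p (fam_family (Some (Some j))) (fe_family j)); congr (_ + _).
by rewrite (series_at_conv h p (asum_grad jeta j) (fam_family (Some None))) fourier_surf1.
Qed.

Let dconv_family i j l : bounded_family (dfam (fconv (grad eta j) (fam i)) l) (fun k => japanese R k * mg k).
Proof. by apply: dfam_family => //; exact: conv_family. Qed.

Let dconv i j l p : series_at h (dfam (fconv (grad eta j) (fam i)) l) p =
  h2 l j p.1 *: series_at h (fam i) p + h1 j p.1 *: series_at h (dfam (fam i) l) p.
Proof.
by rewrite (series_dfam_conv eta l p (nsum_jweight_grad jeta j) (fam_family i) jmw) (fourier_surf2 eta_real jeta) (fourier_surf1 eta_real jeta).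
Qed.

Let dVS j l p : series_at h (dfam (fV j) l) p = P l j p - h2 l j p.1 *: B p - h1 j p.1 *: Q l p.
Proof.
have dw : bounded_family (dfam (fV j) l) (fun k => japanese R k * mw k) by apply: dfam_family => //; exact: fam_family.
have -> : P l j p = series_at h (dfam (fV j) l) p + (h2 l j p.1 *: B p + h1 j p.1 *: Q l p).
  rewrite /B /Q -dconv /P -(series_atD h p dw (dconv_family (Some None) j l)) dphiE.
  by congr (series_at h _ p); apply/funext => k; apply/funext => t; rewrite /dfam mulrDr.
by rewrite -addrA -opprD addrK.
Qed.

Let TS p : T p = \sum_(j < d) (P j j p - h2 j j p.1 *: B p - h1 j p.1 *: Q j p).
Proof.
have hf j : bounded_family (dfam (fV j) j) (fun k => japanese R k * mw k) by apply: dfam_family => //; exact: fam_family.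
rewrite /T /div_fam (series_at_sum _ h p hf); apply: eq_bigr => j _; exact: dVS.
Qed.

Let QS j p : Q j p = M j p + \sum_(l < d) (h2 j l p.1 *: V l p +
  h1 l p.1 *: (P j l p - h2 j l p.1 *: B p - h1 l p.1 *: Q j p)).
Proof.
have hN : bounded_family (dfam fN j) (fun k => japanese R k * mw k) by apply: dfam_family => //; exact: fam_family.
have hs : bounded_family (fun k t => \sum_(l < d) dfam (fconv (grad eta l) (fV l)) j k t) (fun k => \sum_(l < d) japanese R k * mg k).
  split; first by move=> k; apply: half_line_bounded_sum => l; have [hb _] := dconv_family (Some (Some l)) l j.
  apply: nsum_lty_le (nsum_ltyZ (c := d%:R) _ _ jmg) => // k; last exact: mulr_ge0.
  by rewrite sumr_const card_ord mulr_natl.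
transitivity (series_at h (fun k t => dfam fN j k t + \sum_(l < d) dfam (fconv (grad eta l) (fV l)) j k t) p).
  rewrite /Q; congr (series_at h _ p); apply/funext => k; apply/funext => t.
  by rewrite /dfam fluxE mulrDr mulr_sumr.
rewrite (series_atD h p hN hs); congr (_ + _).
rewrite (series_at_sum _ h p (fun l => dconv_family (Some (Some l)) l j)); apply: eq_bigr => l _.
by rewrite dconv dVS.
Qed.

Let cT : continuous T := cont div_family.
Let cB : continuous B := cont (fam_family (Some None)).
Let cV j : continuous (V j) := cont (fam_family (Some (Some j))).
Let cQ j : continuous (Q j).
Proof. by apply: (@cont _ (fun k => japanese R k * mw k)); apply: dfam_family => //; exact: fam_family. Qed.

Let cP l j : continuous (P l j).
Proof. by apply: (@cont _ (fun k => japanese R k * ms k)); exact: dfam_family. Qed.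

Let harmonic : harmonic_on (below h) Phi.
Proof.
exact: (harmonic_below ch (surf1_continuous jeta) (surf2_continuous jeta) cT cB cV cQ cP dPhi dflux dPsi (surf1_derive jeta) fluxS PsiS TS QS).
Qed.

Let dx_pot j p : below h p -> dx j Phi p = V j p.
Proof. by move=> Dp; exact: (dxE dPhi PsiS). Qed.

Let dy_pot p : below h p -> dy Phi p = B p.
Proof. by move=> Dp; exact: (dyE dPhi PsiS). Qed.

Let periodic (f : K -> R -> C) x y j : series_at h f (x + (2 * pi) *: evec R j, y) = series_at h f (x, y).
Proof.
by rewrite /series_at /= surface_periodic; congr csum; apply/funext => k; rewrite expi_periodic.
Qed.

Let A : R := fine (nsum mw).
Let H : R := fine (nsum (fun k => normc (eta k))).

(** All modes decay at least like [e^(- t/2)], which gives the decay of the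
velocity at infinite depth. *)
Let B_le x y (u : R) : 0 <= u -> y <= - H - 2 * u -> normc (B (x, y)) <= expR (- u) * A.
Proof.
move=> u0 yu; apply: (@csum_norm_le _ _ _ (fun k => expR (- u) * mw k)) => [k|]; last first.
  by rewrite nsumZ ?expR_ge0// EFinM fineK// ge0_fin_numE ?nsum_ge0//; exact: drop_j.
rewrite normcM_expi /fb /fam normcZ ger0_norm ?expR_ge0//.
apply: ler_pM; [exact: expR_ge0|exact: normc_ge0| |exact: wsize_ge].
have hx : - H <= h x.
  have := Re_fourier_le x (asum_surface jeta); rewrite ler_norml => /andP[+ _].
  exact.
have t0 : 0 <= h x - y by lra.
by rewrite decay_eq//= ler_expR; lra.
Qed.

Lemma potential_exists : exists Phi (hx : 'I_d -> 'rV[R]_d -> C) (hy : 'rV[R]_d -> C),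
  [/\ is_potential h (fourier psi) Phi, forall j, trace h (dx j Phi) (hx j), trace h (dy Phi) hy &
   forall x, fourier (boundary_flux w) x = hy x - \sum_(j < d) 'D_(evec R j) h x *: hx j x].
Proof.
have tr (f f' : point -> C) : continuous f' -> (forall p, below h p -> f p = f' p) -> trace h f (fun x => f' (x, h x)).
  move=> cg fg x S hS.
  change (nbhs (x, h x) [set p : point | below h p -> S (f p)]).
  have hn : nbhs (x, h x) (f' @^-1` S) by exact: cg (x, h x) S hS.
  by apply: filterS hn => p Sp Dp; rewrite fg.
exists Phi, (fun j x => V j (x, h x)), (fun x => B (x, h x)); split.
- split.
  + by move=> x y j _; exact: periodic.
  + exact: harmonic.
  + apply: continuous_subspaceT; exact: cont phi_family.
  + by move=> x; rewrite /Phi /series_at /= subrr; congr csum; apply/funext => k; rewrite phi0.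
  + move=> eps e0; have A0 : 0 <= A by rewrite fine_ge0// nsum_ge0.
    exists (- H - 2 * (A / eps)); split; first exact: num_real.
    move=> y yH x; have u0 : 0 <= A / eps by rewrite divr_ge0// ltW.
    have Dp : below h (x, y).
      have := Re_fourier_le x (asum_surface jeta); rewrite ler_norml => /andP[+ _].
      by rewrite /below /= -/H -/(real_fourier eta x); lra.
    rewrite dy_pot//; apply: le_lt_trans (B_le x u0 (ltW yH)) _.
    rewrite expRN mulrC ltr_pdivrMr ?expR_gt0//.
    apply: lt_le_trans (ler_wpM2l (ltW e0) (expR_ge1Dx _)).
    by rewrite mulrDr mulr1 [eps * _]mulrC divfK ?gt_eqF// ltrDr.
- by move=> j; apply: tr => // p; exact: dx_pot.
- by apply: tr => // p; exact: dy_pot.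
- move=> x; have -> : B (x, h x) = N (x, h x) + \sum_(j < d) h1 j x *: V j (x, h x) by exact: fluxS.
  have -> : fourier (boundary_flux w) x = N (x, h x).
    by rewrite /N /series_at /= subrr; congr csum; apply/funext => k; rewrite /fN /fam decay0 scale1r.
  rewrite -[LHS](addrK (\sum_(j < d) h1 j x *: V j (x, h x))); congr (_ - _); apply: eq_bigr => j _.
  by have [_ ->] := surface_derive jeta x (evec R j); rewrite sum_evecR.
Qed.

End potential.

(** * The maximum principle and uniqueness *)

Section second_order.
Variables (R : realType) (V : normedModType R).

Lemma derive_pos_increase (F : V -> R) p v g (r : R) : is_derive p v F g -> 0 < g -> 0 < r ->
  exists t : R, [/\ 0 < t, t < r & F p < F (t *: v + p)].
Proof.
move=> /is_derive_cvgP h g0 r0.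
have hn : \forall t \near (0 : R)^', 0 < t^-1 *: (F (t *: v + p) - F p).
  exact: (h _ (open_nbhs_nbhs (conj (@open_gt R 0) g0))).
move: hn => /nbhs_ballP[e e0 he]; pose t := Num.min e r / 2.
have m0 : 0 < Num.min e r by rewrite lt_min e0 r0.
have t0 : 0 < t by rewrite divr_gt0.
have tm : t < Num.min e r by rewrite /t; lra.
have [te tr] : t < e /\ t < r by move: tm; rewrite lt_min => /andP.
exists t; split => //; rewrite -subr_gt0.
have /= := he t; rewrite /ball /= sub0r normrN gtr0_norm// => /(_ te (lt0r_neq0 t0)).
by rewrite [_ *: _]mulrC pmulr_lgt0 ?invr_gt0.
Qed.

(** If the second derivative were positive, the first derivative would increase
through the point, so that the function would increase strictly from it in the
direction given by the sign of the first derivative. *)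
Lemma second_derivative_max (D : set V) (F G : V -> R) p v c : open D -> D p ->
  (forall q, D q -> is_derive q v F (G q)) -> is_derive p v G c ->
  (forall q, D q -> F q <= F p) -> c <= 0.
Proof.
move=> oD Dp hF /is_derive_cvgP hG mx; rewrite leNgt; apply/negP => c0.
have line : \forall t \near (0 : R), D (t *: v + p).
  have cl : {for (0 : R), continuous (fun t : R => t *: v + p)}.
    by apply: cvgD; [apply: cvgZl; exact: cvg_id|exact: cvg_cst].
  by apply: cl; rewrite /= scale0r add0r; exact: open_nbhs_nbhs.
have hn : \forall t \near (0 : R)^', 0 < t^-1 *: (G (t *: v + p) - G p).
  exact: (hG _ (open_nbhs_nbhs (conj (@open_gt R 0) c0))).
move: hn line => /nbhs_ballP[e e0 he] /nbhs_ballP[e' e'0 he'].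
pose r := Num.min e e' / 2.
have m0 : 0 < Num.min e e' by rewrite lt_min e0 e'0.
have r0 : 0 < r by rewrite divr_gt0.
have rm : r < Num.min e e' by rewrite /r; lra.
have [re re'] : r < e /\ r < e' by move: rm; rewrite lt_min => /andP.
have inD t : `|t| <= r -> D (t *: v + p).
  by move=> tr; apply: he'; rewrite /ball /= sub0r normrN (le_lt_trans tr).
have gs t : 0 < `|t| -> `|t| <= r -> 0 < t^-1 * (G (t *: v + p) - G p).
  move=> t0 tr; apply: he; last by rewrite -normr_gt0.
  by rewrite /ball /= sub0r normrN (le_lt_trans tr).
pose f (t : R) := F (t *: v + p).
have df t : `|t| <= r -> is_derive t (1 : R) f (G (t *: v + p)).
  move=> tr; apply/is_derive_line; have /is_derive_line := hF _ (inD t tr).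
  apply: near_eq_is_derive; near=> u; rewrite /f; congr F.
  by rewrite scaler1 scalerDl addrA.
have f0 : f 0 = F p by rewrite /f scale0r add0r.
have mvt a b : a < b -> - r <= a -> b <= r -> exists t, [/\ a < t, t < b & f b - f a = G (t *: v + p) * (b - a)].
  move=> ab ra br.
  have inr t : a <= t -> t <= b -> `|t| <= r by move=> at_ tb; rewrite ler_norml; apply/andP; split; lra.
  have [] := @MVT R f (fun t => G (t *: v + p)) a b ab.
  - by move=> t; rewrite in_itv/= => /andP[at_ tb]; apply: df; apply: inr; exact: ltW.
  - apply: derivable_within_continuous => t; rewrite in_itv/= => /andP[at_ tb].
    by have [] := df t (inr t at_ tb).
  by move=> t; rewrite in_itv/= => /andP[at_ tb] E; exists t.
have [G0|G0] := leP 0 (G p).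
  have [||t [t0 tr E]] := mvt 0 r r0; [lra|lra|].
  have : 0 < f r - f 0.
    rewrite E subr0 mulr_gt0//; have := gs t; rewrite gtr0_norm// => /(_ t0 (ltW tr)).
    by rewrite pmulr_rgt0 ?invr_gt0//; lra.
  have rr : `|r| <= r by rewrite gtr0_norm.
  by have := mx _ (inD r rr); rewrite f0 -/(f r); lra.
have rn : - r < 0 by lra.
have [||t [t0 tr E]] := mvt (- r) 0 rn; [lra|lra|].
have : 0 < f (- r) - f 0.
  have tn : `|t| = - t by rewrite ltr0_norm.
  have := gs t; rewrite tn => /(_ _ _) h; have {h} : 0 < t^-1 * (G (t *: v + p) - G p) by apply: h; lra.
  rewrite nmulr_rgt0 ?invr_lt0// => h.
  rewrite -opprB E sub0r opprK -mulNr mulr_gt0//; lra.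
have rr : `|- r| <= r by rewrite normrN gtr0_norm.
by have := mx _ (inD (- r) rr); rewrite f0 -/(f (- r)); lra.
Unshelve. all: by end_near. Qed.

End second_order.

Section maximum_principle.
Variables (R : realType) (d : nat).
Local Notation point := ('rV[R]_d * R)%type.
Variables (h : 'rV[R]_d -> R) (H : R) (u : point -> R).
Hypothesis ch : continuous h.
Hypothesis hp : forall x j, h (x + (2 * pi) *: evec R j) = h x.
Hypothesis hH : forall x, `|h x| <= H.
Hypothesis cu : {within closed_below h, continuous u}.
Hypothesis up : forall x y j, closed_below h (x, y) -> u (x + (2 * pi) *: evec R j, y) = u (x, y).
Hypothesis u0 : forall x, u (x, h x) = 0.
Variables (G S : point -> point -> R).
Hypothesis dG : forall v p, below h p -> is_derive p v u (G v p).
Hypothesis dS : forall v p, below h p -> is_derive p v (G v) (S v p).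
Hypothesis laplace : forall p, below h p -> \sum_(j < d) S (evec R j, 0) p + S (0, 1) p = 0.
Hypothesis decay : forall e : R, 0 < e -> \forall y \near -oo, forall x, `|G (0, 1) (x, y)| < e.

Let same x x' := h x' = h x /\ forall y, y <= h x -> u (x', y) = u (x, y).

Let same_sym x x' : same x x' -> same x' x.
Proof. by move=> [a b]; split=> // y yh; rewrite b// -a. Qed.

Let same_trans x y z : same x y -> same y z -> same x z.
Proof. by move=> [a b] [a' b']; split=> [|t th]; rewrite ?a' ?a// b' ?b// a. Qed.

Let same_step x j (n : int) : same x (x + (2 * pi * n%:~R) *: evec R j).
Proof.
have P (m : nat) z : same z (z + (2 * pi * m%:R) *: evec R j).
  elim: m z => [|m ih] z; first by rewrite mulr0 scale0r addr0.
  apply: same_trans (ih z) _; set z' := z + _.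
  have -> : z + (2 * pi * m.+1%:R) *: evec R j = z' + (2 * pi) *: evec R j.
    have e : m.+1%:R = m%:R + 1 :> R by rewrite natr1.
    by rewrite /z' -addrA -scalerDl e mulrDr mulr1.
  by split=> [|y yh]; [exact: hp|exact: up].
case: n => n; first exact: P.
apply: same_sym; rewrite NegzE mulrNz mulrN scaleNr -pmulrn.
by have := P n.+1 (x - (2 * pi * n.+1%:R) *: evec R j); rewrite subrK.
Qed.

Let in_cube x : exists x', same x x' /\ forall j, 0 <= x' ord0 j <= 2 * pi.
Proof.
suff : forall s : seq 'I_d, exists x', same x x' /\ forall j, j \in s -> 0 <= x' ord0 j <= 2 * pi.
  move=> /(_ (index_enum 'I_d)) [x' [xx hx']]; exists x'; split => // j; apply: hx'.
  exact: mem_index_enum.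
elim=> [|j s [x' [xx hx']]]; first by exists x.
have pi2 : 0 < 2 * pi :> R by rewrite mulr_gt0// pi_gt0.
pose n := Num.floor (x' ord0 j / (2 * pi)).
exists (x' + (2 * pi * (- n)%:~R) *: evec R j); split.
  exact: same_trans xx (same_step _ _ _).
have E i : (x' + (2 * pi * (- n)%:~R) *: evec R j) ord0 i = x' ord0 i + (if i == j then 2 * pi * (- n)%:~R else 0).
  by rewrite !mxE eqxx /=; case: eqP => _; rewrite ?mulr1 ?mulr0.
move=> i; rewrite in_cons E; case: eqVneq => [->|_] /=; last by rewrite addr0; exact: hx'.
move=> _; have /andP[n1 n2] := floor_itv (x' ord0 j / (2 * pi)).
move: n1 n2; rewrite -/n rmorphD/= ler_pdivlMr// ltr_pdivrMr// rmorphN/= mulrN => n1 n2.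
apply/andP; split; lra.
Qed.

Let dsnd (v q : point) : is_derive q v (fun q : point => q.2) v.2.
Proof.
apply/is_derive_line; have -> : (fun t : R => (t *: v + q).2) = fun t => v.2 * t + q.2.
  by apply/funext => t; rewrite mulrC.
by apply: derive_eq (dD (dMl v.2 (is_derive_id (0 : R) 1)) (dcst _ _ _)) _; rewrite addr0 mulr1.
Qed.

Let closed_below_closed : closed (closed_below h).
Proof.
have -> : closed_below h = ~` [set p : point | h p.1 - p.2 < 0].
  by apply/seteqP; split=> p /=; rewrite /closed_below /= subr_lt0 leNgt => /negP.
apply: open_closedC; apply: (@open_comp _ _ (fun p : point => h p.1 - p.2) [set y | y < 0]); last exact: open_lt.
move=> p _; apply: cvgB; last exact: cvg_snd.
by apply: (@continuous_comp _ _ _ (fun q : point => q.1) h); [exact: cvg_fst|exact: ch].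
Qed.

(** If [u] were positive somewhere, then [F = u + delta (y - H) + eps (y -
Y)^2] with small [delta] and [eps] would have an interior maximum, although its
Laplacian is [2 eps > 0]. The maximum exists because periodicity reduces the
region between the height [Y] and the surface to a compact set. It is not at
the top, where [u] vanishes and the other terms are small, and not at the
bottom, where the vertical derivative of [u] exceeds [- delta]. *)
Lemma maximum_principle p : closed_below h p -> u p <= 0.
Proof.
move=> Dp; rewrite leNgt; apply/negP => up0.
case: p Dp up0 => x0 y0 Dp up0.
have hle x : h x <= H by apply: le_trans (ler_norm _) _.
have hge x : - H <= h x by have := hH x; rewrite ler_norml => /andP[].
have yH : y0 <= H by apply: le_trans Dp (hle x0).
pose c := u (x0, y0).
(* The linear term lowers the value at the given point by at most one half. *)
pose delta := c / (2 * (H - y0) + 2).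
have D0 : 0 < 2 * (H - y0) + 2 by lra.
have delta0 : 0 < delta by rewrite divr_gt0.
have deltac : delta * (H - y0) <= c / 2.
  rewrite /delta mulrAC ler_pdivrMr//.
  by have : 0 < c by []; lra.
have [Y0 [_ hY0]] := decay delta0.
(* The bottom lies below the surface and below the given point, at a height
where the vertical derivative is smaller than [delta]. *)
pose Y := Num.min (Y0 - 1) (Num.min (- H - 1) (y0 - 1)).
have YY0 : Y < Y0 by rewrite /Y gt_min; apply/orP; left; lra.
have YH : Y < - H by rewrite /Y !gt_min; apply/orP; right; apply/orP; left; lra.
have Yy : Y < y0 by rewrite /Y !gt_min; apply/orP; right; apply/orP; right; lra.
(* The quadratic term stays below half the value at the given point. *)
pose eps := c / (2 * (H - Y) ^+ 2 + 2).
have E0 : 0 < 2 * (H - Y) ^+ 2 + 2 by have := sqr_ge0 (H - Y); lra.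
have eps0 : 0 < eps by rewrite divr_gt0.
have epsc : eps * (H - Y) ^+ 2 < c / 2.
  rewrite /eps mulrAC ltr_pdivrMr//.
  by have : 0 < c by []; lra.
pose g (p : point) : R := delta * (p.2 - H) + eps * (p.2 - Y) ^+ 2.
pose F (p : point) := u p + g p.
have Fp : c / 2 <= F (x0, y0).
  rewrite /F /g /= -/c; have : 0 <= eps * (y0 - Y) ^+ 2 by rewrite mulr_ge0 ?sqr_ge0// ltW.
  lra.
have Ftop x : F (x, h x) < c / 2.
  rewrite /F /g /= u0 add0r; have : delta * (h x - H) <= 0 by rewrite pmulr_rle0// subr_le0.
  have : eps * (h x - Y) ^+ 2 <= eps * (H - Y) ^+ 2.
    rewrite ler_pM2l// lerXn2r ?nnegrE//; have := hle x; have := hge x; lra.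
  lra.
pose cube := [set x : 'rV[R]_d | forall j, `[0, 2 * pi]%classic (x ord0 j)].
pose K := (cube `*` `[Y, H]%classic) `&` closed_below h.
have cC : compact cube.
  exact: (@rV_compact R d (fun=> `[0, 2 * pi]%classic) (fun=> @segment_compact R 0 (2 * pi))).
have cK : compact K.
  apply: (@subclosed_compact _ _ (cube `*` `[Y, H]%classic)).
  - apply: closedI; last exact: closed_below_closed.
    apply: compact_closed; first exact: (@norm_hausdorff R point).
    apply: compact_setX; last exact: segment_compact.
    exact: cC.
  - apply: compact_setX; last exact: segment_compact.
    exact: cC.
  - by move=> q [].
have sF x x' y : same x x' -> y <= h x -> F (x', y) = F (x, y).
  by move=> [_ a] yh; rewrite /F /g /= a.
have cF : {within K, continuous F}.
  have cu' : {within K, continuous u} by apply: continuous_subspaceW cu => q [].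
  have cg : continuous g.
    have cs (a : R) : continuous (fun q : point => q.2 - a).
      by move=> q; apply: cvgB; [exact: cvg_snd|exact: cvg_cst].
    move=> q; apply: cvgD; first by apply: cvgM; [exact: cvg_cst|exact: cs].
    by apply: cvgM; [exact: cvg_cst|exact: (cvgM (cs Y q) (cs Y q))].
  have cg' := continuous_subspaceT (A := K) cg.
  by move=> q; apply: continuousD; [exact: cu'|exact: cg'].
have toK x y : Y <= y -> y <= h x -> exists x', K (x', y) /\ F (x', y) = F (x, y).
  move=> Yy' yh; have [x' [xx cx]] := in_cube x; exists x'; split; last exact: sF.
  split; last by rewrite /closed_below /=; have [-> _] := xx.
  split => /=; first by move=> j; rewrite /= in_itv/=; exact: cx.
  by rewrite in_itv/= Yy' (le_trans yh (hle x)).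
have K0 : K !=set0.
  by have [x' [h1 _]] := toK x0 y0 (ltW Yy) Dp; exists (x', y0).
have [[xm ym] qK qmax] := compact_EVT_max K0 cK cF.
have gmax x y : Y <= y -> y <= h x -> F (x, y) <= F (xm, ym).
  by move=> h1 h2; have [x' [h3 <-]] := toK x y h1 h2; apply: qmax; exact: mem_set.
move: qK => /set_mem [[_ /=]]; rewrite in_itv/= => /andP[Ym _] ymh.
have Fm : c / 2 <= F (xm, ym) by apply: le_trans Fp (gmax _ _ (ltW Yy) Dp).
have ymlt : ym < h xm.
  rewrite lt_neqAle ymh andbT; apply/eqP => e; have := Ftop xm; rewrite -e; lra.
have dF (v : point) q : below h q -> is_derive q v F (G v q + delta * v.2 + eps * (2 * (q.2 - Y) * v.2)).
  move=> bq; have ds a := dB (dsnd v q) (dcst q v (a : R)).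
  have -> : F = fun p => u p + (delta * (p.2 - H) + eps * ((p.2 - Y) * (p.2 - Y))).
    by apply/funext => p; rewrite /F /g expr2.
  apply: derive_eq (dD (dG v bq) (dD (dMl delta (ds H)) (dMl eps (dM (ds Y) (ds Y))))) _.
  by rewrite !subr0; ring.
have dF2 (v : point) q : below h q ->
  is_derive q v (fun q : point => G v q + delta * v.2 + eps * (2 * (q.2 - Y) * v.2)) (S v q + eps * (2 * v.2 * v.2)).
  move=> bq; have ds := dB (dsnd v q) (dcst q v (Y : R)).
  have -> : (fun q : point => G v q + delta * v.2 + eps * (2 * (q.2 - Y) * v.2)) =
      fun q : point => G v q + (delta * v.2 + (eps * 2 * v.2) * (q.2 - Y)).
    by apply/funext => q'; ring.
  apply: derive_eq (dD (dS v bq) (dD (dcst _ _ (delta * v.2)) (dMl (eps * 2 * v.2) ds))) _.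
  by rewrite subr0; ring.
have Ylt : Y < ym.
  rewrite lt_neqAle Ym andbT; apply/eqP => e.
  have bq : below h (xm, ym) by [].
  have g0 : 0 < G (0, 1) (xm, ym) + delta * 1 + eps * (2 * (ym - Y) * 1).
    rewrite -e subrr mulr0 mul0r mulr0 addr0 mulr1; have := hY0 Y YY0 xm; rewrite ltr_norml => /andP[]; lra.
  have hr : 0 < h xm - ym by lra.
  have [t [t0 tr]] := derive_pos_increase (dF (0, 1) (xm, ym) bq) g0 hr.
  rewrite /=; apply/negP; rewrite -leNgt.
  have -> : t *: ((0, 1) : point) + (xm, ym) = (xm, t + ym).
    by congr pair => /=; rewrite ?scaler0 ?add0r// [_ *: _]mulr1.
  by apply: gmax; lra.
pose O : set point := [set q | Y < q.2 /\ q.2 < h q.1].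
have oO : open O.
  have -> : O = below h `&` [set q | Y < q.2] by apply/seteqP; split=> q [].
  apply: openI; first exact: below_open.
  by apply: (@open_comp _ _ (fun q : point => q.2) [set y | Y < y]) => [q _|]; [exact: cvg_snd|exact: open_gt].
have Oq : O (xm, ym) by [].
have mO q : O q -> F q <= F (xm, ym) by case: q => x y [/= /ltW h1 /ltW h2]; exact: gmax.
have sec v : S v (xm, ym) + eps * (2 * v.2 * v.2) <= 0.
  apply: (second_derivative_max oO Oq _ (dF2 v (xm, ym) ymlt) mO) => q [_ hq]; exact: dF.
have sx : \sum_(j < d) S (evec R j, 0) (xm, ym) <= 0.
  by apply: sumr_le0 => j _; have := sec (evec R j, 0); rewrite /= mulr0 mulr0 addr0.
have := sec (0, 1); rewrite /= !mulr1; have := @laplace (xm, ym) ymlt; lra.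
Qed.

End maximum_principle.

Section uniqueness.
Variables (R : realType) (d : nat).
Local Notation C := (Rcomplex R).
Local Notation point := ('rV[R]_d * R)%type.
Variables (h : 'rV[R]_d -> R) (H : R) (psi : 'rV[R]_d -> C).
Hypothesis ch : continuous h.
Hypothesis hp : forall x j, h (x + (2 * pi) *: evec R j) = h x.
Hypothesis hH : forall x, `|h x| <= H.

(** The maximum principle applies to the image of the difference of two
potentials under a real-linear form of norm one, such as the real part. *)
Lemma potential_le (L : C -> R) Phi1 Phi2 : {morph L : a b / a - b} ->
  (forall (a : R) z, L (a *: z) = a * L z) -> (forall z, `|L z| <= normc z) ->
  is_potential h psi Phi1 -> is_potential h psi Phi2 ->
  forall p, closed_below h p -> L (Phi1 p) <= L (Phi2 p).
Proof.
move=> LB LZ Ln [per1 [[c1 cc1] l1] w1 b1 d1] [per2 [[c2 cc2] l2] w2 b2 d2] p Dp.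
have L0 : L 0 = 0 by rewrite -(scale0r (0 : C)) LZ mul0r.
have LD a b : L (a + b) = L a + L b.
  by rewrite -[b in LHS]opprK LB -[- b in LHS]scaleN1r LZ mulN1r opprK.
have cLf (T : Type) (F : set_system T) (FF : Filter F) (f : T -> C) (l : C) :
    f x @[x --> F] --> l -> L (f x) @[x --> F] --> L l.
  move=> /cvgrPdist_lt hf; apply/cvgrPdist_lt => e e0; apply: filterS (hf e e0) => x.
  by apply: le_lt_trans; rewrite -LB; exact: Ln.
have cL : continuous L by move=> z; exact: (cLf _ _ (nbhs_filter z) id z cvg_id).
have isL (f : point -> C) v q df : is_derive q v f df -> is_derive q v (fun x => L (f x)) (L df).
  apply: (@is_derive_lin R _ C R L 1) => // z; rewrite mul1r; exact: Ln.
rewrite -subr_le0.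
apply: (@maximum_principle R d h H (fun p => L (Phi1 p) - L (Phi2 p)) ch hp hH _ _ _
  (fun v p => L ('D_v Phi1 p) - L ('D_v Phi2 p))
  (fun v p => L ('D_v ('D_v Phi1) p) - L ('D_v ('D_v Phi2) p)) _ _ _ _ p Dp).
- have cont (f : point -> C) : {within closed_below h, continuous f} -> {within closed_below h, continuous (fun p => L (f p))}.
    move=> /subspace_continuousP cf; apply/subspace_continuousP => q Aq.
    by apply: (cLf _ _ _ f); exact: cf.
  have k1 := cont _ w1; have k2 := cont _ w2.
  by move=> q; apply: continuousB; [exact: k1|exact: k2].
- by move=> x y j hy; rewrite per1 ?per2.
- by move=> x; rewrite b1 b2 subrr.
- move=> v q Dq; have [h1 _] := c1 v q Dq; have [h2 _] := c2 v q Dq.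
  exact: dB (isL Phi1 v q _ (derivableP h1)) (isL Phi2 v q _ (derivableP h2)).
- move=> v q Dq; have [h1 _] := cc1 v v q Dq; have [h2 _] := cc2 v v q Dq.
  exact: dB (isL ('D_v Phi1) v q _ (derivableP h1)) (isL ('D_v Phi2) v q _ (derivableP h2)).
- move=> q Dq; have Lsum (F : 'I_d -> C) : L (\sum_(j < d) F j) = \sum_(j < d) L (F j).
    by elim: (index_enum 'I_d) => [|j s ih]; rewrite ?big_nil// !big_cons LD ih.
  have E (Phi : point -> C) : L (laplacian Phi q) = \sum_(j < d) L ('D_(evec R j, 0) ('D_(evec R j, 0) Phi) q) + L ('D_(0, 1) ('D_(0, 1) Phi) q).
    by rewrite /laplacian LD Lsum.
  rewrite sumrB addrACA -opprD -!E.
  by rewrite l1// l2// subrr.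
- move=> e e0; have e2 : 0 < e / 2 by rewrite divr_gt0.
  have := d1 _ e2; have := d2 _ e2; apply: filterS2 => y h2 h1 x.
  apply: le_lt_trans (ler_normB _ _) _; rewrite [ltRHS]splitr; apply: ltrD.
    exact: le_lt_trans (Ln _) (h1 x).
  exact: le_lt_trans (Ln _) (h2 x).
Unshelve. all: by end_near. Qed.

Lemma potential_unique Phi1 Phi2 : is_potential h psi Phi1 -> is_potential h psi Phi2 ->
  {in closed_below h, Phi1 =1 Phi2}.
Proof.
move=> h1 h2 p /set_mem Dp.
have re A B : is_potential h psi A -> is_potential h psi B -> complex.Re (A p) <= complex.Re (B p).
  move=> hA hB; apply: (@potential_le (fun z => complex.Re z) A B _ _ _ hA hB p Dp).
  - by move=> [a b] [a' b'].
  - by move=> a [b b'].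
  - exact: normc_Re.
have im A B : is_potential h psi A -> is_potential h psi B -> complex.Im (A p) <= complex.Im (B p).
  move=> hA hB; apply: (@potential_le (fun z => complex.Im z) A B _ _ _ hA hB p Dp).
  - by move=> [a b] [a' b'].
  - by move=> a [b b'].
  - exact: normc_Im.
by rewrite [LHS]complexE [RHS]complexE; congr Complex; apply/eqP; rewrite eq_le ?re ?im.
Qed.

End uniqueness.

(** * The Dirichlet-Neumann map *)

Theorem theorem1p2 (R : realType) (d : nat) (hd : (1 <= d)%N) :
  exists eps0 C : R -> R,
  forall (sigma s : R) (s0 : nat),
    0 <= sigma ->
    (exists2 n : nat, (1 <= n)%N & s + 1 / 2 = n%:R) ->
    (1 <= s0)%N ->
    s0%:R <= s - 3 / 2 ->
    (d%:R + 1) / 2 < s0%:R :> R ->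
  0 < eps0 s /\
  exists G : rsobolev d sigma s -> bop d sigma s sigma (s - 1),
  let U := [set eta : rsobolev d sigma s |
              sobolev_ball sigma (s0%:R + 3 / 2) (eps0 s) eta] in
  [/\ forall (eta : rsobolev d sigma s) (psi : sobolev d sigma s), U eta ->
        is_dirichlet_neumann (real_fourier eta) (fourier psi)
          (fourier (G eta psi)),
      analytic_on U G &
      forall (eta : rsobolev d sigma s) (psi : sobolev d sigma s), U eta ->
        (hnorm sigma (s - 1)%R (G eta psi) <=
         (C s)%:E * (hnorm sigma s psi +
           hnorm sigma s eta * hnorm sigma (s0%:R + 3 / 2)%R psi))%E].
Proof.
exists (dn_radius d), (fun s => 4 + 16 * op_const d s).
move=> sigma s s0 sg _ _ s0s ds0.
(* The low index, one derivative below the norm in which the surface is small.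
*)
pose r0 : R := s0%:R + 1 / 2.
have r01 : r0 + 1 = s0%:R + 3 / 2 by rewrite /r0; lra.
have r0s : r0 <= s - 1 by rewrite /r0; lra.
have d1 : d.+1%:R = d%:R + 1 :> R by rewrite natr1.
(* Both [d + 1] and [2 s0] are integers, so the strict inequality gains one. *)
have ds : d%:R + 2 <= 2 * s0%:R :> R.
  have : (d.+1%:R < (2 * s0)%N%:R :> R) by rewrite d1 natrM; lra.
  by rewrite ltr_nat -(ler_nat R) natrM -natr1 d1; lra.
have r0_large : d.+1%:R <= 2 * r0 by rewrite d1 /r0; lra.
have s_large : d.+1%:R <= 2 * (s - 2) by rewrite d1; lra.
have rs : r0 + 1 <= s by lra.
split; first exact: dn_radius_gt0.
exists (dno hd sg r0_large r0s) => U.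
have smallP (eta : rsobolev d sigma s) : U eta -> small r0 eta.
  by rewrite /U /sobolev_ball /= -r01 -(snorm_hnorm _ rs) lte_fin.
split.
- move=> eta psi /smallP hs; rewrite dnoE.
  set w := solve _ _ _ _ _ _.
  have wE : w = flat psi + op hd sg r0_large r0s eta w by exact: solveP.
  have [Phi [hx [hy [pot tx ty hg]]]] := potential_exists s_large wE.
  exists Phi, hx, hy; split=> //; split=> // Phi' pot'.
  have je : (nsum (fun k => japanese R k * jweight eta k)%R < +oo)%E.
    exact: (japanese_nsum hd sg s_large (snorm_ge0 _ _) (jweight_ge0 eta) (snorm_jweight eta (lexx _))).
  have bound x := Re_fourier_le x (asum_surface je).
  exact: (potential_unique (surface_continuous je) (@surface_periodic R d eta) bound pot' pot).
- by move=> eta /smallP hs; exact: dno_analytic.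
- by move=> eta psi /smallP hs; rewrite -r01; exact: dno_tame.
Qed.
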